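(* Let $\mathbf{x}:(M,g)\longrightarrow\mathbb{S}^{m}_s(1)\subset\mathbb{E}^{m+1}_s$ be a non-totally geodesic isometric immersion of a spacelike surface $M$ in the pseudo-sphere $\mathbb{S}^{m}_s(1)$. The pseudo-spherical Gauss map of the immersion is harmonic if and only if there exists a local isothermal coordinate system $\{u,v\}$ on $M$ such that $g=\mu^2(du^2+dv^2)$ and $\mathbf{x}$ is a solution of the system \begin{align*} \mathbf{x}_{uu}&=\frac{\mu_u}{\mu}\mathbf{x}_u-\frac{\mu_v}{\mu}\mathbf{x}_v-\mu^2\mathbf{x}+c,\\ \mathbf{x}_{uv}&=\frac{\mu_v}{\mu}\mathbf{x}_u+\frac{\mu_u}{\mu}\mathbf{x}_v,\\ \mathbf{x}_{vv}&=-\frac{\mu_u}{\mu}\mathbf{x}_u+\frac{\mu_v}{\mu}\mathbf{x}_v-\mu^2\mathbf{x}-c, \end{align*} where $\mu$ satisfies the equation $(\ln\mu)_{uu}+(\ln\mu)_{vv}=-\mu^2$ and $c$ is a fixed lightlike vector in $\mathbb{E}^{m+1}_s$.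
   Context: $\mathbb{E}^{m}_s$ denotes $\mathbb{R}^m$ with the metric $ds^2=\sum_{i=1}^{m-s}dx_i^2-\sum_{j=m-s+1}^{m}dx_j^2$ and associated inner product $\langle\cdot,\cdot\rangle$. The pseudo-sphere of dimension $m$ and index $s$ is $\mathbb{S}^m_s(1)=\{x\in\mathbb{E}^{m+1}_s \mid \langle x,x\rangle=1\}$ with the induced metric. A vector $v$ is lightlike if $\langle v,v\rangle=0$ and $v\neq0$. A surface in $\mathbb{S}^m_s(1)$ is an isometrically immersed 2-dimensional oriented (pseudo-)Riemannian manifold; it is spacelike if its induced metric $g$ is Riemannian. The immersion is totally geodesic if its second fundamental form in $\mathbb{S}^m_s(1)$ vanishes identically. Subscripts $u,v$ denote partial derivatives, with $\mathbf{x}$ regarded as an $\mathbb{E}^{m+1}_s$-valued function. Pseudo-spherical Gauss map: $\bigwedge^{3}\mathbb{E}^{m+1}_s$ carries the pseudo-Euclidean inner product determined by $\langle\langle f_{i_1}\wedge f_{i_2}\wedge f_{i_3},\, g_{j_1}\wedge g_{j_2}\wedge g_{j_3}\rangle\rangle=\det(\langle f_{i_\ell},g_{j_k}\rangle)$ and is thereby identified with a pseudo-Euclidean space $\mathbb{E}^N_q$, $N=\binom{m+1}{3}$. The pseudo-spherical Gauss map of $M$ is $\nu:M\to\bigwedge^3\mathbb{E}^{m+1}_s=\mathbb{E}^N_q$, $\nu(p)=\mathbf{x}(p)\wedge e_1\wedge e_2$, where $\{e_1,e_2\}$ is any positively oriented orthonormal basis of $T_pM$. The map $\nu$ is called harmonic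 if $\Delta\nu=0$, where $\Delta$ is the Laplacian of $(M,g)$ acting componentwise on the $\mathbb{E}^N_q$-valued map $\nu$ (i.e. harmonic as a map into $\mathbb{E}^N_q$, not merely as a map into the Grassmannian).
   Formalization: ''There exists a local isothermal coordinate system on M'' is taken as: around every point where the second fundamental form does not vanish; around every point, harmonic ⇒ system fails at isolated geodesic points, and with a single chart somewhere on M the converse fails. *)

(* Defs.v *)
From HB Require Import structures.
From mathcomp Require Import all_boot all_order all_algebra.
From mathcomp Require Import all_classical all_reals all_analysis.

Set Implicit Arguments.
Unset Strict Implicit.
Unset Printing Implicit Defensive.

Import Order.TTheory GRing.Theory Num.Theory.
Import numFieldNormedType.Exports.

Local Open Scope classical_set_scope.
Local Open Scope ring_scope.

(** * Calculus in the coordinate plane *)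

Definition pd (R : realType) (V : normedModType R) (i : 'I_2)
    (f : 'rV[R]_2 -> V) (q : 'rV[R]_2) : V :=
  'D_(delta_mx 0 i) f q.

(* [f] is of class C^k on [U]; only used for open [U]. *)
Fixpoint Ck_on (R : realType) (V : normedModType R) (k : nat)
    (U : set 'rV[R]_2) (f : 'rV[R]_2 -> V) : Prop :=
  (forall q, U q -> {for q, continuous f}) /\
  match k with
  | 0 => True
  | k'.+1 => forall i : 'I_2,
      (forall q, U q -> derivable f q (delta_mx 0 i)) /\ Ck_on k' U (pd i f)
  end.

Definition smooth_on (R : realType) (V : normedModType R)
    (U : set 'rV[R]_2) (f : 'rV[R]_2 -> V) : Prop :=
  forall k, Ck_on k U f.

(* Row [i] is the i-th partial derivative of [f]. *)
Definition jac (R : realType) (n : nat) (f : 'rV[R]_2 -> 'rV[R]_n.+1)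
    (q : 'rV[R]_2) : 'M[R]_(2, n.+1) :=
  \matrix_(i < 2) pd i f q.

(** * Smooth oriented surfaces *)

(* A homeomorphism between an open set of [M] and an open set of R^2; [cmap]
   and [cinv] are total functions whose values elsewhere are irrelevant. *)
Record chart (R : realType) (M : topologicalType) := Chart {
  cdom : set M;
  cmap : M -> 'rV[R]_2;
  cinv : 'rV[R]_2 -> M;
  cdom_open : open cdom;
  cimg_open : open (cmap @` cdom);
  cmapK : forall p, cdom p -> cinv (cmap p) = p;
  cmap_continuous : forall p, cdom p -> {for p, continuous cmap};
  cinv_continuous : forall q, (cmap @` cdom) q -> {for q, continuous cinv}
}.

Definition cimg (R : realType) (M : topologicalType) (phi : chart R M) :
  set 'rV[R]_2 := cmap phi @` cdom phi.

Definition transition (R : realType) (M : topologicalType)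
    (phi psi : chart R M) : 'rV[R]_2 -> 'rV[R]_2 :=
  cmap psi \o cinv phi.

Definition smooth_transition (R : realType) (M : topologicalType)
    (phi psi : chart R M) : Prop :=
  smooth_on (cmap phi @` (cdom phi `&` cdom psi)) (transition phi psi).

(* The atlas need not be maximal; its charts are the positively oriented
   reference charts. *)
Record oriented_surface (R : realType) (M : topologicalType) :=
  OrientedSurface {
  atlas : set (chart R M);
  surface_hausdorff : hausdorff_space M;
  surface_second_countable : @second_countable M;
  atlas_cover : forall p : M, exists2 phi, atlas phi & cdom phi p;
  atlas_smooth : forall phi psi, atlas phi -> atlas psi ->
    smooth_transition phi psi;
  atlas_oriented : forall phi psi p, atlas phi -> atlas psi ->
    cdom phi p -> cdom psi p ->
    0 < \det (jac (transition phi psi) (cmap phi p))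
}.

(* The charts of the maximal smooth atlas, of either orientation. *)
Definition coordinate_system (R : realType) (M : topologicalType)
    (S : oriented_surface R M) (phi : chart R M) : Prop :=
  forall psi, atlas S psi ->
    smooth_transition phi psi /\ smooth_transition psi phi.

(* [metric_coef phi q] is the matrix (g_ij) in the coordinates [phi] at the
   point with coordinate vector [q]. *)
Record riemannian_metric (R : realType) (M : topologicalType)
    (S : oriented_surface R M) := RiemannianMetric {
  metric_coef : chart R M -> 'rV[R]_2 -> 'M[R]_2;
  metric_smooth : forall phi, coordinate_system S phi ->
    forall i j, smooth_on (V := R^o) (cimg phi)
      (fun q => metric_coef phi q i j);
  metric_sym : forall phi, coordinate_system S phi ->
    forall q, cimg phi q -> (metric_coef phi q)^T = metric_coef phi q;
  metric_pos : forall phi, coordinate_system S phi ->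
    forall q, cimg phi q -> forall a : 'rV[R]_2, a != 0 ->
      0 < (a *m metric_coef phi q *m a^T) 0 0;
  metric_tensor : forall phi psi,
    coordinate_system S phi -> coordinate_system S psi ->
    forall p, cdom phi p -> cdom psi p ->
      let J := jac (transition phi psi) (cmap phi p) in
      metric_coef phi (cmap phi p) =
        J *m metric_coef psi (cmap psi p) *m J^T
}.

(* Laplacian of the metric with coefficients [g], in coordinates:
   (det g)^(-1/2) d_i ((det g)^(1/2) g^ij d_j f). *)
Definition laplacian (R : realType) (g : 'rV[R]_2 -> 'M[R]_2)
    (f : 'rV[R]_2 -> R) (q : 'rV[R]_2) : R :=
  (Num.sqrt (\det (g q)))^-1 *
  \sum_(i < 2) pd (V := R^o) i
    (fun r => Num.sqrt (\det (g r)) *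
              \sum_(j < 2) invmx (g r) i j * pd (V := R^o) j f r) q.

(** * Pseudo-Euclidean spaces *)

(* The inner product of E^n_s: the last [s] coordinates are negative. *)
Definition pdot (R : realType) (n s : nat) (a b : 'rV[R]_n) : R :=
  \sum_(i < n | (i < n - s)%N) a 0 i * b 0 i
  - \sum_(i < n | (n - s <= i)%N) a 0 i * b 0 i.

Definition lightlike (R : realType) (n s : nat) (a : 'rV[R]_n) : Prop :=
  pdot s a a = 0 /\ a != 0.

Definition pseudo_sphere (R : realType) (m s : nat) : set 'rV[R]_m.+1 :=
  [set a | pdot s a a = 1].

Definition triple (n : nat) : Type :=
  {t : 'I_n * 'I_n * 'I_n | (t.1.1 < t.1.2 < t.2)%N}.

(* The third exterior power of R^n, through coordinates in the basis
   e_i /\ e_j /\ e_k, i < j < k.  This basis is orthonormal (with signs) for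
   the determinant inner product, so these are the pseudo-Euclidean
   coordinates of E^N_q up to their order. *)
Definition Lambda3 (R : realType) (n : nat) : Type := triple n -> R.

Definition wedge3 (R : realType) (n : nat) (a b c : 'rV[R]_n) : Lambda3 R n :=
  fun t =>
    let f := [tuple a; b; c] in
    let k := [tuple (val t).1.1; (val t).1.2; (val t).2] in
    \det (\matrix_(i < 3, j < 3) (tnth f i) 0 (tnth k j)).

(** * Spacelike surfaces in the pseudo-sphere *)

Definition gram (R : realType) (n s : nat) (X : 'rV[R]_2 -> 'rV[R]_n.+1)
    (q : 'rV[R]_2) : 'M[R]_2 :=
  \matrix_(i < 2, j < 2) pdot s (pd i X q) (pd j X q).

Definition isometric_immersion (R : realType) (M : topologicalType)
    (S : oriented_surface R M) (m s : nat) (g : riemannian_metric S)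
    (x : M -> 'rV[R]_m.+1) : Prop :=
  [/\ forall p, pseudo_sphere s (x p),
      forall phi, coordinate_system S phi ->
        smooth_on (cimg phi) (x \o cinv phi)
    & forall phi, coordinate_system S phi -> forall q, cimg phi q ->
        gram s (x \o cinv phi) q = metric_coef g phi q].

(* Second fundamental form in the pseudo-sphere of a parametrized surface [X]:
   the component of X_ij orthogonal to X_1, X_2 and to the unit vector X
   normal to the pseudo-sphere. *)
Definition second_fundamental_form (R : realType) (n s : nat)
    (X : 'rV[R]_2 -> 'rV[R]_n.+1) (q : 'rV[R]_2) (i j : 'I_2) : 'rV[R]_n.+1 :=
  let Xij := pd i (pd j X) q in
  Xij
  - \sum_(k < 2) \sum_(l < 2)
      (invmx (gram s X q) k l * pdot s Xij (pd k X q)) *: pd l X q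
  - pdot s Xij (X q) *: X q.

Definition geodesic_point (R : realType) (M : topologicalType)
    (S : oriented_surface R M) (m s : nat) (x : M -> 'rV[R]_m.+1) (p : M) :
    Prop :=
  forall phi, atlas S phi -> cdom phi p -> forall i j : 'I_2,
    second_fundamental_form s (x \o cinv phi) (cmap phi p) i j = 0.

Definition totally_geodesic (R : realType) (M : topologicalType)
    (S : oriented_surface R M) (m s : nat) (x : M -> 'rV[R]_m.+1) : Prop :=
  forall p, geodesic_point S s x p.

(* Tangent vectors at [p] are identified with their images under dx. *)
Definition oriented_orthonormal_basis (R : realType) (M : topologicalType)
    (S : oriented_surface R M) (m s : nat) (x : M -> 'rV[R]_m.+1) (p : M)
    (e1 e2 : 'rV[R]_m.+1) : Prop :=
  [/\ pdot s e1 e1 = 1, pdot s e2 e2 = 1, pdot s e1 e2 = 0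
    & exists (phi : chart R M) (A : 'M[R]_2),
      [/\ atlas S phi, cdom phi p, 0 < \det A
        & let F := A *m jac (x \o cinv phi) (cmap phi p) in
          e1 = row 0 F /\ e2 = row 1 F]].

Definition is_gauss_map (R : realType) (M : topologicalType)
    (S : oriented_surface R M) (m s : nat) (x : M -> 'rV[R]_m.+1)
    (nu : M -> Lambda3 R m.+1) : Prop :=
  forall p e1 e2, oriented_orthonormal_basis S s x p e1 e2 ->
    nu p = wedge3 (x p) e1 e2.

Definition harmonic_map (R : realType) (M : topologicalType)
    (S : oriented_surface R M) (g : riemannian_metric S) (n : nat)
    (nu : M -> Lambda3 R n) : Prop :=
  forall phi, atlas S phi -> forall q, cimg phi q -> forall t : triple n,
    laplacian (metric_coef g phi) (fun r => nu (cinv phi r) t) q = 0.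

(* Main.v *)
Require Import Defs.
From HB Require Import structures.
From mathcomp Require Import all_boot all_order all_algebra.
From mathcomp Require Import all_classical all_reals all_analysis.
From mathcomp Require Import ring lra.

(** Let [X] parametrize the surface, let [h i j] be the normal parts of its
    second derivatives and [D] the determinant of its metric.  The Gauss map is
    [X /\ X_0 /\ X_1 / sqrt D].  In its first derivatives the tangential parts
    of the [X_ij] are absorbed by [sqrt D] ([pd_gauss_comp]), so that
      [sqrt D * nu_j = X /\ h_j0 /\ X_1 + X /\ X_0 /\ h_j1].

    From the Gauss map to the system.  At a given point, pair the equation
    [Laplacian nu = 0] with constant decomposable 3-vectors along which all the
    [nu_j] vanish there; only the second derivatives of [nu] then contribute
    ([laplacian_gauss_comp]).  With [X_0 /\ X_1 /\ xi], where [xi] is normal,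
    one finds that [h] is trace free; with [X /\ xi /\ eta], that its values are
    proportional, [h = om N]; with [X /\ X_0 /\ X_1], that the squared norm of
    [om] times [<N, N>] vanishes.  The induced metric is definite, so [N] is a
    null vector wherever [h] is not zero ([harmonic_point]).  Because [N] is
    null, its derivatives are normal again.  The normal part of
    [X_10i = X_01i] therefore involves only [N] and its derivatives, and if [N]
    is scaled so that one of its coordinates is 1, it splits into the Codazzi
    equations for [om] and into the constancy of [N]
    ([constant_direction]).  This constant vector is [c].

    The form [om] is symmetric, trace free and not zero.  With
    [lam^2 = - det om / D] the forms [(lam g + om) / 2] and [(lam g - om) / 2]
    are squares of linear forms [al] and [be], and the Codazzi equations say
    that [al] and [be] are closed ([diagonal_forms_closed]).  By the Poincare
    lemma and the inverse function theorem [al = du] and [be = dv] for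
    coordinates [u], [v] ([coframe_coordinates]).  In these the metric is
    [mu^2 (du^2 + dv^2)] with [mu^2 = 1 / lam], and [h] is
    [c (du^2 - dv^2)]: the system is the Gauss formula
    ([isothermal_system]), and the equation for [mu] is the Gauss equation
    ([isothermal_gauss]).

    From the system to the Gauss map.  In the coordinates [u], [v] the system
    yields [nu_u = Y /\ c /\ Y_v / mu^2] and [nu_v = Y /\ c /\ Y_u / mu^2], and
    these have vanishing divergence ([isothermal_gauss_map_harmonic]).
    In dimension two this property is invariant under conformal changes of the
    coordinates ([laplacian_conformal]), so [nu] is harmonic near every point
    that is not geodesic.  On the interior of the set of geodesic points [nu]
    is locally constant, and the remaining points follow by continuity of the
    Laplacian ([isothermal_harmonic_map]). *)

Set Implicit Arguments.
Unset Strict Implicit.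
Unset Printing Implicit Defensive.

Import Order.TTheory GRing.Theory Num.Theory.
Import numFieldNormedType.Exports.

Local Open Scope classical_set_scope.
Local Open Scope ring_scope.

(** * Mean values and differentiability in the plane *)

Notation E2 i := (delta_mx 0 i : 'rV[_]_2).

Section PlaneBasics.
Context {R : realType}.
Implicit Types (p q : 'rV[R]_2) (U : set 'rV[R]_2).

Lemma forall_I2 (P : 'I_2 -> Prop) : P 0 -> P 1 -> forall i, P i.
Proof.
by move=> P0 P1 [[|[|//]] i]; [move: P0|move: P1]; congr P; exact/val_inj.
Qed.

Lemma sum_I2 (V : nmodType) (F : 'I_2 -> V) : \sum_(i < 2) F i = F 0 + F 1.
Proof.
by rewrite big_ord_recl big_ord1; congr (F _ + F _); exact/val_inj.
Qed.

Lemma sum_I22 (V : nmodType) (F : 'I_2 -> 'I_2 -> V) :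
  \sum_(i < 2) \sum_(j < 2) F i j = F 0 0 + F 0 1 + (F 1 0 + F 1 1).
Proof. by rewrite !sum_I2. Qed.

Lemma rV2P p q : p 0 0 = q 0 0 -> p 0 1 = q 0 1 -> p = q.
Proof.
by move=> h0 h1; apply/rowP; apply: forall_I2.
Qed.

Lemma E2E (i j : 'I_2) : (E2 i : 'rV[R]_2) 0 j = (i == j)%:R.
Proof. by rewrite mxE eqxx eq_sym. Qed.

Lemma add_scale_E2 p (a : R) (i j : 'I_2) :
  (p + a *: E2 i) 0 j = p 0 j + a * (i == j)%:R.
Proof. by rewrite !mxE eqxx eq_sym. Qed.

Lemma rV2_decomp p : p = p 0 0 *: E2 0 + p 0 1 *: E2 1.
Proof. by apply: rV2P; rewrite !mxE /= ?mulr1 ?mulr0 ?addr0 ?add0r. Qed.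

Lemma normr_rV_le (n : nat) (p : 'rV[R]_n) (j : 'I_n) : `|p 0 j| <= `|p|.
Proof.
by rewrite {2}/Num.norm /= mx_normrE; apply: (le_bigmax _ _ (0, j)).
Qed.

Lemma norm_rV2_lt p e : 0 < e -> `|p 0 0| < e -> `|p 0 1| < e -> `|p| < e.
Proof.
move=> e0 h0 h1; rewrite {1}/Num.norm /= mx_normrE.
apply/bigmax_ltP; split=> // -[i j] _ /=; rewrite ord1.
by move: j; apply: forall_I2.
Qed.

Lemma norm_rV2_le p e : 0 <= e -> `|p 0 0| <= e -> `|p 0 1| <= e -> `|p| <= e.
Proof.
move=> e0 h0 h1; rewrite {1}/Num.norm /= mx_normrE.
apply/bigmax_leP; split=> // -[i j] _ /=; rewrite ord1.
by move: j; apply: forall_I2.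
Qed.

Lemma norm_E2 (i : 'I_2) : `|E2 i : 'rV[R]_2| = 1.
Proof.
apply/eqP; rewrite eq_le; apply/andP; split.
  by apply: norm_rV2_le => //; rewrite E2E; case: eqP; rewrite ?normr1 ?normr0.
by apply: le_trans (normr_rV_le _ i); rewrite E2E eqxx normr1.
Qed.

Lemma ball_rV2P q e p : ball q e p <-> `|q - p| < e.
Proof. by rewrite -ball_normE. Qed.

Lemma open_ball_sub U q : open U -> U q -> exists2 e, 0 < e & ball q e `<=` U.
Proof.
move=> oU Uq; have : nbhs q U by exact: open_nbhs_nbhs.
by move/nbhs_ballP => [e e0 h]; exists e.
Qed.

Lemma near_open U q : open U -> U q -> \forall p \near q, U p.
Proof. by move=> oU Uq; exact: open_nbhs_nbhs. Qed.

(** The sup norm makes balls into boxes, so a point all of whose coordinates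
    lie between those of two points of a ball stays in it. *)
Lemma ball_box q e (x y z : 'rV[R]_2) : ball q e x -> ball q e y ->
  (forall j, exists2 c, 0 <= c <= 1 & z 0 j = x 0 j + c * (y 0 j - x 0 j)) ->
  ball q e z.
Proof.
move=> /ball_rV2P qx /ball_rV2P qy hz; apply/ball_rV2P.
have e0 : 0 < e by exact: le_lt_trans qx.
have hj j : `|(q - z) 0 j| < e.
  have [c /andP[c0 c1] zE] := hz j.
  have := le_lt_trans (normr_rV_le _ j) qx.
  have := le_lt_trans (normr_rV_le _ j) qy.
  rewrite !mxE zE !ltr_norml => /andP[a1 a2] /andP[b1 b2].
  have [c_gt0|c_le0] := ltP 0 c; last first.
    by have -> : c = 0 by [apply: le_anti; rewrite c0 c_le0]; apply/andP; split; lra.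
  by apply/andP; split; nra.
by apply: norm_rV2_lt.
Qed.

End PlaneBasics.

Section Slices.
Context {R : realType} {V : normedModType R}.
Implicit Types (p q : 'rV[R]_2) (U : set 'rV[R]_2) (f : 'rV[R]_2 -> V).

Lemma is_derive_slice f q v (t : R) : derivable f (q + t *: v) v ->
  is_derive t (1 : R) (fun s : R => f (q + s *: v)) ('D_v f (q + t *: v)).
Proof.
move=> df; have eqq : (fun h : R => h^-1 *:
    (((fun s : R => f (q + s *: v)) \o shift t) (h *: (1 : R)) - f (q + t *: v)))
  = (fun h => h^-1 *: ((f \o shift (q + t *: v)) (h *: v) - f (q + t *: v))).
  apply/funext => h /=; congr (_ *: (f _ - _)).
  by rewrite [h%:A]mulr1 scalerDl addrCA.
by apply: DeriveDef; rewrite /derivable /derive /= eqq.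
Qed.

Lemma is_derive_dir_comp (W Z : normedModType R) (g : W -> V) (f : V -> Z) x v :
  differentiable f (g x) -> derivable g x v ->
  is_derive x v (f \o g) ('d f (g x) ('D_v g x)).
Proof.
move=> df dg; set c := fun h : R => g (h *: v + x).
have dc : derivable c 0 1 by move/derivable1P: dg.
have c0 : c 0 = g x by rewrite /c scale0r add0r.
have dfc : differentiable f (c 0) by rewrite c0.
have dfcc : differentiable (f \o c) 0.
  by apply: differentiable_comp => //; apply/derivable1_diffP.
have eqD (Y : normedModType R) (k : W -> Y) :
    'D_v k x = 'D_1 (fun h : R => k (h *: v + x)) 0.
  rewrite /derive; set k1 := fun h => h^-1 *: _; set k2 := fun h => h^-1 *: _.
  suff -> : k1 = k2 by [].
  by rewrite funeqE /k1 /k2 => h /=; rewrite addr0 scale0r add0r [_%:A]mulr1.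
apply: DeriveDef.
  by apply: (derivable1P _ _ _).2; apply: (derivable1_diffP _ _).2.
rewrite !eqD /=.
rewrite deriveE // [X in 'd X _](_ : _ = f \o c) // diff_comp //=; last first.
  exact/derivable1_diffP.
rewrite c0 deriveE //; exact/derivable1_diffP.
Qed.

End Slices.

Section AxisMVT.
Context {R : realType}.
Implicit Types (p q x y : 'rV[R]_2) (U : set 'rV[R]_2) (f : 'rV[R]_2 -> R^o).

Lemma axis_mvt f q (i : 'I_2) (h : R) :
  (forall c, 0 <= c <= 1 -> derivable f (q + (c * h) *: E2 i) (E2 i)) ->
  exists2 c, 0 <= c <= 1 &
    f (q + h *: E2 i) - f q = pd i f (q + (c * h) *: E2 i) * h.
Proof.
move=> df; pose k (s : R) : R := f (q + (s * h) *: E2 i).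
pose dk (s : R) : R := pd i f (q + (s * h) *: E2 i) * h.
have dK (s : R) : 0 <= s <= 1 -> is_derive s (1 : R) (k : R -> R^o) (dk s).
  move=> s01; have d1 := is_derive_slice (df s s01).
  have d2 : is_derive s (1 : R) (fun s : R => s * h : R^o) h.
    have -> : (fun s : R => s * h : R^o) = (fun s : R => h *: (s : R^o)).
      by apply/funext => z; rewrite mulrC.
    apply: is_derive_eq; exact: mulr1.
  exact: (@is_derive1_comp R (fun s : R => f (q + s *: E2 i)) (fun s => s * h)
    s _ _ d1 d2).
have [c c01 E] : exists2 c, c \in `[0, 1]%R & k 1 - k 0 = dk c * (1 - 0).
  apply: MVT_segment => //.
    by move=> s; rewrite in_itv /= => /andP[s0 s1]; apply: dK; rewrite !ltW.
  apply: derivable_within_continuous => s; rewrite in_itv /= => s01.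
  by have [] := dK _ s01.
exists c; first by move: c01; rewrite in_itv.
by move: E; rewrite /k /dk mul1r mul0r scale0r addr0 subr0 mulr1.
Qed.

(** Mean value theorem along the broken line from [x] to [y] that is parallel
    to the axes; [ball_box] keeps the two intermediate points in the ball. *)
Lemma box_mvt f q e x y : ball q e x -> ball q e y ->
  (forall i z, ball q e z -> derivable f z (E2 i)) ->
  exists z1 z2 : 'rV[R]_2,
  [/\ forall j, exists2 c, 0 <= c <= 1 & z1 0 j = x 0 j + c * (y 0 j - x 0 j),
      forall j, exists2 c, 0 <= c <= 1 & z2 0 j = x 0 j + c * (y 0 j - x 0 j)
    & f y - f x = pd 0 f z1 * (y 0 0 - x 0 0) + pd 1 f z2 * (y 0 1 - x 0 1)].
Proof.
move=> qx qy df; set h0 := y 0 0 - x 0 0; set h1 := y 0 1 - x 0 1.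
have le11 : 0 <= (1 : R) <= 1 by rewrite ler01 lexx.
have le00 : 0 <= (0 : R) <= 1 by rewrite ler01 lexx.
have box1 (c : R) : 0 <= c <= 1 -> forall j,
    exists2 d, 0 <= d <= 1 &
    (x + (c * h0) *: E2 0) 0 j = x 0 j + d * (y 0 j - x 0 j) :> R.
  move=> c01; apply: forall_I2.
    by exists c => //; rewrite add_scale_E2 mulr1.
  by exists 0 => //; rewrite add_scale_E2 mulr0 mul0r.
have box2 (c : R) : 0 <= c <= 1 -> forall j,
    exists2 d, 0 <= d <= 1 &
    (x + h0 *: E2 0 + (c * h1) *: E2 1) 0 j
      = x 0 j + d * (y 0 j - x 0 j) :> R.
  move=> c01; apply: forall_I2.
    by exists 1 => //; rewrite !add_scale_E2 /= mulr1 mulr0 mul1r addr0.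
  by exists c => //; rewrite !add_scale_E2 /= mulr1 mulr0 addr0.
have [c1 c1i E1] := axis_mvt (f := f) (q := x) (i := 0) (h := h0)
  (fun c hc => df _ _ (ball_box qx qy (box1 c hc))).
have [c2 c2i F2] := axis_mvt (f := f) (q := x + h0 *: E2 0) (i := 1) (h := h1)
  (fun c hc => df _ _ (ball_box qx qy (box2 c hc))).
exists (x + (c1 * h0) *: E2 0), (x + h0 *: E2 0 + (c2 * h1) *: E2 1); split.
- exact: box1.
- exact: box2.
- have yE : x + h0 *: E2 0 + h1 *: E2 1 = y.
    by apply: rV2P; rewrite !add_scale_E2 /h0 /h1 /=; ring.
  by rewrite yE in F2; rewrite -E1 -F2 [RHS]addrC subrKA.
Qed.

(** By [box_mvt], the error is controlled by the oscillation of the partial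
    derivatives near [q]. *)
Lemma C1_expansion U f q (eps : R) : open U -> U q -> 0 < eps ->
  (forall i z, U z -> derivable f z (E2 i)) ->
  (forall i, {for q, continuous (pd i f)}) ->
  \forall p \near q,
    `|f p - f q - ((p - q) 0 0 * pd 0 f q + (p - q) 0 1 * pd 1 f q)|
      <= eps * `|p - q|.
Proof.
move=> oU Uq eps0 df cdf.
have near_pd i : \forall z \near q, `|pd i f q - pd i f z| <= eps / 2.
  by have /cvgrPdist_le := cdf i; apply; rewrite divr_gt0.
have /nbhs_ballP[d d0 dP] : \forall z \near q, U z /\
   (forall i, `|pd i f q - pd i f z| <= eps / 2).
  move: (near_open oU Uq) (near_pd 0) (near_pd 1).
  apply: filterS3 => z Uz p0 p1; exact: (conj Uz (forall_I2 p0 p1)).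
apply/nbhs_ballP; exists d => // p qp.
have qq : ball q d q by exact: ballxx.
have [z1 [z2 [b1 b2 fE]]] := box_mvt qq qp (fun i z hz => df i z (dP z hz).1).
have [_ z1P] := dP _ (ball_box qq qp b1).
have [_ z2P] := dP _ (ball_box qq qp b2).
have -> : f p - f q - ((p - q) 0 0 * pd 0 f q + (p - q) 0 1 * pd 1 f q) =
    (pd 0 f z1 - pd 0 f q) * (p - q) 0 0 + (pd 1 f z2 - pd 1 f q) * (p - q) 0 1.
  by rewrite fE !mxE; ring.
apply: le_trans (ler_normD _ _) _; rewrite !normrM (splitr eps) mulrDl.
apply: lerD; apply: ler_pM; rewrite ?normr_ge0 ?normr_rV_le // distrC.
  exact: z1P.
exact: z2P.
Qed.

Lemma C1_differentiable U f q : open U -> U q ->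
  (forall i z, U z -> derivable f z (E2 i)) ->
  (forall i, {for q, continuous (pd i f)}) -> differentiable f q.
Proof.
move=> oU Uq df cdf.
pose L (v : 'rV[R]_2) : R^o := v 0 0 * pd 0 f q + v 0 1 * pd 1 f q.
have Llin : linear L by move=> a u v; rewrite /L !mxE /GRing.scale/=; ring.
pose LM := GRing.isLinear.Build _ _ _ _ _ Llin.
pose LL : {linear 'rV[R]_2 -> R^o} := HB.pack L LM.
have Lc : continuous LL.
  move=> v.
  have cM j (a : R) : {for v, continuous (fun u : 'rV[R]_2 => u 0 j * a : R^o)}.
    by apply: continuousM; [exact: coord_continuous | exact: cst_continuous].
  exact: (continuousD (cM 0 _) (cM 1 _)).
have E : f \o shift q = cst (f q) + LL +o_ (0 : 'rV[R]_2) id.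
  apply/eqaddoP => eps eps0.
  have /nbhs_ballP[d d0 dP] := C1_expansion oU Uq eps0 df cdf.
  apply/nbhs_ballP; exists d => // y /ball_rV2P; rewrite sub0r normrN => yd.
  have /dP : ball q d (y + q).
    by apply/ball_rV2P; rewrite opprD addrCA subrr addr0 normrN.
  by rewrite addrK !fctE /= -/(L y) -addrA -opprD.
by apply/diff_locallyP; rewrite (diff_unique Lc E); split.
Qed.

Lemma Ck_on_differentiable U f q : open U -> U q -> Ck_on 1 U f ->
  differentiable f q.
Proof.
move=> oU Uq [_ Df]; apply: (C1_differentiable oU Uq).
  by move=> i z Uz; apply: (Df i).1.
by move=> i; have [_ [cpd _]] := Df i; exact: cpd.
Qed.

End AxisMVT.

(** * Functions of class C^k *)

Section SmoothGeneral.
Context {R : realType} {V : normedModType R}.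
Implicit Types (p q : 'rV[R]_2) (U W : set 'rV[R]_2) (f g : 'rV[R]_2 -> V).

Lemma near_eq_open U f g q : open U -> U q -> (forall p, U p -> f p = g p) ->
  \forall p \near q, f p = g p.
Proof. by move=> oU Uq fg; apply: filterS fg _; exact: near_open. Qed.

Lemma pd_eq_on U f g q i : open U -> U q -> (forall p, U p -> f p = g p) ->
  pd i f q = pd i g q.
Proof. by move=> oU Uq fg; apply: near_eq_derive; exact: near_eq_open fg. Qed.

Lemma continuous_eq_on U f g q : open U -> U q ->
  (forall p, U p -> f p = g p) -> {for q, continuous f} -> {for q, continuous g}.
Proof.
move=> oU Uq fg cf; rewrite /prop_for /continuous_at -(fg q Uq).
apply: cvg_trans cf; apply: (near_eq_cvg (F := nbhs q)).
exact: near_eq_open oU Uq fg.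
Qed.

Lemma Ck_on_eq k U f g : open U -> (forall p, U p -> f p = g p) ->
  Ck_on k U f -> Ck_on k U g.
Proof.
move=> oU; elim: k f g => [|k ih] f g fg [cf Df]; split.
- by move=> q Uq; exact: continuous_eq_on oU Uq fg (cf q Uq).
- by [].
- by move=> q Uq; exact: continuous_eq_on oU Uq fg (cf q Uq).
- move=> i; have [df cdf] := Df i; split.
    move=> q Uq; apply: near_eq_derivable (df q Uq); exact: near_eq_open fg.
  by apply: ih cdf => p Up; exact: (pd_eq_on i oU Up fg).
Qed.

Lemma Ck_on_sub k U W f : U `<=` W -> Ck_on k W f -> Ck_on k U f.
Proof.
move=> UW; elim: k f => [|k ih] f [cf Df]; split=> //.
- by move=> q /UW; exact: cf.
- by move=> q /UW; exact: cf.
- move=> i; have [df cdf] := Df i; split; last exact: ih.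
  by move=> q /UW; exact: df.
Qed.

Lemma Ck_onS k U f : Ck_on k.+1 U f -> Ck_on k U f.
Proof.
elim: k f => [|k ih] f [cf Df]; split=> // i.
by have [df cdf] := Df i; split=> //; exact: ih.
Qed.

Lemma Ck_on_pd k U f i : Ck_on k.+1 U f -> Ck_on k U (pd i f).
Proof. by move=> [_ /(_ i)[]]. Qed.

Lemma Ck_on_derivable k U f i q : U q -> Ck_on k.+1 U f ->
  derivable f q (E2 i).
Proof. by move=> Uq [_ /(_ i)[df _]]; exact: df. Qed.

Arguments Ck_on_derivable [k U f i q].

Lemma Ck_on_continuous k U f q : U q -> Ck_on k U f -> {for q, continuous f}.
Proof. by move=> Uq; case: k => [|k] [cf _]; exact: cf. Qed.

(** Adds one degree of smoothness by exhibiting the partial derivatives. *)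
Lemma Ck_on_intro k U f (g : 'I_2 -> 'rV[R]_2 -> V) : open U ->
  (forall q, U q -> {for q, continuous f}) ->
  (forall i q, U q -> is_derive q (E2 i) f (g i q)) ->
  (forall i, Ck_on k U (g i)) -> Ck_on k.+1 U f.
Proof.
move=> oU cf df cg; split=> // i; split.
  by move=> q Uq; have [] := df i q Uq.
apply: Ck_on_eq (cg i) => // p Up; have dfp := df i p Up.
by rewrite /pd derive_val.
Qed.

Lemma is_derive_derivable f q v (d : V) : is_derive q v f d -> derivable f q v.
Proof. by case. Qed.

Lemma pd_is_derive f q i (d : V) : is_derive q (E2 i) f d -> pd i f q = d.
Proof. by move=> df; rewrite /pd derive_val. Qed.

Lemma is_derive_pd f q i : derivable f q (E2 i) ->
  is_derive q (E2 i) f (pd i f q).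
Proof. exact: derivableP. Qed.

Lemma Ck_on_cst k U (a : V) : open U -> Ck_on k U (fun=> a).
Proof.
move=> oU; elim: k a => [|k ih] a; first by split=> // q _; exact: cst_continuous.
apply: (@Ck_on_intro _ _ _ (fun _ _ => 0)) => // q _; exact: cst_continuous.
Qed.

Lemma Ck_onD k U f g : open U -> Ck_on k U f -> Ck_on k U g ->
  Ck_on k U (fun r => f r + g r).
Proof.
move=> oU; elim: k f g => [|k ih] f g sf sg.
  split=> // q Uq; apply: continuousD;
    [exact: Ck_on_continuous Uq sf|exact: Ck_on_continuous Uq sg].
apply: (@Ck_on_intro _ _ _ (fun i r => pd i f r + pd i g r)) => //.
- move=> q Uq; apply: continuousD;
    [exact: Ck_on_continuous Uq sf|exact: Ck_on_continuous Uq sg].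
- move=> i q Uq.
  apply: is_deriveD; apply: is_derive_pd;
    [exact: Ck_on_derivable Uq sf|exact: Ck_on_derivable Uq sg].
- by move=> i; apply: ih; exact: Ck_on_pd.
Qed.

End SmoothGeneral.

Section NearContinuous.
Context {R : realType}.
Implicit Types (q : 'rV[R]_2) (f : 'rV[R]_2 -> R^o).

Lemma near_dist_lt f q (e : R) : {for q, continuous f} -> 0 < e ->
  \forall r \near q, `|f q - f r| < e.
Proof. by move=> cf; exact: (cvgrPdist_lt (F := nbhs q) _ _).1. Qed.

Lemma near_neq0 f q : {for q, continuous f} -> f q != 0 ->
  \forall r \near q, f r != 0.
Proof.
move=> cf f0; have h : 0 < `|f q| by rewrite normr_gt0.
have := near_dist_lt cf h.
by apply: filterS => r; apply: contraTneq => ->; rewrite subr0 ltxx.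
Qed.

Lemma near_gt0 f q : {for q, continuous f} -> 0 < f q ->
  \forall r \near q, 0 < f r.
Proof.
move=> cf f0; have := near_dist_lt cf f0; apply: filterS => r.
by rewrite ltr_norml => /andP[_]; rewrite ltrBlDl ltrDr.
Qed.

End NearContinuous.

Section SmoothScalar.
Context {R : realType}.
Implicit Types (p q : 'rV[R]_2) (U W : set 'rV[R]_2) (f g : 'rV[R]_2 -> R^o).

Lemma is_derive_mul f g q v (df dg : R^o) :
  is_derive q v f df -> is_derive q v g dg ->
  is_derive q v (fun r => f r * g r : R^o) (df * g q + f q * dg).
Proof.
move=> hf hg; apply: (is_derive_eq (is_deriveM hf hg)).
by rewrite /GRing.scale/= addrC mulrC [f q * _]mulrC [dg * _]mulrC.
Qed.

Lemma is_derive_comp1 (h : R^o -> R^o) f q v (dh df : R^o) :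
  is_derive (f q) (1 : R) h dh -> is_derive q v f df ->
  is_derive q v (fun r => h (f r)) (dh * df).
Proof.
move=> hh hf.
have dif : differentiable h (f q) by apply/derivable1_diffP.
have [dfv dfE] := hf.
apply: (is_derive_eq (is_derive_dir_comp dif dfv)); rewrite dfE.
rewrite -[df in 'd _ _ df](mulr1 (df : R)).
by rewrite -[df * 1]/(df *: (1 : R^o)) linearZ /= -deriveE // derive_val mulrC.
Qed.

Lemma is_derive_inv f q v (df : R^o) : f q != 0 -> is_derive q v f df ->
  is_derive q v (fun r => (f r)^-1 : R^o) (- (f q)^-1 * (f q)^-1 * df).
Proof.
move=> f0 hf; apply: DeriveDef; first exact: derivableV.
rewrite deriveV // derive_val /GRing.scale /= expr2 invfM mulNr; ring.
Qed.

Lemma Ck_onM k U f g : open U -> Ck_on k U f -> Ck_on k U g ->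
  Ck_on k U (fun r => f r * g r : R^o).
Proof.
move=> oU; elim: k f g => [|k ih] f g sf sg.
  split=> // q Uq; apply: continuousM;
    [exact: Ck_on_continuous Uq sf|exact: Ck_on_continuous Uq sg].
apply: (@Ck_on_intro _ _ _ _ _ (fun i r => pd i f r * g r + f r * pd i g r)) => //.
- move=> q Uq; apply: continuousM;
    [exact: Ck_on_continuous Uq sf|exact: Ck_on_continuous Uq sg].
- move=> i q Uq.
  apply: is_derive_mul; apply: is_derive_pd;
    [exact: Ck_on_derivable Uq sf|exact: Ck_on_derivable Uq sg].
- move=> i; apply: Ck_onD => //; apply: ih => //; do ?exact: Ck_on_pd.
    exact: Ck_onS.
  exact: Ck_onS.
Qed.

Lemma Ck_onZ k U (a : R) f : open U -> Ck_on k U f ->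
  Ck_on k U (fun r => a * f r : R^o).
Proof. by move=> oU; apply: Ck_onM => //; exact: Ck_on_cst. Qed.

Lemma Ck_onN k U f : open U -> Ck_on k U f -> Ck_on k U (fun r => - f r : R^o).
Proof.
move=> oU sf; apply: Ck_on_eq (Ck_onZ (-1) oU sf) => // p _; exact: mulN1r.
Qed.

Lemma Ck_onB k U f g : open U -> Ck_on k U f -> Ck_on k U g ->
  Ck_on k U (fun r => f r - g r : R^o).
Proof. by move=> oU sf sg; apply: Ck_onD => //; exact: Ck_onN. Qed.

Lemma Ck_onV k U f : open U -> (forall q, U q -> f q != 0) -> Ck_on k U f ->
  Ck_on k U (fun r => (f r)^-1 : R^o).
Proof.
move=> oU f0; elim: k => [|k ih] sf.
  split=> // q Uq; apply: continuousV; [exact: f0|exact: Ck_on_continuous Uq sf].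
have sV := ih (Ck_onS sf).
apply: (@Ck_on_intro _ _ _ _ _ (fun i r => - (f r)^-1 * (f r)^-1 * pd i f r)) => //.
- move=> q Uq; apply: continuousV; [exact: f0|exact: Ck_on_continuous Uq sf].
- move=> i q Uq; apply: is_derive_inv; first exact: f0.
  by apply: is_derive_pd; exact: Ck_on_derivable Uq sf.
- move=> i; apply: Ck_onM => //; last exact: Ck_on_pd.
  by apply: Ck_onM => //; exact: Ck_onN.
Qed.

Lemma is_derive_sqrt f q v (df : R^o) : 0 < f q -> is_derive q v f df ->
  is_derive q v (fun r => Num.sqrt (f r) : R^o) ((2 * Num.sqrt (f q))^-1 * df).
Proof.
move=> f0 hf; apply: (@is_derive_comp1 (@Num.sqrt R)) => //.
exact: is_derive1_sqrt.
Qed.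

Lemma Ck_on_sqrt k U f : open U -> (forall q, U q -> 0 < f q) -> Ck_on k U f ->
  Ck_on k U (fun r => Num.sqrt (f r) : R^o).
Proof.
move=> oU f0.
have cs q : U q -> {for q, continuous f} ->
    {for q, continuous (fun r => Num.sqrt (f r) : R^o)}.
  move=> Uq cf; apply: continuous_comp => //; exact: sqrt_continuous.
elim: k => [|k ih] sf.
  by split=> // q Uq; apply: cs => //; exact: Ck_on_continuous Uq sf.
have sV := ih (Ck_onS sf).
apply: (@Ck_on_intro _ _ _ _ _ (fun i r => (2 * Num.sqrt (f r))^-1 * pd i f r)) => //.
- by move=> q Uq; apply: cs => //; exact: Ck_on_continuous Uq sf.
- move=> i q Uq; apply: is_derive_sqrt; first exact: f0.
  by apply: is_derive_pd; exact: Ck_on_derivable Uq sf.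
- move=> i; apply: Ck_onM => //; last exact: Ck_on_pd.
  apply: Ck_onV => //; last exact: Ck_onZ.
  by move=> q Uq; rewrite mulf_neq0 // sqrtr_eq0 -ltNge f0.
Qed.

Lemma is_derive_ln f q v (df : R^o) : 0 < f q -> is_derive q v f df ->
  is_derive q v (fun r => ln (f r) : R^o) ((f q)^-1 * df).
Proof.
move=> f0 hf; apply: (@is_derive_comp1 (@ln R)) => //; exact: is_derive1_ln.
Qed.

End SmoothScalar.

Section SmoothVector.
Context {R : realType} {n : nat}.
Implicit Types (p q : 'rV[R]_2) (U W : set 'rV[R]_2) (f g : 'rV[R]_2 -> 'rV[R]_n).

Lemma continuous_rV f q :
  (forall j, {for q, continuous (fun r => f r 0 j : R^o)}) ->
  {for q, continuous f}.
Proof.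
move=> cf; rewrite /prop_for /continuous_at.
apply/(cvgrPdist_lt (F := nbhs q) f (f q)) => e e0.
have : \forall r \near q, forall j, `|f q 0 j - f r 0 j| < e.
  apply: (filter_forall (F := nbhs q)) => j.
  exact: (cvgrPdist_lt (F := nbhs q) _ _).1 (cf j) e e0.
apply: filterS => r hr; rewrite /Num.norm /= mx_normrE.
by apply/bigmax_ltP; split=> // -[i j] _ /=; rewrite ord1 !mxE.
Qed.

Lemma continuous_coord f q j : {for q, continuous f} ->
  {for q, continuous (fun r => f r 0 j : R^o)}.
Proof.
move=> cf.
by apply: (@continuous_comp _ _ _ f (fun M : 'rV[R]_n => M 0 j : R^o)) => //;
  exact: coord_continuous.
Qed.

Lemma derivable_rV f q v :
  derivable f q v <-> forall j, derivable (fun r => f r 0 j : R^o) q v.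
Proof.
split; first by move=> /derivable_mxP h j; exact: h.
by move=> h; apply/derivable_mxP => i j; rewrite ord1; exact: h.
Qed.

Lemma pd_coord f q i j : derivable f q (E2 i) ->
  pd i f q 0 j = pd i (fun r => f r 0 j : R^o) q.
Proof. by move=> df; rewrite /pd derive_mx // mxE. Qed.

Lemma Ck_on_rV k U f : open U ->
  Ck_on k U f <-> forall j, Ck_on k U (fun r => f r 0 j : R^o).
Proof.
move=> oU; split.
- elim: k f => [|k ih] f sf j.
    by split=> // q Uq; apply: continuous_coord; exact: Ck_on_continuous Uq sf.
  split; first by move=> q Uq; apply: continuous_coord; exact: Ck_on_continuous Uq sf.
  move=> i; split.
    by move=> q Uq; exact: ((derivable_rV f q (E2 i)).1 (Ck_on_derivable (i := i) Uq sf) j).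
  apply: Ck_on_eq (ih _ (Ck_on_pd i sf) j) => // p Up.
  by apply: pd_coord; exact: Ck_on_derivable Up sf.
- elim: k f => [|k ih] f sf.
    by split=> // q Uq; apply: continuous_rV => j; exact: Ck_on_continuous Uq (sf j).
  have df i q : U q -> derivable f q (E2 i).
    by move=> Uq; apply/derivable_rV => j; exact: (Ck_on_derivable Uq (sf j)).
  split; first by move=> q Uq; apply: continuous_rV => j; exact: Ck_on_continuous Uq (sf j).
  move=> i; split; first exact: df.
  apply: ih => j; apply: Ck_on_eq (Ck_on_pd i (sf j)) => // p Up.
  by rewrite pd_coord //; exact: df.
Qed.

End SmoothVector.

Section SmoothComp.
Context {R : realType}.
Implicit Types (p q : 'rV[R]_2) (U W : set 'rV[R]_2) (f g : 'rV[R]_2 -> R^o)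
  (h : 'rV[R]_2 -> 'rV[R]_2).

Lemma diff_pd f q v : differentiable f q ->
  'd f q v = v 0 0 * pd 0 f q + v 0 1 * pd 1 f q.
Proof.
by move=> df; rewrite {1}[v]rV2_decomp linearD !linearZ /= /pd !deriveE.
Qed.

Lemma is_derive_comp_plane U f h q i : open U -> Ck_on 1 U f -> U (h q) ->
  derivable h q (E2 i) ->
  is_derive q (E2 i) (fun r => f (h r))
    (pd i h q 0 0 * pd 0 f (h q) + pd i h q 0 1 * pd 1 f (h q)).
Proof.
move=> oU sf Uhq dh; have df := Ck_on_differentiable oU Uhq sf.
by apply: (is_derive_eq (is_derive_dir_comp df dh)); rewrite diff_pd.
Qed.

Lemma Ck_on_comp k U W f h : open U -> open W -> (forall q, W q -> U (h q)) ->
  Ck_on k U f -> Ck_on k W h -> Ck_on k W (fun r => f (h r)).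
Proof.
move=> oU oW WU; elim: k f => [|k ih] f sf sh.
  split=> // q Wq; apply: continuous_comp; first exact: Ck_on_continuous Wq sh.
  by apply: Ck_on_continuous sf; exact: WU.
have s1 : Ck_on 1 U f.
  by elim: {ih sh} k sf => // k ihk sf; apply: ihk; exact: Ck_onS.
pose d i r := pd i (fun p => h p 0 0 : R^o) r * pd 0 f (h r)
            + pd i (fun p => h p 0 1 : R^o) r * pd 1 f (h r) : R^o.
have shj := (Ck_on_rV k.+1 h oW).1 sh.
apply: (@Ck_on_intro _ _ _ _ _ d) => //.
- move=> q Wq; apply: continuous_comp; first exact: Ck_on_continuous Wq sh.
  by apply: Ck_on_continuous sf; exact: WU.
- move=> i q Wq; have dh : derivable h q (E2 i) by exact: Ck_on_derivable Wq sh.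
  apply: is_derive_eq (is_derive_comp_plane oU s1 (WU _ Wq) dh) _.
  by rewrite /d !pd_coord.
- move=> i; have fh j := ih _ (Ck_on_pd j sf) (Ck_onS sh).
  exact: (Ck_onD oW (Ck_onM oW (Ck_on_pd i (shj 0)) (fh 0))
                    (Ck_onM oW (Ck_on_pd i (shj 1)) (fh 1))).
Qed.

End SmoothComp.

(** * Symmetry of second derivatives and estimates on balls *)

Section Schwarz.
Context {R : realType}.
Implicit Types (p q : 'rV[R]_2) (U W : set 'rV[R]_2) (f g : 'rV[R]_2 -> R^o).

Lemma is_derive_translate f (w : 'rV[R]_2) q v : derivable f (q + w) v ->
  is_derive q v (fun r => f (r + w) : R^o) ('D_v f (q + w)).
Proof.
move=> df.
have E : (fun h : R => h^-1 *:
    (((fun r => f (r + w) : R^o) \o shift q) (h *: v) - f (q + w)))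
    = (fun h => h^-1 *: ((f \o shift (q + w)) (h *: v) - f (q + w))).
  by apply/funext => h /=; rewrite -addrA.
by apply: DeriveDef; rewrite /derivable /derive /= E.
Qed.

(** Two applications of the mean value theorem.  The left-hand side is
    symmetric in [i] and [j], which is what makes the mixed derivatives agree. *)
Lemma second_difference f q e i j (t : R) : Ck_on 2 (ball q e) f ->
  0 < t -> t < e / 2 ->
  exists2 z, `|z - q| <= 2 * t &
    f (q + t *: E2 i + t *: E2 j) - f (q + t *: E2 i) - f (q + t *: E2 j) + f q
      = pd j (pd i f) z * (t * t).
Proof.
move=> sf t0 te; have s1 := Ck_onS sf.
have bound (a b : R) : 0 <= a <= 1 -> 0 <= b <= 1 ->
    `|(q + (a * t) *: E2 i + (b * t) *: E2 j) - q| <= 2 * t.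
  move=> /andP[a0 a1] /andP[b0 b1].
  have -> : q + (a * t) *: E2 i + (b * t) *: E2 j - q
      = (a * t) *: E2 i + (b * t) *: E2 j :> 'rV[R]_2.
    by apply: (addrI q); rewrite [LHS]addrC subrK addrA.
  rewrite (le_trans (ler_normD _ _)) //.
  rewrite !normrZ !norm_E2 !ger0_norm ?mulr_ge0 ?(ltW t0) //.
  by rewrite !mulr1; nra.
have inB (a b : R) : 0 <= a <= 1 -> 0 <= b <= 1 ->
    ball q e (q + (a * t) *: E2 i + (b * t) *: E2 j).
  move=> a01 b01; apply/ball_rV2P; rewrite distrC (le_lt_trans (bound _ _ a01 b01)) //.
  lra.
have le11 : 0 <= (1 : R) <= 1 by rewrite ler01 lexx.
have le00 : 0 <= (0 : R) <= 1 by rewrite ler01 lexx.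
pose k r : R^o := f (r + t *: E2 j) - f r.
have dk (c : R) : 0 <= c <= 1 -> is_derive (q + (c * t) *: E2 i) (E2 i) k
    (pd i f (q + (c * t) *: E2 i + t *: E2 j) - pd i f (q + (c * t) *: E2 i)).
  move=> c01; apply: is_deriveB.
    apply: is_derive_translate; apply: Ck_on_derivable s1.
    by have := inB _ _ c01 le11; rewrite mul1r.
  apply: is_derive_pd; apply: Ck_on_derivable s1.
  by have := inB _ _ c01 le00; rewrite mul0r scale0r addr0.
have [a a01 kE] := axis_mvt (fun c hc => is_derive_derivable (dk c hc)).
have [b b01 pE] := axis_mvt (f := pd i f) (q := q + (a * t) *: E2 i) (i := j)
  (h := t) (fun c hc => Ck_on_derivable (inB _ _ a01 hc) (Ck_on_pd i sf)).
exists (q + (a * t) *: E2 i + (b * t) *: E2 j); first exact: bound.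
rewrite mulrA -pE -(pd_is_derive (dk a a01)) -kE /k opprB addrA addrAC.
by [].
Qed.

(** The mixed derivatives agree at points arbitrarily near [q], by
    [second_difference], and both are continuous. *)
Lemma schwarz U f q i j : open U -> U q -> Ck_on 2 U f ->
  pd i (pd j f) q = pd j (pd i f) q.
Proof.
move=> oU Uq sf; have [e e0 eU] := open_ball_sub oU Uq.
have sfe : Ck_on 2 (ball q e) f by exact: Ck_on_sub eU sf.
have cij k l : {for q, continuous (pd k (pd l f))}.
  exact: (Ck_on_continuous Uq (Ck_on_pd k (Ck_on_pd l sf))).
apply/eqP; rewrite -subr_eq0 -normr_eq0; apply/eqP/le_anti; rewrite normr_ge0 andbT.
apply/ler_addgt0Pl => eps eps0; rewrite addr0.
have near_c k l : \forall z \near q,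
    `|pd k (pd l f) q - pd k (pd l f) z| <= eps / 2.
  apply: ((cvgrPdist_le (F := nbhs q) _ _).1 (cij k l)); by rewrite divr_gt0.
have /nbhs_ballP[d d0 dP] : \forall z \near q,
    `|pd i (pd j f) q - pd i (pd j f) z| <= eps / 2 /\
    `|pd j (pd i f) q - pd j (pd i f) z| <= eps / 2.
  exact: (filterI (F := nbhs q)) (near_c i j) (near_c j i).
pose t := Num.min d e / 4.
have mde : 0 < Num.min d e by rewrite lt_min d0 e0.
have [t0 te td] : [/\ 0 < t, t < e / 2 & 2 * t < d].
  rewrite /t; have h1 : Num.min d e <= d by rewrite ge_min lexx.
  have h2 : Num.min d e <= e by rewrite ge_min lexx orbT.
  by split; lra.
have [z1 z1q E1] := second_difference i j sfe t0 te.
have [z2 z2q F2] := second_difference j i sfe t0 te.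
have zE : pd j (pd i f) z1 = pd i (pd j f) z2.
  have t2 : t * t != 0 by rewrite mulf_neq0 // gt_eqF.
  have : pd j (pd i f) z1 * (t * t) = pd i (pd j f) z2 * (t * t).
    have sdC (A B C D : R) : A - B - C + D = A - C - B + D by ring.
    have swap : q + t *: E2 i + t *: E2 j = q + t *: E2 j + t *: E2 i.
      exact: addrAC.
    rewrite swap in E1; exact: etrans (esym E1) (etrans (sdC _ _ _ _) F2).
  by move/(mulIf t2).
have b1 : ball q d z1 by apply/ball_rV2P; rewrite distrC (le_lt_trans z1q).
have b2 : ball q d z2 by apply/ball_rV2P; rewrite distrC (le_lt_trans z2q).
have [_ h1] := dP _ b1; have [h2 _] := dP _ b2.
rewrite -(subrKA (pd i (pd j f) z2)) (splitr eps).
apply: le_trans (ler_normD _ _) _; apply: lerD; first exact: h2.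
by rewrite -zE distrC; exact: h1.
Qed.

End Schwarz.

Section BallEstimates.
Context {R : realType}.
Implicit Types (p q x y : 'rV[R]_2) (f g : 'rV[R]_2 -> R^o).

Lemma ball_constant f q e p :
  (forall i z, ball q e z -> is_derive z (E2 i) f 0) ->
  ball q e p -> f p = f q.
Proof.
move=> df qp.
have qq : ball q e q by apply: ballxx; move/ball_rV2P: qp; exact: le_lt_trans.
have [z1 [z2 [b1 b2 fE]]] := box_mvt qq qp (fun i z hz => is_derive_derivable (df i z hz)).
apply/eqP; rewrite -subr_eq0 fE.
rewrite (pd_is_derive (df 0 z1 (ball_box qq qp b1))).
by rewrite (pd_is_derive (df 1 z2 (ball_box qq qp b2))) !mul0r addr0.
Qed.

Lemma ball_lipschitz f q e x y (K : R) :
  (forall i z, ball q e z -> derivable f z (E2 i)) ->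
  (forall i z, ball q e z -> `|pd i f z| <= K) ->
  ball q e x -> ball q e y -> `|f x - f y| <= 2 * K * `|x - y|.
Proof.
move=> df fK qx qy; rewrite distrC [`|x - y|]distrC.
have [z1 [z2 [b1 b2 ->]]] := box_mvt qx qy df.
have k1 := fK 0 _ (ball_box qx qy b1); have k2 := fK 1 _ (ball_box qx qy b2).
apply: le_trans (ler_normD _ _) _; rewrite !normrM mulrDl mul1r mulrDl.
have n0 := normr_rV_le (y - x) 0; have n1 := normr_rV_le (y - x) 1.
rewrite !mxE in n0 n1.
by apply: lerD; apply: ler_pM.
Qed.

End BallEstimates.

(** * The inverse function theorem *)

Section Mat2.
Context {R : fieldType}.

Lemma det2 (M : 'M[R]_2) : \det M = M 0 0 * M 1 1 - M 0 1 * M 1 0.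
Proof.
rewrite (expand_det_row _ 0) sum_I2 /cofactor !det_mx11 !mxE /=.
have -> : lift 0 0 = 1 :> 'I_2 by exact/val_inj.
have -> : lift 1 0 = 0 :> 'I_2 by exact/val_inj.
by rewrite addn0 expr0 expr1 mul1r mulN1r mulrN.
Qed.

Lemma mul_rV2 n (v : 'rV[R]_2) (M : 'M[R]_(2, n)) j :
  (v *m M) 0 j = v 0 0 * M 0 j + v 0 1 * M 1 j.
Proof. by rewrite mxE sum_I2. Qed.

Lemma invmx2 (M : 'M[R]_2) : \det M != 0 ->
  [/\ invmx M 0 0 = (\det M)^-1 * M 1 1, invmx M 0 1 = - ((\det M)^-1 * M 0 1),
      invmx M 1 0 = - ((\det M)^-1 * M 1 0) & invmx M 1 1 = (\det M)^-1 * M 0 0].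
Proof.
move=> d0; have uM : M \in unitmx by rewrite unitmxE unitfE.
pose N : 'M[R]_2 := \matrix_(i, j)
  ((\det M)^-1 * (if i == 0 then if j == 0 then M 1 1 else - M 0 1
                  else if j == 0 then - M 1 0 else M 0 0)).
have MN : M *m N = 1%:M.
  apply/matrixP; apply: forall_I2; apply: forall_I2; rewrite !mxE sum_I2 !mxE /=;
    move: d0; rewrite det2 => d0; field => //.
have -> : invmx M = N by rewrite -[N]mul1mx -(mulVmx uM) -mulmxA MN mulmx1.
by rewrite !mxE /= !mulrN.
Qed.

End Mat2.

(** The contraction principle needs the plane as a complete space. *)
HB.instance Definition _ (R : realType) m n := Complete.on 'M[R]_(m, n).

Section InverseFunction.
Context {R : realType}.
Implicit Types (p q x y : 'rV[R]_2) (U W B : set 'rV[R]_2)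
  (f : 'rV[R]_2 -> 'rV[R]_2).

Lemma mulmx_bound n (M : 'M[R]_(2, n)) :
  exists2 C : R, 0 < C & forall v : 'rV[R]_2, `|v *m M| <= C * `|v|.
Proof.
pose C : R := \sum_j (`|M 0 j| + `|M 1 j|) + 1.
have C0 : 0 < C by rewrite ltr_pwDr // sumr_ge0 // => j _; rewrite addr_ge0.
exists C => // v; rewrite {1}/Num.norm /= mx_normrE.
apply/bigmax_leP; split=> [|[i j] _]; first by rewrite mulr_ge0 // ltW.
rewrite ord1 /= mul_rV2 (le_trans (ler_normD _ _)) // !normrM.
apply: (@le_trans _ _ ((`|M 0 j| + `|M 1 j|) * `|v|)).
  rewrite mulrDl; apply: lerD; rewrite mulrC ler_wpM2l // normr_rV_le //.
rewrite ler_wpM2r // /C (bigD1 j) //= -addrA lerDl addr_ge0 // sumr_ge0 // => k _.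
Qed.

Lemma is_derive_coord q i (j : 'I_2) :
  is_derive q (E2 i) (fun r : 'rV[R]_2 => r 0 j : R^o) (i == j)%:R.
Proof.
have did : derivable (@id 'rV[R]_2) q (E2 i) by exact: derivable_id.
apply: DeriveDef; first exact: ((derivable_rV _ _ _).1 did j).
by have := pd_coord j did; rewrite /pd derive_id E2E.
Qed.

Lemma Ck_on_coord k U (j : 'I_2) : open U ->
  Ck_on k U (fun r : 'rV[R]_2 => r 0 j : R^o).
Proof.
have cc q : {for q, continuous (fun r : 'rV[R]_2 => r 0 j : R^o)}.
  exact: coord_continuous.
move=> oU; case: k => [|k]; first by split=> // q _; exact: cc.
apply: (@Ck_on_intro R R^o k U _ (fun i _ => (i == j)%:R)) => //.
- by move=> i q _; exact: is_derive_coord.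
- by move=> i; exact: Ck_on_cst.
Qed.

Lemma jacE n (f : 'rV[R]_2 -> 'rV[R]_n.+1) q i j : jac f q i j = pd i f q 0 j.
Proof. by rewrite mxE. Qed.

Lemma Ck_on_jac k U n (f : 'rV[R]_2 -> 'rV[R]_n.+1) i j : open U ->
  Ck_on k.+1 U f -> Ck_on k U (fun r => jac f r i j : R^o).
Proof.
move=> oU sf.
apply: Ck_on_eq oU _ ((Ck_on_rV k _ oU).1 (Ck_on_pd i sf) j) => p _.
by rewrite jacE.
Qed.

Lemma Ck_on_det_jac k U f : open U -> Ck_on k.+1 U f ->
  Ck_on k U (fun r => \det (jac f r) : R^o).
Proof.
move=> oU sf.
apply: (@Ck_on_eq _ _ _ _ (fun r =>
  jac f r 0 0 * jac f r 1 1 - jac f r 0 1 * jac f r 1 0 : R^o)) => //.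
  by move=> p _; rewrite det2.
by apply: Ck_onB => //; apply: Ck_onM => //; exact: Ck_on_jac.
Qed.

(** The map [x - f x A^-1], with [A] the Jacobian matrix at [q0], has zero
    derivatives at [q0], hence small ones nearby. *)
Lemma near_contraction U f q0 : open U -> U q0 -> Ck_on 2 U f ->
  \det (jac f q0) != 0 ->
  exists2 e, 0 < e & [/\ ball q0 e `<=` U,
    forall q, ball q0 e q -> \det (jac f q) != 0 &
    forall x y, ball q0 e x -> ball q0 e y ->
      `|(x - f x *m invmx (jac f q0)) - (y - f y *m invmx (jac f q0))|
         <= 2^-1 * `|x - y|].
Proof.
move=> oU Uq sf d0; set N := invmx _.
have uA : jac f q0 \in unitmx by rewrite unitmxE unitfE.
pose G (j : 'I_2) (r : 'rV[R]_2) : R^o := r 0 j - (f r 0 0 * N 0 j + f r 0 1 * N 1 j).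
have fj j : Ck_on 2 U (fun r => f r 0 j : R^o) by exact: ((Ck_on_rV _ _ oU).1 sf).
have sG j : Ck_on 2 U (G j).
  apply: Ck_onB => //; first exact: Ck_on_coord.
  by apply: Ck_onD => //; apply: Ck_onM => //; exact: Ck_on_cst.
have dG j i : pd i (G j) q0 = 0.
  have dfk k : is_derive q0 (E2 i) (fun r => f r 0 k : R^o) (jac f q0 i k).
    have := is_derive_pd (Ck_on_derivable (i := i) Uq (fj k)).
    by rewrite jacE pd_coord //; exact: Ck_on_derivable Uq sf.
  have dfkN k : is_derive q0 (E2 i) (fun r => f r 0 k * N k j : R^o)
      (jac f q0 i k * N k j).
    apply: is_derive_eq (is_derive_mul (dfk k) (is_derive_cst (N k j : R^o) q0 _)) _.
    by rewrite mulr0 addr0.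
  have := is_deriveB (is_derive_coord q0 i j) (is_deriveD (dfkN 0) (dfkN 1)).
  move/pd_is_derive => ->.
  have hE : (jac f q0 *m N) i j = (i == j)%:R by rewrite mulmxV // mxE.
  rewrite mxE sum_I2 in hE.
  by apply/eqP; rewrite subr_eq0; apply/eqP; exact: esym hE.
have near_G j i : \forall r \near q0, `|pd i (G j) r| <= 4^-1.
  have cG : {for q0, continuous (pd i (G j))}.
    exact: (Ck_on_continuous Uq (Ck_on_pd i (sG j))).
  have h : 0 < (4^-1 : R) by rewrite invr_gt0.
  have := near_dist_lt cG h.
  by apply: filterS => r; rewrite dG sub0r normrN => /ltW.
have near_det : \forall r \near q0, \det (jac f r) != 0.
  have cd : {for q0, continuous (fun r => \det (jac f r) : R^o)}.
    exact: (Ck_on_continuous Uq (Ck_on_det_jac oU sf)).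
  exact: near_neq0.
have nG j : \forall r \near q0, forall i, `|pd i (G j) r| <= 4^-1.
  by apply: (filter_forall (F := nbhs q0)) => i; exact: near_G.
have /nbhs_ballP[e e0 eP] : \forall r \near q0,
    (U r /\ \det (jac f r) != 0) /\ forall j i, `|pd i (G j) r| <= 4^-1.
  apply: (filterI (F := nbhs q0)).
    apply: (filterI (F := nbhs q0)); [exact: open_nbhs_nbhs | exact: near_det].
  by apply: (filter_forall (F := nbhs q0)).
exists e; [exact: e0 | split].
- by move=> r /eP[[]].
- by move=> r /eP[[]].
- move=> x y ex ey.
  have key j : `|G j x - G j y| <= 2^-1 * `|x - y|.
    have -> : 2^-1 = 2 * 4^-1 :> R by field.
    apply: ball_lipschitz ex ey => i z /eP[[Uz _] hz]; last exact: hz.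
    exact: Ck_on_derivable Uz (sG j).
  have GE j r : (r - f r *m N) 0 j = G j r.
    by rewrite [LHS]mxE [X in _ + X]mxE mul_rV2.
  by apply: norm_rV2_le; rewrite ?mulr_ge0 // ?invr_ge0 // [X in `|X|]mxE
    [X in _ + X]mxE !GE.
Qed.

(** The equation [f z = y] says that [z] is a fixed point of
    [z - f z A^-1 + y A^-1], a contraction of a closed ball around [x] when [y]
    is near [f x].  The lower bound on [|f x - f y|] follows from the same
    contraction estimate. *)
Lemma local_homeo U f q0 : open U -> U q0 -> Ck_on 2 U f ->
  \det (jac f q0) != 0 ->
  exists2 e, 0 < e & [/\ ball q0 e `<=` U,
    forall q, ball q0 e q -> \det (jac f q) != 0,
    open (f @` ball q0 e) &
    exists2 C, 0 < C & forall x y, ball q0 e x -> ball q0 e y ->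
      `|x - y| <= C * `|f x - f y|].
Proof.
move=> oU Uq sf d0; have uA : jac f q0 \in unitmx by rewrite unitmxE unitfE.
have [e e0 [eU ed contr]] := near_contraction oU Uq sf d0.
set N := invmx _ in contr.
have [C C0 CN] := mulmx_bound N.
have low x y : ball q0 e x -> ball q0 e y -> `|x - y| <= 2 * C * `|f x - f y|.
  move=> ex ey; have h := contr x y ex ey.
  have E : x - y = (x - f x *m N - (y - f y *m N)) + (f x - f y) *m N.
    rewrite mulmxBl; move: (f x *m N) (f y *m N) => a b.
    by apply: rV2P; rewrite !mxE; ring.
  have := ler_normD (x - f x *m N - (y - f y *m N)) ((f x - f y) *m N).
  rewrite -E => h2; have h3 := CN (f x - f y).
  lra.
exists e => //; split=> //; last by exists (2 * C) => //; rewrite mulr_gt0.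
rewrite openE => _ [x ex <-].
have [r r0 rB] : exists2 r, 0 < r & forall z, `|x - z| <= r -> ball q0 e z.
  have /ball_rV2P xe := ex.
  exists ((e - `|q0 - x|) / 2); first by rewrite divr_gt0 // subr_gt0.
  move=> z xz; apply/ball_rV2P; rewrite -(subrKA x) (le_lt_trans (ler_normD _ _)) //.
  lra.
rewrite /interior /=; apply/nbhs_ballP.
exists (r / (2 * C)) => [|y /ball_rV2P fxy]; first by rewrite /= divr_gt0 // mulr_gt0.
pose D : set 'rV[R]_2 := [set z | `|x - z| <= r].
pose T z := z - f z *m N + y *m N.
have xTz z : D z -> `|x - T z| <= r.
  move=> Dz.
  have E : x - T z = (x - f x *m N - (z - f z *m N)) + (f x - y) *m N.
    rewrite /T mulmxBl; move: (f x *m N) (f z *m N) (y *m N) => a b c.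
    by apply: rV2P; rewrite !mxE; ring.
  have h1 := contr x z ex (rB z Dz).
  have h2 := CN (f x - y); have h3 : C * `|f x - y| <= r / 2.
    have -> : r / 2 = C * (r / (2 * C)) by field; rewrite gt_eqF.
    by rewrite ler_wpM2l // ltW.
  have := ler_normD (x - f x *m N - (z - f z *m N)) ((f x - y) *m N).
  rewrite -E /D /= in Dz *; lra.
have TD : {homo T : z / D z >-> D z} by [].
pose TT : {fun D >-> D} := mkfun TD.
have cT : is_contraction TT.
  exists (2^-1)%:nng; split; first by rewrite /= invf_lt1 // ltr1n.
  move=> [a b] [/= Da Db].
  have -> : T a - T b = a - f a *m N - (b - f b *m N).
    by rewrite /T opprD addrACA subrr addr0.
  exact: contr (rB a Da) (rB b Db).
have clD : closed D.
  have -> : D = closed_ball x r by rewrite closed_ballE.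
  exact: closed_ball_closed.
have [z Dz zE] : exists2 z, D z & z = TT z.
  apply: banach_fixed_point => //; exists x.
  by rewrite /D /= subrr normr0 ltW.
exists z; first exact: rB.
have : f z *m N = y *m N.
  move: zE; rewrite /TT /= /mkfun /T -addrA => /eqP.
  rewrite -{1}[z]addr0 (inj_eq (addrI z)) eq_sym addrC subr_eq0 => /eqP.
  by [].
move/(congr1 (fun v => v *m jac f q0)).
by rewrite -!mulmxA mulVmx // !mulmx1.
Qed.

(** The difference quotients of the inverse converge to the inverse of the
    Jacobian matrix, because the Lipschitz bound on the inverse turns the
    first-order expansion of [f] into one of the inverse. *)
Lemma is_derive_local_inverse B f (chi : 'rV[R]_2 -> 'rV[R]_2) (C : R) x0 i :
  open B -> B x0 -> Ck_on 1 B f -> \det (jac f x0) != 0 ->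
  (forall x, B x -> chi (f x) = x) -> open (f @` B) -> 0 < C ->
  (forall x y, B x -> B y -> `|x - y| <= C * `|f x - f y|) ->
  is_derive (f x0) (E2 i) chi (row i (invmx (jac f x0))).
Proof.
move=> oB Bx sf d0 chiK oF C0 low; set J := jac f x0.
have uJ : J \in unitmx by rewrite unitmxE unitfE.
have [K K0 KN] := mulmx_bound (invmx J).
have fj j : Ck_on 1 B (fun r => f r 0 j : R^o) by exact: ((Ck_on_rV _ _ oB).1 sf).
have Jij a j : pd a (fun r => f r 0 j : R^o) x0 = J a j.
  by rewrite /J jacE pd_coord //; exact: Ck_on_derivable Bx sf.
have cvg_q : h^-1 *: ((chi \o shift (f x0)) (h *: E2 i) - chi (f x0))
      @[h --> 0^'] --> row i (invmx J).
  apply/cvgrPdist_le => eps eps0.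
  pose eta := eps / (K * C).
  have eta0 : 0 < eta by rewrite divr_gt0 // mulr_gt0.
  have exp j : \forall p \near x0, `|f p 0 j - f x0 0 j -
      ((p - x0) 0 0 * J 0 j + (p - x0) 0 1 * J 1 j)| <= eta * `|p - x0|.
    have := @C1_expansion R B (fun r => f r 0 j : R^o) x0 eta oB Bx eta0.
    rewrite !Jij; apply.
      by move=> a z Bz; exact: Ck_on_derivable Bz (fj j).
    by move=> a; exact: (Ck_on_continuous Bx (Ck_on_pd a (fj j))).
  have /nbhs_ballP[d /= dg0 dP] : \forall p \near x0, forall j,
      `|f p 0 j - f x0 0 j - ((p - x0) 0 0 * J 0 j + (p - x0) 0 1 * J 1 j)|
        <= eta * `|p - x0|.
    by apply: (filter_forall (F := nbhs x0)).
  have [e e0 eF] := open_ball_sub oF (imageP f Bx).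
  have m0 : 0 < Num.min e (d / C) by rewrite lt_min e0 divr_gt0.
  apply/nbhs_ballP; exists (Num.min e (d / C)) => //= h /=.
  rewrite /ball /= sub0r normrN lt_min => /andP[he hd] h0.
  have [x Bx' fxE] : (f @` B) (h *: E2 i + f x0).
    apply: eF; apply/ball_rV2P; rewrite opprD addrCA subrr addr0 normrN.
    by rewrite normrZ norm_E2 mulr1.
  rewrite -fxE !chiK //.
  have fxB : f x - f x0 = h *: E2 i by rewrite fxE addrK.
  have hn : `|f x - f x0| = `|h| by rewrite fxB normrZ norm_E2 mulr1.
  have xx0 : `|x - x0| <= C * `|h| by rewrite -hn; exact: low.
  have xd : ball x0 d x.
    apply/ball_rV2P; rewrite distrC (le_lt_trans xx0) // mulrC -ltr_pdivlMr //.
  have hx j := dP x xd j.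
  have err : `|h *: E2 i - (x - x0) *m J| <= eta * C * `|h|.
    have : forall j, `|(h *: E2 i - (x - x0) *m J : 'rV[R]_2) 0 j| <= eta * C * `|h|.
      move=> j; have := hx j; rewrite [X in _ -> `|X| <= _]mxE -fxB [X in _ -> `|X + _| <= _]mxE.
      rewrite [X in _ -> `|_ + X + _| <= _]mxE [X in _ -> `|_ + X| <= _]mxE mul_rV2 => hj.
      by apply: le_trans hj _; rewrite -mulrA ler_wpM2l // ltW.
    move=> hj; apply: norm_rV2_le => //.
    by apply: mulr_ge0 => //; apply: mulr_ge0; exact: ltW.
  have E : row i (invmx J) - h^-1 *: (x - x0)
      = h^-1 *: ((h *: E2 i - (x - x0) *m J) *m invmx J).
    rewrite mulmxBl -mulmxA mulmxV // mulmx1 -scalemxAl -rowE.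
    by rewrite [RHS]scalerBr scalerA mulVf // scale1r.
  rewrite E normrZ normfV ler_pdivrMl ?normr_gt0 // (le_trans (KN _)) //.
  apply: le_trans (ler_wpM2l (ltW K0) err) _.
  by rewrite /eta le_eqVlt; apply/orP; left; apply/eqP; field; rewrite !gt_eqF.
apply: DeriveDef; first by apply/cvg_ex; exists (row i (invmx J)).
exact: cvg_lim cvg_q.
Qed.

End InverseFunction.

Section InverseSmooth.
Context {R : realType}.
Implicit Types (p q x y : 'rV[R]_2) (U W B : set 'rV[R]_2)
  (f : 'rV[R]_2 -> 'rV[R]_2).

Lemma Ck_on_det2 k U (M : 'rV[R]_2 -> 'M[R]_2) : open U ->
  (forall i j, Ck_on k U (fun r => M r i j : R^o)) ->
  Ck_on k U (fun r => \det (M r) : R^o).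
Proof.
move=> oU sM.
apply: (@Ck_on_eq _ _ _ _ (fun r => M r 0 0 * M r 1 1 - M r 0 1 * M r 1 0 : R^o)).
- exact: oU.
- by move=> p _; rewrite det2.
- exact: (Ck_onB oU (Ck_onM oU (sM 0 0) (sM 1 1)) (Ck_onM oU (sM 0 1) (sM 1 0))).
Qed.

Lemma Ck_on_invmx k U (M : 'rV[R]_2 -> 'M[R]_2) : open U ->
  (forall q, U q -> \det (M q) != 0) ->
  (forall i j, Ck_on k U (fun r => M r i j : R^o)) ->
  forall i j, Ck_on k U (fun r => invmx (M r) i j : R^o).
Proof.
move=> oU d0 sM; have sV := Ck_onV oU d0 (Ck_on_det2 oU sM).
apply: forall_I2; apply: forall_I2.
- apply: Ck_on_eq oU _ (Ck_onM oU sV (sM 1 1)) => p /d0 /invmx2[h _ _ _].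
  by rewrite h.
- apply: Ck_on_eq oU _ (Ck_onN oU (Ck_onM oU sV (sM 0 1))) => p /d0 /invmx2[_ h _ _].
  by rewrite h.
- apply: Ck_on_eq oU _ (Ck_onN oU (Ck_onM oU sV (sM 1 0))) => p /d0 /invmx2[_ _ h _].
  by rewrite h.
- apply: Ck_on_eq oU _ (Ck_onM oU sV (sM 0 0)) => p /d0 /invmx2[_ _ _ h].
  by rewrite h.
Qed.

(** Induction on the class: the derivatives of the inverse are the entries of
    the inverse Jacobian matrix composed with the inverse itself. *)
Lemma inverse_smooth B f (chi : 'rV[R]_2 -> 'rV[R]_2) (C : R) :
  open B -> smooth_on B f -> (forall x, B x -> \det (jac f x) != 0) ->
  (forall x, B x -> chi (f x) = x) -> open (f @` B) -> 0 < C ->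
  (forall x y, B x -> B y -> `|x - y| <= C * `|f x - f y|) ->
  smooth_on (f @` B) chi.
Proof.
move=> oB sf d0 chiK oF C0 low.
have cchi q : (f @` B) q -> {for q, continuous chi}.
  move=> [x Bx <-]; rewrite /prop_for /continuous_at chiK //.
  apply/(cvgrPdist_lt (F := nbhs (f x)) chi x) => e e0.
  have near_F : \forall z \near f x, (f @` B) z.
    by apply: near_open => //; exists x.
  have near_e : \forall z \near f x, `|f x - z| < e / C.
    by apply/nbhs_ballP; exists (e / C) => [|z /ball_rV2P //]; rewrite /= divr_gt0.
  move: near_F near_e; apply: filterS2 => _ [y By <-] h; rewrite chiK //.
  by rewrite (le_lt_trans (low x y Bx By)) // mulrC -ltr_pdivlMr.
elim=> [|k ih]; first by split=> // q /cchi.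
apply: (@Ck_on_intro R _ k _ chi (fun i y => row i (invmx (jac f (chi y))))) => //.
- move=> i _ [x Bx <-]; rewrite chiK //.
  exact: (is_derive_local_inverse i oB Bx (sf 1%N) (d0 x Bx) chiK oF C0 low).
- move=> i; apply/(Ck_on_rV k _ oF) => j.
  have sJ := Ck_on_invmx oB d0 (fun a b => Ck_on_jac a b oB (sf k.+1)) i j.
  have chiB q : (f @` B) q -> B (chi q) by move=> [x Bx <-]; rewrite chiK.
  by apply: Ck_on_eq oF _ (Ck_on_comp oB oF chiB sJ ih) => p _; rewrite mxE.
Qed.

Theorem inverse_function U f q0 : open U -> U q0 -> smooth_on U f ->
  \det (jac f q0) != 0 ->
  exists (B : set 'rV[R]_2) (chi : 'rV[R]_2 -> 'rV[R]_2),
  [/\ [/\ open B, B q0 & B `<=` U], open (f @` B),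
      forall x, B x -> chi (f x) = x & smooth_on (f @` B) chi].
Proof.
move=> oU Uq sf d0.
have [e e0 [eU ed oF [C C0 low]]] := local_homeo oU Uq (sf 2%N) d0.
pose B := ball q0 e; pose chi y := xget q0 [set x | B x /\ f x = y].
have chiK x : B x -> chi (f x) = x.
  move=> Bx; have ex : exists z, [set z | B z /\ f z = f x] z by exists x.
  have [Bz fz] := xgetPex q0 ex.
  have := low _ _ Bz Bx; rewrite fz subrr normr0 mulr0 normr_le0 subr_eq0.
  by move/eqP.
have oB : open B by exact: ball_open.
have sB : smooth_on B f by move=> k; exact: Ck_on_sub eU (sf k).
exists B, chi; split=> //; first by split=> //; exact: ballxx.
exact: (inverse_smooth oB sB ed chiK oF C0 low).
Qed.

End InverseSmooth.

(** * The Poincare lemma *)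

Section Poincare.
Context {R : realType}.
Implicit Types (p q : 'rV[R]_2) (U : set 'rV[R]_2) (f : 'rV[R]_2 -> R^o).
Local Notation mu := (@lebesgue_measure R).

Let pt (a b : R) : 'rV[R]_2 := a *: E2 0 + b *: E2 1.

Lemma pt_coord q : pt (q 0 0) (q 0 1) = q.
Proof. by rewrite /pt -rV2_decomp. Qed.

Lemma ball_pt q (e a b : R) : 0 < e -> `|a - q 0 0| < e -> `|b - q 0 1| < e ->
  ball q e (pt a b).
Proof.
move=> e0 ha hb; apply/ball_rV2P; apply: norm_rV2_lt => //.
  by move: ha; rewrite distrC !mxE /= mulr1 mulr0 addr0.
by move: hb; rewrite distrC !mxE /= mulr1 mulr0 add0r.
Qed.

Lemma is_derive_axis0 (F : R -> R -> R^o) q (d : R^o) :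
  is_derive (q 0 0) (1 : R) (fun x => F x (q 0 1)) d ->
  is_derive q (E2 0) (fun r => F (r 0 0) (r 0 1) : R^o) d.
Proof.
move=> [h1 h2].
have E : (fun h : R => h^-1 *:
    (((fun r => F (r 0 0) (r 0 1) : R^o) \o shift q) (h *: E2 0) - F (q 0 0) (q 0 1)))
    = (fun h => h^-1 *: (((fun x => F x (q 0 1)) \o shift (q 0 0)) (h *: (1 : R))
        - F (q 0 0) (q 0 1))).
  by apply/funext => h /=; rewrite [h *: _ + q]addrC !add_scale_E2 /= mulr0 addr0
    [q 0 0 + _]addrC.
by apply: DeriveDef; [move: h1|move: h2]; rewrite /derivable /derive /= E.
Qed.

Lemma is_derive_axis1 (F : R -> R -> R^o) q (d : R^o) :
  is_derive (q 0 1) (1 : R) (fun y => F (q 0 0) y) d ->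
  is_derive q (E2 1) (fun r => F (r 0 0) (r 0 1) : R^o) d.
Proof.
move=> [h1 h2].
have E : (fun h : R => h^-1 *:
    (((fun r => F (r 0 0) (r 0 1) : R^o) \o shift q) (h *: E2 1) - F (q 0 0) (q 0 1)))
    = (fun h => h^-1 *: (((fun y => F (q 0 0) y) \o shift (q 0 1)) (h *: (1 : R))
        - F (q 0 0) (q 0 1))).
  by apply/funext => h /=; rewrite [h *: _ + q]addrC !add_scale_E2 /= mulr0 addr0
    [q 0 1 + _]addrC.
by apply: DeriveDef; [move: h1|move: h2]; rewrite /derivable /derive /= E.
Qed.

Lemma is_derive_pt0 f x y : derivable f (pt x y) (E2 0) ->
  is_derive x (1 : R) (fun s => f (pt s y)) (pd 0 f (pt x y)).
Proof.
have E s : pt s y = y *: E2 1 + s *: E2 0 by rewrite /pt addrC.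
rewrite (_ : (fun s => f (pt s y)) = (fun s => f (y *: E2 1 + s *: E2 0))).
  by rewrite E; exact: is_derive_slice.
by apply/funext => s; rewrite E.
Qed.

Lemma is_derive_pt1 f x y : derivable f (pt x y) (E2 1) ->
  is_derive y (1 : R) (fun s => f (pt x s)) (pd 1 f (pt x y)).
Proof. exact: is_derive_slice. Qed.

Lemma continuous_slice1 f x y : {for pt x y, continuous f} ->
  {for y, continuous (fun s : R => f (pt x s) : R^o)}.
Proof.
move=> cf; apply: (@continuous_comp _ _ _ (fun s : R => pt x s) f) => //.
apply: continuousD; first exact: cst_continuous.
exact: scalel_continuous.
Qed.

Lemma continuous_slice0 f x y : {for pt x y, continuous f} ->
  {for x, continuous (fun s : R => f (pt s y) : R^o)}.
Proof.
move=> cf; apply: (@continuous_comp _ _ _ (fun s : R => pt s y) f) => //.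
apply: continuousD; last exact: cst_continuous.
exact: scalel_continuous.
Qed.

Lemma continuous_integrable (k : R -> R^o) (a b : R) :
  (forall t, a <= t <= b -> {for t, continuous k}) ->
  mu.-integrable `[a, b] (EFin \o k).
Proof.
move=> ck; apply: continuous_compact_integrable; first exact: segment_compact.
apply: continuous_in_subspaceT => t; rewrite inE /= in_itv /=; exact: ck.
Qed.

Lemma is_derive_integral (k : R -> R^o) (a b y : R) : a < y -> y < b ->
  (forall t, a <= t <= b -> {for t, continuous k}) ->
  is_derive y (1 : R) (fun s => \int[mu]_(t in `[a, s]) k t : R^o) (k y).
Proof.
move=> ay yb ck.
have [] := @continuous_FTC1_closed R k a y b yb (continuous_integrable ck) ay.
  by apply: ck; rewrite !ltW.
by move=> h1 h2; apply: (DeriveDef h1); rewrite -derive1E; exact: h2.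
Qed.

Lemma integral_derive (F k : R -> R^o) (a b : R) : a < b ->
  (forall t, a <= t <= b -> {for t, continuous k}) ->
  (forall t, a <= t <= b -> is_derive t (1 : R) F (k t)) ->
  \int[mu]_(t in `[a, b]) k t = F b - F a.
Proof.
move=> ab ck dF.
have cF t : a <= t <= b -> {for t, continuous F}.
  by move=> /dF[h _]; apply/differentiable_continuous/derivable1_diffP.
rewrite /Rintegral (@continuous_FTC2 R k F a b ab) //.
- apply: continuous_in_subspaceT => t; rewrite inE /= in_itv /=; exact: ck.
- split.
  + by move=> t; rewrite in_itv /= => /andP[h1 h2]; have [] := dF t; rewrite ?ltW.
  + by apply: cvg_at_right_filter; apply: cF; rewrite lexx ltW.
  + by apply: cvg_at_left_filter; apply: cF; rewrite lexx ltW.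
- move=> t; rewrite in_itv /= => /andP[h1 h2].
  have ht : a <= t <= b by rewrite !ltW.
  by have [_ E] := dF t ht; rewrite derive1E.
Qed.

(** The primitive is the integral along the path made of a horizontal and a
    vertical segment.  Its vertical derivative is clear; its horizontal one
    is computed by differentiating under the integral sign and using that the
    form is closed. *)
Theorem poincare U q0 (alpha : 'I_2 -> 'rV[R]_2 -> R^o) : open U -> U q0 ->
  (forall i, Ck_on 1 U (alpha i)) ->
  (forall q, U q -> pd 0 (alpha 1) q = pd 1 (alpha 0) q) ->
  exists e u, [/\ 0 < e, ball q0 e `<=` U &
    forall i q, ball q0 e q -> is_derive q (E2 i) (u : _ -> R^o) (alpha i q)].
Proof.
move=> oU Uq sa clo.
have cpd i j q : U q -> {for q, continuous (pd j (alpha i))}.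
  by move=> Uq'; exact: (Ck_on_continuous Uq' (Ck_on_pd j (sa i))).
have /nbhs_ballP[d /= dg0 dP] : \forall z \near q0,
    U z /\ `|pd 0 (alpha 1) q0 - pd 0 (alpha 1) z| < 1.
  apply: (filterI (F := nbhs q0)); first exact: near_open.
  exact: near_dist_lt (cpd _ _ _ Uq) ltr01.
pose K := `|pd 0 (alpha 1) q0| + 1.
have hK z : ball q0 d z -> `|pd 0 (alpha 1) z| <= K.
  move=> /dP[_ h]; rewrite -[X in `|X|](subKr (pd 0 (alpha 1) q0)).
  by rewrite (le_trans (ler_normB _ _)) // lerD2l ltW.
pose a0 := q0 0 0; pose b0 := q0 0 1; pose e := d / 2.
have e0 : 0 < e by rewrite divr_gt0.
have ed : e < d by rewrite /e; lra.
have inB x t : `|x - a0| < d -> `|t - b0| < d -> ball q0 d (pt x t).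
  exact: ball_pt.
have inU x t : `|x - a0| < d -> `|t - b0| < d -> U (pt x t).
  by move=> hx ht; have [] := dP _ (inB _ _ hx ht).
have tb t y : `|y - b0| < e -> b0 - e <= t <= y -> `|t - b0| < d.
  rewrite !ltr_norml => /andP[h1 h2] /andP[h3 h4]; apply/andP; split; lra.
have tb' t : b0 - e <= t <= b0 + e -> `|t - b0| < d.
  rewrite !ltr_norml => /andP[h1 h2]; apply/andP; split; lra.
have sa' t : a0 - e <= t <= a0 + e -> `|t - a0| < d.
  rewrite !ltr_norml => /andP[h1 h2]; apply/andP; split; lra.
pose I x y : R^o := \int[mu]_(t in `[b0 - e, y]) alpha 1 (pt x t).
pose A x : R^o := \int[mu]_(s in `[a0 - e, x]) alpha 0 (pt s (b0 - e)).
have ca i q : U q -> {for q, continuous (alpha i)}.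
  by move=> Uq'; exact: (Ck_on_continuous Uq' (sa i)).
have dalpha i j q : U q -> derivable (alpha i) q (E2 j).
  by move=> Uq'; exact: (Ck_on_derivable Uq' (sa i)).
have dA x : `|x - a0| < e -> is_derive x (1 : R) A (alpha 0 (pt x (b0 - e))).
  move=> hx; have /andP[h1 h2] : (a0 - e < x < a0 + e).
    by move: hx; rewrite ltr_norml => /andP[h1 h2]; apply/andP; split; lra.
  apply: (is_derive_integral (k := fun s => alpha 0 (pt s (b0 - e))) h1 h2) => t ht.
  apply: continuous_slice0; apply: ca; apply: inU; first exact: sa'.
  by apply: tb'; apply/andP; split; lra.
have dIy x y : `|x - a0| < e -> `|y - b0| < e ->
    is_derive y (1 : R) (I x) (alpha 1 (pt x y)).
  move=> hx hy; have /andP[h1 h2] : (b0 - e < y < b0 + e).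
    by move: hy; rewrite ltr_norml => /andP[h1 h2]; apply/andP; split; lra.
  apply: (is_derive_integral (k := fun s => alpha 1 (pt x s)) h1 h2) => t ht.
  apply: continuous_slice1; apply: ca; apply: inU; first exact: lt_trans ed.
  exact: tb'.
have dIx x y : `|x - a0| < e -> `|y - b0| < e ->
    is_derive x (1 : R) (I^~ y) (alpha 0 (pt x y) - alpha 0 (pt x (b0 - e))).
  move=> hx hy.
  have h1 : b0 - e < y by move: hy; rewrite ltr_norml => /andP[? ?]; lra.
  have xI : x \in `]a0 - e, a0 + e[.
    by move: hx; rewrite in_itv /= ltr_norml => /andP[? ?]; apply/andP; split; lra.
  have xd z : z \in `]a0 - e, a0 + e[ -> `|z - a0| < d.
    rewrite in_itv /= => /andP[? ?]; apply: sa'; apply/andP; split; lra.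
  have dpt z t : z \in `]a0 - e, a0 + e[ -> b0 - e <= t <= y ->
      is_derive z (1 : R) (fun z => alpha 1 (pt z t) : R^o) (pd 0 (alpha 1) (pt z t)).
    move=> hz ht; apply: is_derive_pt0; apply: dalpha; apply: inU; first exact: xd.
    exact: tb hy ht.
  pose f z t := alpha 1 (pt z t) : R.
  have fint z : z \in `]a0 - e, a0 + e[ -> mu.-integrable `[b0 - e, y] (EFin \o f z).
    move=> hz; apply: continuous_integrable => t ht.
    apply: continuous_slice1; apply: ca; apply: inU; first exact: xd.
    exact: tb hy ht.
  have p1 z t : z \in `]a0 - e, a0 + e[ -> b0 - e <= t <= y ->
      partial1of2 f z t = pd 0 (alpha 1) (pt z t).
    by move=> hz ht; rewrite partial1of2E; have [_] := dpt z t hz ht.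
  have fder z t : z \in `]a0 - e, a0 + e[ -> t \in `[b0 - e, y] ->
      derivable (f^~ t) z 1.
    by move=> hz; rewrite in_itv /= => ht; have [] := dpt z t hz ht.
  have Gint : mu.-integrable `[b0 - e, y] (EFin \o (fun _ : R => K)).
    by apply: (continuous_integrable (k := fun=> K)) => t _; exact: cst_continuous.
  have K0 (t : R) : 0 <= K by rewrite addr_ge0.
  have Gub z t : z \in `]a0 - e, a0 + e[ -> t \in `[b0 - e, y] ->
      `|partial1of2 f z t| <= K.
    move=> hz; rewrite in_itv /= => ht; rewrite p1 //; apply: hK.
    apply: inB; [exact: xd | exact: tb hy ht].
  have D1 := @derivable_under_integral R _ _ mu f `[b0 - e, y] (measurable_itv _)
     x (a0 - e) (a0 + e) xI fint fder (fun _ => K) K0 Gint Gub.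
  have D2 := @differentiation_under_integral R _ _ mu f `[b0 - e, y] (measurable_itv _)
     x (a0 - e) (a0 + e) xI fint fder (fun _ => K) K0 Gint Gub.
  apply: DeriveDef; first exact: D1.
  rewrite -derive1E; apply: etrans D2 _.
  have ck t : b0 - e <= t <= y ->
      {for t, continuous (fun t => pd 1 (alpha 0) (pt x t) : R^o)}.
    move=> ht; apply: continuous_slice1; apply: cpd.
    apply: inU; [exact: xd | exact: tb hy ht].
  have dk t : b0 - e <= t <= y ->
      is_derive t (1 : R) (fun t => alpha 0 (pt x t) : R^o) (pd 1 (alpha 0) (pt x t)).
    move=> ht; apply: is_derive_pt1; apply: dalpha.
    apply: inU; [exact: xd | exact: tb hy ht].
  apply: etrans _ (integral_derive h1 ck dk).
  apply: eq_Rintegral => t; rewrite inE /= in_itv /= => ht.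
  rewrite p1 // clo //; apply: inU; [exact: xd | exact: tb hy ht].
pose u (r : 'rV[R]_2) : R^o := A (r 0 0) + I (r 0 0) (r 0 1).
exists e, u; split=> //.
  move=> z /ball_rV2P hz; have [] : U z /\ True; last by [].
  split=> //; have := dP z; case=> //.
  by apply/ball_rV2P; exact: lt_trans hz ed.
have coord q j : ball q0 e q -> `|q 0 j - q0 0 j| < e.
  move=> /ball_rV2P h; have := le_lt_trans (normr_rV_le _ j) h.
  by rewrite !mxE distrC.
apply: forall_I2 => q qe; have h0 := coord q 0 qe; have h1 := coord q 1 qe.
- apply: (@is_derive_axis0 (fun x y => A x + I x y)).
  apply: is_derive_eq (is_deriveD (dA _ h0) (dIx _ _ h0 h1)) _.
  by rewrite addrC subrK pt_coord.
- apply: (@is_derive_axis1 (fun x y => A x + I x y)).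
  apply: is_derive_eq (is_deriveD (is_derive_cst (A (q 0 0) : R^o) _ _) (dIy _ _ h0 h1)) _.
  by rewrite add0r pt_coord.
Qed.

End Poincare.

(** * Pseudo-Euclidean multilinear algebra *)

Section Pdot.
Context {R : realType} {n s : nat}.
Implicit Types (a b c : 'rV[R]_n) (k : R).

Definition sgn_coord (i : 'I_n) : R := if (i < n - s)%N then 1 else -1.

Lemma pdotE a b : pdot s a b = \sum_(i < n) sgn_coord i * (a 0 i * b 0 i).
Proof.
rewrite /pdot [RHS](bigID (fun i : 'I_n => (i < n - s)%N)) /=; congr (_ + _).
  by apply: eq_bigr => i h; rewrite /sgn_coord h mul1r.
rewrite -sumrN; apply: eq_big => [i|i h]; first by rewrite leqNgt.
by rewrite /sgn_coord ltnNge h mulN1r.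
Qed.

Lemma pdotC a b : pdot s a b = pdot s b a.
Proof. by rewrite !pdotE; apply: eq_bigr => i _; rewrite [a 0 i * _]mulrC. Qed.

Lemma pdotDl a b c : pdot s (a + b) c = pdot s a c + pdot s b c.
Proof.
by rewrite !pdotE -big_split; apply: eq_bigr => i _; rewrite mxE /=; ring.
Qed.

Lemma pdotZl k a b : pdot s (k *: a) b = k * pdot s a b.
Proof.
by rewrite !pdotE mulr_sumr; apply: eq_bigr => i _; rewrite mxE /=; ring.
Qed.

Lemma pdotNl a b : pdot s (- a) b = - pdot s a b.
Proof. by rewrite -scaleN1r pdotZl mulN1r. Qed.

Lemma pdotBl a b c : pdot s (a - b) c = pdot s a c - pdot s b c.
Proof. by rewrite pdotDl pdotNl. Qed.

Lemma pdot0l a : pdot s 0 a = 0.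
Proof. by rewrite -(scale0r 0) pdotZl mul0r. Qed.

Lemma pdotDr a b c : pdot s c (a + b) = pdot s c a + pdot s c b.
Proof. by rewrite !(pdotC c) pdotDl. Qed.

Lemma pdotZr k a b : pdot s b (k *: a) = k * pdot s b a.
Proof. by rewrite !(pdotC b) pdotZl. Qed.

Lemma pdotNr a b : pdot s b (- a) = - pdot s b a.
Proof. by rewrite !(pdotC b) pdotNl. Qed.

Lemma pdotBr a b c : pdot s c (a - b) = pdot s c a - pdot s c b.
Proof. by rewrite pdotDr pdotNr. Qed.

Lemma pdot0r a : pdot s a 0 = 0.
Proof. by rewrite pdotC pdot0l. Qed.

Definition pdotlE := (pdotDl, pdotBl, pdotZl, pdotNl, pdot0l).
Definition pdotrE := (pdotDr, pdotBr, pdotZr, pdotNr, pdot0r).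

(** The vector whose pairing reads off the coordinate [i]; the sign compensates
    that of the metric. *)
Definition dual_vec (i : 'I_n) : 'rV[R]_n := sgn_coord i *: delta_mx 0 i.

Lemma sgn_coordK (i : 'I_n) : sgn_coord i * sgn_coord i = 1.
Proof. by rewrite /sgn_coord; case: ifP; rewrite ?mulrNN mulr1. Qed.

Lemma pdot_dual a i : pdot s a (dual_vec i) = a 0 i.
Proof.
rewrite pdotE (bigD1 i) //= big1 ?addr0 => [|j ji].
  by rewrite !mxE !eqxx mulr1 [a 0 i * _]mulrC mulrA sgn_coordK mul1r.
by rewrite !mxE (negPf ji) andbF !mulr0.
Qed.

Lemma sum_dual a : a = \sum_(i < n) (sgn_coord i * a 0 i) *: dual_vec i.
Proof.
rewrite {1}(row_sum_delta a); apply: eq_bigr => i _.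
by rewrite /dual_vec scalerA mulrAC sgn_coordK mul1r.
Qed.

Lemma pdot_nondegenerate a : (forall b, pdot s a b = 0) -> a = 0.
Proof. by move=> h; apply/rowP => i; rewrite -pdot_dual h mxE. Qed.

Implicit Types (X Y : 'rV[R]_2 -> 'rV[R]_n) (q v : 'rV[R]_2).

Lemma is_derive_pdot X Y q v (dX dY : 'rV[R]_n) :
  is_derive q v X dX -> is_derive q v Y dY ->
  is_derive q v (fun r => pdot s (X r) (Y r) : R^o)
    (pdot s dX (Y q) + pdot s (X q) dY).
Proof.
move=> hX hY.
have coord (Z : 'rV[R]_2 -> 'rV[R]_n) dZ j : is_derive q v Z dZ ->
    is_derive q v (fun r => Z r 0 j : R^o) (dZ 0 j).
  move=> [h1 h2]; apply: DeriveDef; first exact: ((derivable_rV _ _ _).1 h1 j).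
  by rewrite -h2 derive_mx // mxE.
pose h (i : 'I_n) (r : 'rV[R]_2) : R^o := sgn_coord i * (X r 0 i * Y r 0 i).
have dh i : is_derive q v (h i)
    (sgn_coord i * (dX 0 i * Y q 0 i + X q 0 i * dY 0 i)).
  apply: is_derive_eq (is_derive_mul (is_derive_cst (sgn_coord i : R^o) q v)
    (is_derive_mul (coord X dX i hX) (coord Y dY i hY))) _.
  by rewrite mul0r add0r.
have -> : (fun r => pdot s (X r) (Y r) : R^o) = \sum_(i < n) h i.
  by apply/funext => r; rewrite pdotE fct_sumE.
apply: is_derive_eq (is_derive_sum dh) _.
rewrite !pdotE -big_split; apply: eq_bigr => i _ /=; ring.
Qed.

Lemma Ck_on_pdot (k : nat) (U : set 'rV[R]_2) X Y : open U -> Ck_on k U X -> Ck_on k U Y ->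
  Ck_on k U (fun r => pdot s (X r) (Y r) : R^o).
Proof.
move=> oU sX sY.
pose h (i : 'I_n) (r : 'rV[R]_2) : R^o := sgn_coord i * (X r 0 i * Y r 0 i).
have sh i : Ck_on k U (h i).
  apply: (Ck_onZ _ oU); apply: (Ck_onM oU).
    exact: ((Ck_on_rV k X oU).1 sX i).
  exact: ((Ck_on_rV k Y oU).1 sY i).
have sum_smooth (r : seq 'I_n) : Ck_on k U (fun p => \sum_(i <- r) h i p : R^o).
  elim: r => [|i r ih].
    by apply: Ck_on_eq oU _ (Ck_on_cst k (0 : R^o) oU) => p _; rewrite big_nil.
  by apply: Ck_on_eq oU _ (Ck_onD oU (sh i) ih) => p _; rewrite big_cons.
by apply: Ck_on_eq oU _ (sum_smooth (index_enum 'I_n)) => p _; rewrite pdotE.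
Qed.

End Pdot.

Section Tri.
Context {R : realType} {n : nat} (s : nat).
Implicit Types (a b c p q r x y z : 'rV[R]_n) (k : R).

Definition det33 (a1 a2 a3 b1 b2 b3 c1 c2 c3 : R) : R :=
  a1 * (b2 * c3 - b3 * c2) - a2 * (b1 * c3 - b3 * c1) + a3 * (b1 * c2 - b2 * c1).

(** The determinant inner product of the 3-vectors [a /\ b /\ c] and
    [p /\ q /\ r]. *)
Definition tri a b c p q r : R :=
  det33 (pdot s a p) (pdot s a q) (pdot s a r)
        (pdot s b p) (pdot s b q) (pdot s b r)
        (pdot s c p) (pdot s c q) (pdot s c r).

Lemma tri_col1 k a b c d p q r :
  tri a b c (p + k *: d) q r = tri a b c p q r + k * tri a b c d q r.
Proof. by rewrite /tri /det33 !pdotrE; ring. Qed.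

Lemma tri_swap12 a b c p q r : tri a b c q p r = - tri a b c p q r.
Proof. by rewrite /tri /det33; ring. Qed.

Lemma tri_swap23 a b c p q r : tri a b c p r q = - tri a b c p q r.
Proof. by rewrite /tri /det33; ring. Qed.

Implicit Types (X Y Z : 'rV[R]_2 -> 'rV[R]_n) (o v : 'rV[R]_2).

Lemma is_derive_tri X Y Z o v dX dY dZ p q r :
  is_derive o v X dX -> is_derive o v Y dY -> is_derive o v Z dZ ->
  is_derive o v (fun t => tri (X t) (Y t) (Z t) p q r : R^o)
    (tri dX (Y o) (Z o) p q r + tri (X o) dY (Z o) p q r
     + tri (X o) (Y o) dZ p q r).
Proof.
move=> hX hY hZ.
have dp (W : 'rV[R]_2 -> 'rV[R]_n) dW (a : 'rV[R]_n) : is_derive o v W dW ->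
    is_derive o v (fun t => pdot s (W t) a : R^o) (pdot s dW a).
  move=> hW; apply: is_derive_eq (is_derive_pdot hW (is_derive_cst a o v)) _.
  by rewrite pdot0r addr0.
by rewrite /tri /det33; apply: is_derive_eq; rewrite /GRing.scale /=; ring.
Qed.

Lemma Ck_on_tri (k : nat) (U : set 'rV[R]_2) X Y Z p q r : open U ->
  Ck_on k U X -> Ck_on k U Y -> Ck_on k U Z ->
  Ck_on k U (fun t => tri (X t) (Y t) (Z t) p q r : R^o).
Proof.
move=> oU sX sY sZ; rewrite /tri /det33.
have sp W (a : 'rV[R]_n) : Ck_on k U W -> Ck_on k U (fun t => pdot s (W t) a : R^o).
  by move=> sW; exact: (Ck_on_pdot oU sW (Ck_on_cst k a oU)).
have M := @Ck_onM R k U; have B := @Ck_onB R k U.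
exact: (Ck_onD oU
  (B _ _ oU
    (M _ _ oU (sp X p sX) (B _ _ oU (M _ _ oU (sp Y q sY) (sp Z r sZ))
                                    (M _ _ oU (sp Y r sY) (sp Z q sZ))))
    (M _ _ oU (sp X q sX) (B _ _ oU (M _ _ oU (sp Y p sY) (sp Z r sZ))
                                    (M _ _ oU (sp Y r sY) (sp Z p sZ)))))
  (M _ _ oU (sp X r sX) (B _ _ oU (M _ _ oU (sp Y p sY) (sp Z q sZ))
                                  (M _ _ oU (sp Y q sY) (sp Z p sZ))))).
Qed.

End Tri.

Section NormalProjection.
Context {R : realType} {n : nat} (s : nat).
Implicit Types (x a b v w : 'rV[R]_n).

Definition gdet a b : R := pdot s a a * pdot s b b - pdot s a b * pdot s a b.

(** Christoffel-type coefficients: [tcoef a b v] and [tcoef b a v] are the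
    coordinates of the tangential part of [v] in the basis [a], [b]. *)
Definition tcoef a b v : R :=
  (pdot s b b * pdot s v a - pdot s a b * pdot s v b) / gdet a b.

(** The component of [v] orthogonal to the position vector [x] and to the
    tangent plane spanned by [a] and [b]. *)
Definition nproj x a b v : 'rV[R]_n :=
  v - (tcoef a b v *: a + tcoef b a v *: b) - pdot s v x *: x.

Lemma gdetC a b : gdet b a = gdet a b.
Proof. by rewrite /gdet (pdotC b a); ring. Qed.

Lemma nproj_decomp x a b v :
  v = tcoef a b v *: a + tcoef b a v *: b + pdot s v x *: x + nproj x a b v.
Proof.
rewrite /nproj; set A := tcoef a b v *: a + _; set B := pdot s v x *: x.
by apply/rowP => i; rewrite !mxE; ring.
Qed.

Record unit_frame x a b : Prop := UnitFrame {
  uf_unit : pdot s x x = 1;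
  uf_a : pdot s a x = 0;
  uf_b : pdot s b x = 0;
  uf_det : gdet a b != 0 }.

Variables (x a b : 'rV[R]_n).
Hypothesis uf : unit_frame x a b.

Lemma nproj_x v : pdot s (nproj x a b v) x = 0.
Proof. by case: uf => h1 h2 h3 _; rewrite /nproj !pdotlE h1 h2 h3; ring. Qed.

Lemma nproj_a v : pdot s (nproj x a b v) a = 0.
Proof.
case: uf => h1 h2 h3 h4; rewrite /nproj !pdotlE (pdotC x a) h2 /tcoef (gdetC a b).
rewrite (pdotC b a); move: h4; rewrite /gdet => h4; field; exact: h4.
Qed.

Lemma nproj_b v : pdot s (nproj x a b v) b = 0.
Proof.
case: uf => h1 h2 h3 h4; rewrite /nproj !pdotlE (pdotC x b) h3 /tcoef (gdetC a b).
rewrite (pdotC b a); move: h4; rewrite /gdet => h4; field; exact: h4.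
Qed.

Lemma nprojD v w : nproj x a b (v + w) = nproj x a b v + nproj x a b w.
Proof.
by apply/rowP => i; rewrite /nproj /tcoef !pdotlE !mxE; ring.
Qed.

Lemma nprojZ (k : R) v : nproj x a b (k *: v) = k *: nproj x a b v.
Proof.
by apply/rowP => i; rewrite /nproj /tcoef !pdotlE !mxE; ring.
Qed.

Lemma nproj_normal v : pdot s v x = 0 -> pdot s v a = 0 -> pdot s v b = 0 ->
  nproj x a b v = v.
Proof.
by move=> h1 h2 h3; rewrite /nproj /tcoef h1 h2 h3 !mulr0 !subrr !mul0r !scale0r !addr0 !subr0.
Qed.

Lemma nproj0x : nproj x a b x = 0.
Proof.
case: uf => h1 h2 h3 _; rewrite /nproj /tcoef !(pdotC x) h1 h2 h3.
by rewrite !mulr0 !subrr !mul0r !scale0r !addr0 subr0 scale1r subrr.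
Qed.

Lemma nproj0a : nproj x a b a = 0.
Proof.
case: uf => h1 h2 h3 h4; rewrite /nproj h2 scale0r subr0.
have -> : tcoef a b a = 1.
  by rewrite /tcoef; move: h4; rewrite /gdet => h4; field; exact: h4.
have -> : tcoef b a a = 0.
  by rewrite /tcoef (pdotC b a) [X in X / _](_ : _ = 0) ?mul0r //; ring.
by rewrite scale0r addr0 scale1r subrr.
Qed.

Lemma nproj0b : nproj x a b b = 0.
Proof.
case: uf => h1 h2 h3 h4; rewrite /nproj h3 scale0r subr0.
have -> : tcoef b a b = 1.
  by rewrite /tcoef (gdetC a b) (pdotC b a); move: h4; rewrite /gdet => h4; field; exact: h4.
have -> : tcoef a b b = 0.
  by rewrite /tcoef (pdotC b a) [X in X / _](_ : _ = 0) ?mul0r //; ring.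
by rewrite scale0r add0r scale1r subrr.
Qed.

Lemma pdot_nproj v w : pdot s v x = 0 -> pdot s v a = 0 -> pdot s v b = 0 ->
  pdot s v w = pdot s v (nproj x a b w).
Proof.
by move=> h1 h2 h3; rewrite /nproj !pdotrE h1 h2 h3; ring.
Qed.

(** Pairing with an arbitrary [w] only sees its normal part, and the whole
    space is nondegenerate. *)
Lemma normal_eq0 v : pdot s v x = 0 -> pdot s v a = 0 -> pdot s v b = 0 ->
  (forall w, pdot s w x = 0 -> pdot s w a = 0 -> pdot s w b = 0 ->
    pdot s v w = 0) -> v = 0.
Proof.
move=> h1 h2 h3 hv; apply: (@pdot_nondegenerate R n s) => w.
rewrite (pdot_nproj w h1 h2 h3); apply: hv.
- exact: nproj_x.
- exact: nproj_a.
- exact: nproj_b.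
Qed.

End NormalProjection.

(** * Spacelike surfaces in the pseudo-sphere *)

Section VectorCalculus.
Context {R : realType} {n : nat}.
Implicit Types (q : 'rV[R]_2) (U : set 'rV[R]_2) (X : 'rV[R]_2 -> 'rV[R]_n).

Lemma is_derive_scale (f : 'rV[R]_2 -> R^o) X q v df dX :
  is_derive q v f df -> is_derive q v X dX ->
  is_derive q v (fun r => f r *: X r) (df *: X q + f q *: dX).
Proof.
move=> hf hX.
have coord j : is_derive q v (fun r => (f r *: X r) 0 j : R^o)
    ((df *: X q + f q *: dX) 0 j).
  have hXj : is_derive q v (fun r => X r 0 j : R^o) (dX 0 j).
    case: hX => h1 h2; apply: DeriveDef; first exact: ((derivable_rV _ _ _).1 h1 j).
    by rewrite -h2 derive_mx // mxE.
  have -> : (fun r => (f r *: X r) 0 j : R^o) = (fun r => f r * X r 0 j : R^o).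
    by apply/funext => r; rewrite mxE.
  by apply: is_derive_eq (is_derive_mul hf hXj) _; rewrite !mxE.
have der : derivable (fun r => f r *: X r) q v.
  by apply/derivable_rV => j; case: (coord j).
apply: DeriveDef => //; rewrite derive_mx //; apply/rowP => j.
by rewrite mxE; case: (coord j).
Qed.

Lemma Ck_on_scale (k : nat) U (f : 'rV[R]_2 -> R^o) X : open U ->
  Ck_on k U f -> Ck_on k U X -> Ck_on k U (fun r => f r *: X r).
Proof.
move=> oU sf sX; apply/(Ck_on_rV k _ oU) => j.
apply: Ck_on_eq oU _ (Ck_onM oU sf ((Ck_on_rV k X oU).1 sX j)) => p _.
by rewrite mxE.
Qed.

Lemma Ck_on_oppv (k : nat) U X : open U -> Ck_on k U X ->
  Ck_on k U (fun r => - X r).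
Proof.
move=> oU sX; apply: Ck_on_eq oU _ (Ck_on_scale oU (Ck_on_cst k (-1 : R^o) oU) sX).
by move=> p _; rewrite scaleN1r.
Qed.

Lemma schwarz_rV U X q i j : open U -> U q -> Ck_on 2 U X ->
  pd i (pd j X) q = pd j (pd i X) q.
Proof.
move=> oU Uq sX; apply/rowP => c.
have s2 k : Ck_on 1 U (pd k X) by exact: Ck_on_pd sX.
have sc : Ck_on 2 U (fun r => X r 0 c : R^o) by exact: ((Ck_on_rV 2 X oU).1 sX c).
have E k l : pd k (pd l X) q 0 c = pd k (pd l (fun r => X r 0 c : R^o)) q.
  rewrite pd_coord; last exact: Ck_on_derivable Uq (s2 l).
  apply: pd_eq_on oU Uq _ => p Up; apply: pd_coord.
  exact: Ck_on_derivable Up sX.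
exact: etrans (E i j) (etrans (schwarz i j oU Uq sc) (esym (E j i))).
Qed.

End VectorCalculus.

(** The quotient rule for [x /\ a /\ b / |a /\ b|] when [a] and [b] move with
    velocities [v0] and [v1]: the derivative of the area removes the tangential
    parts of both velocities. *)
Lemma gauss_comp_algebra (R : realType) (n s : nat) (dx x a b v0 v1 p q r : 'rV[R]_n)
    (w : R) : w != 0 -> w * w = gdet s a b -> tri s dx a b p q r = 0 ->
  (tri s dx a b p q r + tri s x v0 b p q r + tri s x a v1 p q r) * w^-1
  + tri s x a b p q r * (- w^-1 * w^-1 * ((2 * w)^-1 *
     ((pdot s v0 a + pdot s a v0) * pdot s b b
      + pdot s a a * (pdot s v1 b + pdot s b v1)
      - ((pdot s v0 b + pdot s a v1) * pdot s a b
         + pdot s a b * (pdot s v0 b + pdot s a v1)))))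
  = (tri s x (nproj s x a b v0) b p q r + tri s x a (nproj s x a b v1) p q r) / w.
Proof.
move=> w0 wD ->; rewrite add0r.
have N0 : tri s x (nproj s x a b v0) b p q r
    = tri s x v0 b p q r - tcoef s a b v0 * tri s x a b p q r.
  by rewrite /nproj /tri /det33 !pdotlE; ring.
have N1 : tri s x a (nproj s x a b v1) p q r
    = tri s x a v1 p q r - tcoef s b a v1 * tri s x a b p q r.
  by rewrite /nproj /tri /det33 !pdotlE; ring.
rewrite N0 N1 /tcoef (gdetC s a) -wD (pdotC a v0) (pdotC b v1) (pdotC a v1) (pdotC b a).
by field.
Qed.

(** Both positivity conditions together say that the induced metric is positive
    definite. *)
Record is_patch (R : realType) (n s : nat) (U : set 'rV[R]_2)
    (X : 'rV[R]_2 -> 'rV[R]_n.+1) : Prop := Patch {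
  patch_open : open U;
  patch_smooth : smooth_on U X;
  patch_unit : forall q, U q -> pdot s (X q) (X q) = 1;
  patch_pos : forall q, U q -> 0 < pdot s (pd 0 X q) (pd 0 X q);
  patch_det : forall q, U q -> 0 < gdet s (pd 0 X q) (pd 1 X q) }.

Section Patch.
Context {R : realType} {n s : nat} {U : set 'rV[R]_2}
  {X : 'rV[R]_2 -> 'rV[R]_n.+1}.
Hypothesis pX : is_patch s U X.
Implicit Types (q : 'rV[R]_2) (i j k l : 'I_2) (a b c : 'rV[R]_n.+1).

Local Notation dot := (pdot s).
Local Notation oU := (patch_open pX).
Local Notation sX := (patch_smooth pX).
Local Notation XX i j := (pd i (pd j X)).

Lemma d1X i q : U q -> is_derive q (E2 i) X (pd i X q).
Proof. by move=> Uq; exact: is_derive_pd (Ck_on_derivable Uq (sX 1%N)). Qed.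

Lemma d2X i j q : U q -> is_derive q (E2 i) (pd j X) (XX i j q).
Proof.
by move=> Uq; exact: is_derive_pd (Ck_on_derivable Uq (Ck_on_pd j (sX 2%N))).
Qed.

Lemma d3X i j k q : U q ->
  is_derive q (E2 i) (XX j k) (pd i (XX j k) q).
Proof.
move=> Uq.
exact: is_derive_pd (Ck_on_derivable Uq (Ck_on_pd j (Ck_on_pd k (sX 3%N)))).
Qed.

Lemma XXC i j q : U q -> XX i j q = XX j i q.
Proof. by move=> Uq; exact: schwarz_rV oU Uq (sX 2%N). Qed.

Lemma pd_const_on (f : 'rV[R]_2 -> R^o) (c d : R) i q : U q ->
  (forall p, U p -> f p = c) -> is_derive q (E2 i) f d -> d = 0.
Proof.
move=> Uq fc df; rewrite -(pd_is_derive df).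
rewrite (pd_eq_on (g := fun=> c) i oU Uq fc).
exact: (pd_is_derive (is_derive_cst (c : R^o) q (E2 i))).
Qed.

Lemma pdot_XiX i q : U q -> dot (pd i X q) (X q) = 0.
Proof.
move=> Uq.
have := pd_const_on Uq (patch_unit pX) (is_derive_pdot (d1X i Uq) (d1X i Uq)).
by rewrite (pdotC (X q)) -mulr2n => /eqP; rewrite mulrn_eq0 /= => /eqP.
Qed.

Lemma pdot_XijX i j q : U q -> dot (XX i j q) (X q) = - dot (pd i X q) (pd j X q).
Proof.
move=> Uq.
have := pd_const_on Uq (fun p Up => pdot_XiX j Up)
  (is_derive_pdot (d2X i j Uq) (d1X i Uq)).
by rewrite [X in _ + X]pdotC => /eqP; rewrite addr_eq0 => /eqP.
Qed.

Lemma frame q : U q -> unit_frame s (X q) (pd 0 X q) (pd 1 X q).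
Proof.
move=> Uq; split.
- exact: (patch_unit pX).
- exact: pdot_XiX.
- exact: pdot_XiX.
- by rewrite gt_eqF // (patch_det pX).
Qed.

(** The second fundamental form in the pseudo-sphere, as the normal part of the
    second derivatives. *)
Definition sff i j q : 'rV[R]_n.+1 :=
  nproj s (X q) (pd 0 X q) (pd 1 X q) (XX i j q).

Lemma sffC i j q : U q -> sff i j q = sff j i q.
Proof. by move=> Uq; rewrite /sff XXC. Qed.

Lemma pdot_sff_X i j q : U q -> dot (sff i j q) (X q) = 0.
Proof. by move=> Uq; exact: nproj_x (frame Uq) _. Qed.

Lemma pdot_sff_Xk i j k q : U q -> dot (sff i j q) (pd k X q) = 0.
Proof.
move=> Uq; move: k; apply: forall_I2.
  exact: nproj_a (frame Uq) _.
exact: nproj_b (frame Uq) _.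
Qed.

Lemma pdot_sff_XX i j k l q : U q ->
  dot (sff i j q) (XX k l q) = dot (sff i j q) (sff k l q).
Proof.
by move=> Uq; apply: pdot_nproj; rewrite ?pdot_sff_X ?pdot_sff_Xk.
Qed.

(** Gauss formula; the coefficient of [X] comes from [<X, X> = 1]. *)
Lemma gauss_formula i j q : U q -> XX i j q =
  tcoef s (pd 0 X q) (pd 1 X q) (XX i j q) *: pd 0 X q
  + tcoef s (pd 1 X q) (pd 0 X q) (XX i j q) *: pd 1 X q
  - dot (pd i X q) (pd j X q) *: X q + sff i j q.
Proof.
move=> Uq; rewrite {1}(nproj_decomp s (X q) (pd 0 X q) (pd 1 X q) (XX i j q)).
by rewrite pdot_XijX // scaleNr.
Qed.

Lemma Ck_on_metric (k : nat) i j : Ck_on k U (fun r => dot (pd i X r) (pd j X r) : R^o).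
Proof.
exact: (Ck_on_pdot oU (Ck_on_pd i (sX k.+1)) (Ck_on_pd j (sX k.+1))).
Qed.

Lemma Ck_on_gdet (k : nat) : Ck_on k U (fun r => gdet s (pd 0 X r) (pd 1 X r) : R^o).
Proof.
exact: (Ck_onB oU (Ck_onM oU (Ck_on_metric k 0 0) (Ck_on_metric k 1 1))
                  (Ck_onM oU (Ck_on_metric k 0 1) (Ck_on_metric k 0 1))).
Qed.

Lemma gdet_neq0 q : U q -> gdet s (pd 0 X q) (pd 1 X q) != 0.
Proof. by move=> Uq; rewrite gt_eqF // (patch_det pX). Qed.

Lemma Ck_on_tcoef (k : nat) i j : Ck_on k U (fun r =>
  tcoef s (pd 0 X r) (pd 1 X r) (XX i j r) : R^o).
Proof.
have sij := Ck_on_pd i (Ck_on_pd j (sX k.+2)).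
have sg := Ck_onV oU gdet_neq0 (Ck_on_gdet k).
have g l : Ck_on k U (fun r => dot (XX i j r) (pd l X r) : R^o).
  exact: (Ck_on_pdot oU sij (Ck_on_pd l (sX k.+1))).
exact: (Ck_onM oU (Ck_onB oU (Ck_onM oU (Ck_on_metric k 1 1) (g 0))
  (Ck_onM oU (Ck_on_metric k 0 1) (g 1))) sg).
Qed.

Lemma Ck_on_tcoef' (k : nat) i j : Ck_on k U (fun r =>
  tcoef s (pd 1 X r) (pd 0 X r) (XX i j r) : R^o).
Proof.
have sij := Ck_on_pd i (Ck_on_pd j (sX k.+2)).
have sg := Ck_onV oU gdet_neq0 (Ck_on_gdet k).
have g l : Ck_on k U (fun r => dot (XX i j r) (pd l X r) : R^o).
  exact: (Ck_on_pdot oU sij (Ck_on_pd l (sX k.+1))).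
apply: Ck_on_eq oU _ (Ck_onM oU (Ck_onB oU (Ck_onM oU (Ck_on_metric k 0 0) (g 1))
  (Ck_onM oU (Ck_on_metric k 1 0) (g 0))) sg).
by move=> p Up; rewrite /tcoef gdetC.
Qed.

Lemma Ck_on_sff (k : nat) i j : Ck_on k U (sff i j).
Proof.
have sij := Ck_on_pd i (Ck_on_pd j (sX k.+2)).
have sXk := sX k.
have s1 l := Ck_on_pd l (sX k.+1).
have N (f : 'rV[R]_2 -> 'rV[R]_n.+1) : Ck_on k U f -> Ck_on k U (fun r => - f r).
  exact: Ck_on_oppv oU.
exact: (Ck_onD oU (Ck_onD oU sij
   (N _ (Ck_onD oU (Ck_on_scale oU (Ck_on_tcoef k i j) (s1 0))
                   (Ck_on_scale oU (Ck_on_tcoef' k i j) (s1 1)))))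
   (N _ (Ck_on_scale oU (Ck_on_pdot oU sij sXk) sXk))).
Qed.

Lemma dsff k i j q : U q -> is_derive q (E2 k) (sff i j) (pd k (sff i j) q).
Proof. by move=> Uq; exact: is_derive_pd (Ck_on_derivable Uq (Ck_on_sff 1 i j)). Qed.

Lemma pdot_dsff_X k i j q : U q -> dot (pd k (sff i j) q) (X q) = 0.
Proof.
move=> Uq.
have := pd_const_on Uq (fun p Up => pdot_sff_X i j Up)
  (is_derive_pdot (dsff k i j Uq) (d1X k Uq)).
by rewrite pdot_sff_Xk // addr0.
Qed.

(** Weingarten equation, from differentiating [<h_ij, X_l> = 0]. *)
Lemma pdot_dsff_Xl k i j l q : U q ->
  dot (pd k (sff i j) q) (pd l X q) = - dot (sff i j q) (sff k l q).
Proof.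
move=> Uq.
have := pd_const_on Uq (fun p Up => pdot_sff_Xk i j l Up)
  (is_derive_pdot (dsff k i j Uq) (d2X k l Uq)).
by rewrite pdot_sff_XX // => /eqP; rewrite addr_eq0 => /eqP.
Qed.

(** The component along [a /\ b /\ c] of the Gauss map
    [X /\ X_0 /\ X_1 / |X_0 /\ X_1|]. *)
Definition gauss_comp (a b c : 'rV[R]_n.+1) (q : 'rV[R]_2) : R^o :=
  tri s (X q) (pd 0 X q) (pd 1 X q) a b c
  / Num.sqrt (gdet s (pd 0 X q) (pd 1 X q)).

Lemma sqrt_gdet_neq0 q : U q -> Num.sqrt (gdet s (pd 0 X q) (pd 1 X q)) != 0.
Proof. by move=> Uq; rewrite sqrtr_eq0 -ltNge (patch_det pX). Qed.

Lemma Ck_on_invsqrt (k : nat) :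
  Ck_on k U (fun r => (Num.sqrt (gdet s (pd 0 X r) (pd 1 X r)))^-1 : R^o).
Proof.
exact: (Ck_onV oU sqrt_gdet_neq0 (Ck_on_sqrt oU (patch_det pX) (Ck_on_gdet k))).
Qed.

Lemma Ck_on_gauss_comp (k : nat) a b c : Ck_on k U (gauss_comp a b c).
Proof.
rewrite /gauss_comp.
exact: (Ck_onM oU (Ck_on_tri s a b c oU (sX k) (Ck_on_pd 0 (sX k.+1))
  (Ck_on_pd 1 (sX k.+1))) (Ck_on_invsqrt k)).
Qed.

(** The Gauss map varies only through the second fundamental form: the
    tangential part of [dX_i] is absorbed by the area factor. *)
Lemma pd_gauss_comp a b c j q : U q ->
  pd j (gauss_comp a b c) q =
  (tri s (X q) (sff j 0 q) (pd 1 X q) a b c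
   + tri s (X q) (pd 0 X q) (sff j 1 q) a b c)
  / Num.sqrt (gdet s (pd 0 X q) (pd 1 X q)).
Proof.
move=> Uq; set D := gdet s _ _; set w := Num.sqrt D.
have w0 : w != 0 by exact: sqrt_gdet_neq0.
have D0 : D != 0 by exact: gdet_neq0.
have wD : w * w = D by rewrite -expr2 sqr_sqrtr // ltW // (patch_det pX).
have dg k l : is_derive q (E2 j) (fun r => dot (pd k X r) (pd l X r) : R^o)
    (dot (XX j k q) (pd l X q) + dot (pd k X q) (XX j l q)).
  exact: is_derive_pdot (d2X j k Uq) (d2X j l Uq).
have dD := is_deriveB (is_derive_mul (dg 0 0) (dg 1 1))
                      (is_derive_mul (dg 0 1) (dg 0 1)).
have dw := is_derive_inv w0 (is_derive_sqrt (patch_det pX Uq) dD).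
have dPhi := is_derive_tri s a b c (d1X j Uq) (d2X j 0 Uq) (d2X j 1 Uq).
rewrite (pd_is_derive (is_derive_mul dPhi dw)).
rewrite -/D -/w.
have T1 (y z : 'rV[R]_n.+1) : tri s y y z a b c = 0 by rewrite /tri /det33; ring.
have T2 (y z : 'rV[R]_n.+1) : tri s y z y a b c = 0 by rewrite /tri /det33; ring.
have Tj : forall k, tri s (pd k X q) (pd 0 X q) (pd 1 X q) a b c = 0.
  by apply: forall_I2; [exact: T1 | exact: T2].
exact: (gauss_comp_algebra (X q) (XX j 0 q) (XX j 1 q) w0 wD (Tj j)).
Qed.

End Patch.

(** * The Laplacian in coordinates *)

Section Laplacian.
Context {R : realType}.
Implicit Types (q : 'rV[R]_2) (U : set 'rV[R]_2) (f : 'rV[R]_2 -> R^o)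
  (g : 'rV[R]_2 -> 'M[R]_2).

Lemma laplacian_eq_on U g g' f f' q : open U -> U q ->
  (forall p, U p -> g p = g' p) -> (forall p, U p -> f p = f' p) ->
  laplacian g f q = laplacian g' f' q.
Proof.
move=> oU Uq gg ff; rewrite /laplacian (gg q Uq).
apply: (congr1 (fun z => (Num.sqrt (\det (g' q)))^-1 * z)).
apply: eq_bigr => i _; apply: (pd_eq_on i oU Uq) => p Up.
rewrite (gg p Up); apply: (congr1 (fun z => Num.sqrt (\det (g' p)) * z)).
apply: eq_bigr => j _; apply: (congr1 (fun z => invmx (g' p) i j * z)).
exact: (pd_eq_on j oU Up ff).
Qed.

Definition smooth_metric U g := [/\ open U,
  forall k i j, Ck_on k U (fun r => g r i j : R^o) &
  forall q, U q -> 0 < \det (g q)].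

Section Fixed.
Variables (U : set 'rV[R]_2) (g : 'rV[R]_2 -> 'M[R]_2).
Hypothesis sg : smooth_metric U g.

(** The densitized inverse metric. *)
Definition flux_coef (i j : 'I_2) (r : 'rV[R]_2) : R^o :=
  Num.sqrt (\det (g r)) * invmx (g r) i j.

Lemma Ck_on_sqrt_det k : Ck_on k U (fun r => Num.sqrt (\det (g r)) : R^o).
Proof.
by have [oU sgc d0] := sg; exact: (Ck_on_sqrt oU d0 (Ck_on_det2 oU (sgc k))).
Qed.

Lemma Ck_on_flux_coef k i j : Ck_on k U (flux_coef i j).
Proof.
have [oU sgc d0] := sg; apply: (Ck_onM oU (Ck_on_sqrt_det k)).
by apply: (Ck_on_invmx oU _ (sgc k)) => q /d0 h; rewrite gt_eqF.
Qed.

Lemma laplacian_flux f q : laplacian g f q =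
  (Num.sqrt (\det (g q)))^-1 *
   (pd 0 (fun r => flux_coef 0 0 r * pd 0 f r + flux_coef 0 1 r * pd 1 f r : R^o) q
   + pd 1 (fun r => flux_coef 1 0 r * pd 0 f r + flux_coef 1 1 r * pd 1 f r : R^o) q).
Proof.
rewrite /laplacian sum_I2.
have E i : (fun r => Num.sqrt (\det (g r)) *
      \sum_(j < 2) invmx (g r) i j * pd (V := R^o) j f r : R^o)
    = (fun r => flux_coef i 0 r * pd 0 f r + flux_coef i 1 r * pd 1 f r : R^o).
  by apply/funext => r; rewrite sum_I2 mulrDr !mulrA.
by rewrite (E 0) (E 1).
Qed.

Lemma is_derive_flux k i f q : U q -> Ck_on 2 U f ->
  is_derive q (E2 k) (fun r => flux_coef i 0 r * pd 0 f r
                             + flux_coef i 1 r * pd 1 f r : R^o)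
   (pd k (flux_coef i 0) q * pd 0 f q + flux_coef i 0 q * pd k (pd 0 f) q
    + (pd k (flux_coef i 1) q * pd 1 f q + flux_coef i 1 q * pd k (pd 1 f) q)).
Proof.
move=> Uq sf; have D (h : 'rV[R]_2 -> R^o) : Ck_on 1 U h ->
    is_derive q (E2 k) h (pd k h q).
  by move=> sh; apply: is_derive_pd; exact: Ck_on_derivable Uq sh.
exact: (is_deriveD
  (is_derive_mul (D _ (Ck_on_flux_coef 1 i 0)) (D _ (Ck_on_pd 0 sf)))
  (is_derive_mul (D _ (Ck_on_flux_coef 1 i 1)) (D _ (Ck_on_pd 1 sf)))).
Qed.

(** The coefficients [b] of the first-order part are left unspecified: the
    expansion is used for linearity and at critical points of [f]. *)
Lemma laplacian_expand q : U q -> exists b : 'I_2 -> R, forall f, Ck_on 2 U f ->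
  laplacian g f q = \sum_i \sum_j invmx (g q) i j * pd i (pd j f) q
                    + \sum_j b j * pd j f q.
Proof.
move=> Uq; have [oU sgc d0] := sg; set W := Num.sqrt (\det (g q)).
exists (fun j => W^-1 * (pd 0 (flux_coef 0 j) q + pd 1 (flux_coef 1 j) q)) => f sf.
have W0 : W != 0 by rewrite sqrtr_eq0 -ltNge d0.
rewrite laplacian_flux (pd_is_derive (is_derive_flux 0 0 Uq sf)).
rewrite (pd_is_derive (is_derive_flux 1 1 Uq sf)) -/W sum_I22 sum_I2.
have E i j : flux_coef i j q = W * invmx (g q) i j by [].
rewrite !E.
move: (invmx (g q) 0 0) (invmx (g q) 0 1) (invmx (g q) 1 0) (invmx (g q) 1 1).
move: (pd 0 (pd 0 f) q) (pd 0 (pd 1 f) q) (pd 1 (pd 0 f) q) (pd 1 (pd 1 f) q).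
move: (pd 0 f q) (pd 1 f q) (pd 0 (flux_coef 0 0) q) (pd 0 (flux_coef 0 1) q)
  (pd 1 (flux_coef 1 0) q) (pd 1 (flux_coef 1 1) q).
move=> *; field; exact: W0.
Qed.

Lemma pd_lin f h (a : R) i q : U q -> Ck_on 1 U f -> Ck_on 1 U h ->
  pd i (fun r => a * f r + h r : R^o) q = a * pd i f q + pd i h q.
Proof.
move=> Uq sf sh; have [oU _ _] := sg.
have D (k : 'rV[R]_2 -> R^o) : Ck_on 1 U k -> is_derive q (E2 i) k (pd i k q).
  by move=> sk; apply: is_derive_pd; exact: Ck_on_derivable Uq sk.
apply: pd_is_derive; apply: is_derive_eq.
  exact: is_deriveD (is_derive_mul (is_derive_cst (a : R^o) q (E2 i)) (D _ sf)) (D _ sh).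
by rewrite mul0r add0r.
Qed.

Lemma laplacian_lin f h (a : R) q : U q -> Ck_on 2 U f -> Ck_on 2 U h ->
  laplacian g (fun r => a * f r + h r) q = a * laplacian g f q + laplacian g h q.
Proof.
move=> Uq sf sh; have [oU _ _] := sg; have [b E] := laplacian_expand Uq.
have s1 := Ck_onS sf; have s2 := Ck_onS sh.
have sfh : Ck_on 2 U (fun r => a * f r + h r : R^o).
  exact: (Ck_onD oU (Ck_onZ a oU sf) sh).
have P i j : pd i (pd j (fun r => a * f r + h r : R^o)) q
    = a * pd i (pd j f) q + pd i (pd j h) q.
  rewrite -(pd_lin a i Uq (Ck_on_pd j sf) (Ck_on_pd j sh)).
  by apply: (pd_eq_on i oU Uq) => p Up; exact: pd_lin.
rewrite (E _ sfh) (E _ sf) (E _ sh) mulrDr addrACA; congr (_ + _).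
  rewrite mulr_sumr -big_split; apply: eq_bigr => i _ /=.
  rewrite mulr_sumr -big_split; apply: eq_bigr => j _ /=.
  by rewrite P mulrDr mulrCA.
rewrite mulr_sumr -big_split; apply: eq_bigr => j _ /=.
by rewrite (pd_lin a j Uq s1 s2) mulrDr mulrCA.
Qed.

Lemma continuous_laplacian f q : U q -> Ck_on 2 U f ->
  {for q, continuous (laplacian g f : _ -> R^o)}.
Proof.
move=> Uq sf; have [oU _ d0] := sg.
have sW : Ck_on 0 U (fun r => (Num.sqrt (\det (g r)))^-1 : R^o).
  apply: (Ck_onV oU _ (Ck_on_sqrt_det 0)) => r Ur.
  by rewrite sqrtr_eq0 -ltNge d0.
have sfl i : Ck_on 1 U (fun r => flux_coef i 0 r * pd 0 f r
                              + flux_coef i 1 r * pd 1 f r : R^o).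
  exact: (Ck_onD oU (Ck_onM oU (Ck_on_flux_coef 1 i 0) (Ck_on_pd 0 sf))
                    (Ck_onM oU (Ck_on_flux_coef 1 i 1) (Ck_on_pd 1 sf))).
have sL := Ck_onM oU sW (Ck_onD oU (Ck_on_pd 0 (sfl 0)) (Ck_on_pd 1 (sfl 1))).
apply: (Ck_on_continuous Uq); apply: Ck_on_eq oU _ sL => p _.
by rewrite laplacian_flux.
Qed.

End Fixed.
End Laplacian.

(** * Pointwise consequences of harmonicity *)

Section PointwiseAlgebra.
Context {R : realType} {n s : nat}.
Implicit Types (x a b h xi eta : 'rV[R]_n).
Local Notation dot := (pdot s).

(** The derivative of [x /\ h0 /\ b + x /\ a /\ h1] when [x], [a], [b], [h0],
    [h1] move with velocities [dx], [da], [db], [d0], [d1]. *)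
Definition wedge_velocity x a b h0 h1 dx da db d0 d1 p q r : R :=
  (tri s dx h0 b p q r + tri s x d0 b p q r + tri s x h0 db p q r)
  + (tri s dx a h1 p q r + tri s x da h1 p q r + tri s x a d1 p q r).

(** The mean curvature, times twice the determinant of the metric, of a form
    with values [A], [B], [C] on the coordinate frame. *)
Definition mean_curv (E F G : R) (A B C : R) := G * A - F * B - F * B + E * C.

Section WithFrame.
Variables (x a b : 'rV[R]_n).
Hypothesis uf : unit_frame s x a b.

Definition is_normal (v : 'rV[R]_n) := [/\ dot v x = 0, dot v a = 0 & dot v b = 0].

Lemma tri_tangent_normal h0 h1 xi : is_normal xi ->
  tri s x h0 b a b xi + tri s x a h1 a b xi = 0.
Proof.
case: uf => u1 u2 u3 _ [n1 n2 n3].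
by rewrite /tri /det33 (pdotC x a) (pdotC x b) (pdotC x xi) u2 u3 n1; ring.
Qed.

Lemma wedge_velocity_a h0 h1 da db d0 d1 xi :
  is_normal h0 -> is_normal h1 -> is_normal xi ->
  wedge_velocity x a b h0 h1 a da db d0 d1 a b xi = - gdet s a b * dot h0 xi.
Proof.
case: uf => u1 u2 u3 _ [n1 n2 n3] [m1 m2 m3] [k1 k2 k3].
rewrite /wedge_velocity /gdet /tri /det33 (pdotC x a) (pdotC x b) (pdotC x xi).
rewrite u2 u3 k1 (pdotC a xi) (pdotC b xi) k2 k3 n2 n3 m2 m3 (pdotC b a); ring.
Qed.

Lemma wedge_velocity_b h0 h1 da db d0 d1 xi :
  is_normal h0 -> is_normal h1 -> is_normal xi ->
  wedge_velocity x a b h0 h1 b da db d0 d1 a b xi = - gdet s a b * dot h1 xi.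
Proof.
case: uf => u1 u2 u3 _ [n1 n2 n3] [m1 m2 m3] [k1 k2 k3].
rewrite /wedge_velocity /gdet /tri /det33 (pdotC x a) (pdotC x b) (pdotC x xi).
rewrite u2 u3 k1 (pdotC a xi) (pdotC b xi) k2 k3 n2 n3 m2 m3 (pdotC b a); ring.
Qed.

Lemma tri_normal_normal h0 h1 xi eta : is_normal xi -> is_normal eta ->
  tri s x h0 b x xi eta + tri s x a h1 x xi eta = 0.
Proof.
case: uf => u1 u2 u3 _ [n1 n2 n3] [m1 m2 m3].
rewrite /tri /det33 u2 u3 (pdotC a xi) (pdotC b xi) (pdotC a eta) (pdotC b eta).
by rewrite n2 n3 m2 m3 (pdotC x xi) (pdotC x eta) n1 m1; ring.
Qed.

Lemma wedge_velocity_normal h0 h1 dx da db d0 d1 xi eta :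
  is_normal xi -> is_normal eta -> dx = a \/ dx = b ->
  wedge_velocity x a b h0 h1 dx da db d0 d1 x xi eta
   = dot h0 xi * dot db eta - dot h0 eta * dot db xi
     + (dot da xi * dot h1 eta - dot da eta * dot h1 xi).
Proof.
case: uf => u1 u2 u3 _ [n1 n2 n3] [m1 m2 m3] [->|->];
rewrite /wedge_velocity /tri /det33 u1 u2 u3 (pdotC a xi) (pdotC b xi)
  (pdotC a eta) (pdotC b eta) n2 n3 m2 m3 (pdotC x xi) (pdotC x eta) n1 m1; ring.
Qed.

Lemma tri_normal_frame h0 h1 : is_normal h0 -> is_normal h1 ->
  tri s x h0 b x a b + tri s x a h1 x a b = 0.
Proof.
case: uf => u1 u2 u3 _ [n1 n2 n3] [m1 m2 m3].
by rewrite /tri /det33 n1 n2 n3 m1 m2 m3; ring.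
Qed.

Lemma wedge_velocity_frame h0 h1 dx da db d0 d1 :
  is_normal h0 -> is_normal h1 -> dot d0 x = 0 -> dot d1 x = 0 ->
  wedge_velocity x a b h0 h1 dx da db d0 d1 x a b
   = dot b b * dot d0 a - dot a b * (dot d0 b + dot d1 a) + dot a a * dot d1 b.
Proof.
case: uf => u1 u2 u3 _ [n1 n2 n3] [m1 m2 m3] k0 k1.
rewrite /wedge_velocity /tri /det33 n1 n2 n3 m1 m2 m3 u1 u2 u3 k0 k1.
by rewrite (pdotC x a) (pdotC x b) u2 u3 (pdotC b a); ring.
Qed.

End WithFrame.

(** The trace conditions turn the three wedge products into multiples of one of
    them, and the remaining equation has determinant [2 (E G - F^2)]. *)
Lemma tracefree_wedge (E F G x0 x1 x2 y0 y1 y2 : R) :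
  0 < E -> 0 < E * G - F * F ->
  mean_curv E F G x0 x1 x2 = 0 -> mean_curv E F G y0 y1 y2 = 0 ->
  G * (x0 * y1 - y0 * x1) - F * (x0 * y2 - y0 * x2) + E * (x1 * y2 - y1 * x2) = 0 ->
  [/\ x0 * y1 = y0 * x1, x0 * y2 = y0 * x2 & x1 * y2 = y1 * x2].
Proof.
rewrite /mean_curv => E0 D0 tx ty H.
set A := x0 * y1 - y0 * x1; set B := x0 * y2 - y0 * x2; set C := x1 * y2 - y1 * x2.
have e1 : G * A = E * C.
  have : G * A - E * C = (G * x0 - F * x1 - F * x1 + E * x2) * y1
    - (G * y0 - F * y1 - F * y1 + E * y2) * x1 by rewrite /A /C; ring.
  by rewrite tx ty !mul0r subrr => /eqP; rewrite subr_eq0 => /eqP.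
have e2 : 2 * F * A = E * B.
  have : E * B - 2 * F * A = (G * y0 - F * y1 - F * y1 + E * y2) * x0
    - (G * x0 - F * x1 - F * x1 + E * x2) * y0 by rewrite /A /B; ring.
  by rewrite tx ty !mul0r subrr => /eqP; rewrite subr_eq0 => /eqP.
have H' : G * A - F * B + E * C = 0 by exact: H.
have A0 : A = 0.
  have : 2 * (E * G - F * F) * A = 0.
    have -> : 2 * (E * G - F * F) * A = E * (G * A - F * B + E * C)
      - F * (2 * F * A - E * B) + E * (G * A - E * C) by ring.
    by rewrite H' e1 e2 !subrr !mulr0 subrr addr0.
  by move/eqP; rewrite !mulf_eq0 pnatr_eq0 (gt_eqF D0) /= => /eqP.
have C0 : C = 0.
  by move: e1; rewrite A0 mulr0 => /esym/eqP; rewrite mulf_eq0 (gt_eqF E0) => /eqP.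
have B0 : B = 0.
  by move: e2; rewrite A0 mulr0 => /esym/eqP; rewrite mulf_eq0 (gt_eqF E0) => /eqP.
by split; apply/eqP; rewrite -subr_eq0; apply/eqP.
Qed.

(** Under the trace condition, [E^2] times the right-hand side is a sum of
    squares. *)
Lemma tracefree_det (E F G w0 w1 w2 : R) : 0 < E -> 0 < E * G - F * F ->
  mean_curv E F G w0 w1 w2 = 0 -> w0 != 0 \/ w1 != 0 \/ w2 != 0 ->
  0 < w1 * w1 - w0 * w2.
Proof.
rewrite /mean_curv => E0 D0 t nz.
have key : E * E * (w1 * w1 - w0 * w2)
    = (E * w1 - F * w0) ^+ 2 + (E * G - F * F) * w0 ^+ 2.
  have -> : E * E * (w1 * w1 - w0 * w2) = E * E * w1 * w1
     - E * w0 * (G * w0 - F * w1 - F * w1 + E * w2)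
     + E * w0 * (G * w0 - 2 * F * w1) by ring.
  by rewrite t mulr0 subr0; ring.
have pos : 0 < (E * w1 - F * w0) ^+ 2 + (E * G - F * F) * w0 ^+ 2.
  have [w00|w00] := eqVneq w0 0; last first.
    by rewrite ltr_wpDl ?sqr_ge0 // mulr_gt0 // exprn_even_gt0.
  have [w10|w10] := eqVneq w1 0; last first.
    by rewrite w00 !mulr0 subr0 expr0n /= mulr0 addr0 exprn_even_gt0 //= mulf_neq0 // gt_eqF.
  move: t; rewrite w00 w10 !mulr0 !subr0 add0r => /eqP.
  rewrite mulf_eq0 (gt_eqF E0) /= => /eqP w20.
  by case: nz => [|[]]; rewrite ?w00 ?w10 ?w20 eqxx.
by move: pos; rewrite -key pmulr_rgt0 // mulr_gt0.
Qed.

End PointwiseAlgebra.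

Section HarmonicAlgebra.
Context {R : realType} {n s : nat}.
Local Notation dot := (pdot s).
(* [x], [a], [b] stand for [X], [X_0], [X_1] at a point, [vij] for [X_ij], [h0], [h1],
   [h2] for the normal parts of [X_00], [X_01], [X_11], and [dkij] for the derivative
   in direction [k] of the normal part of [X_ij]. *)
Variables (x a b v00 v01 v10 v11 h0 h1 h2 : 'rV[R]_n).
Variables (d000 d001 d010 d011 d100 d101 d110 d111 : 'rV[R]_n).
Hypothesis uf : unit_frame s x a b.
Hypothesis pos_a : 0 < dot a a.
Hypothesis pos_det : 0 < gdet s a b.
Local Notation normal := (is_normal (s := s) x a b).
Local Notation E := (dot a a).
Local Notation F := (dot a b).
Local Notation G := (dot b b).
Hypotheses (nh0 : normal h0) (nh1 : normal h1) (nh2 : normal h2).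
Hypotheses (v00E : forall z, normal z -> dot v00 z = dot h0 z)
  (v01E : forall z, normal z -> dot v01 z = dot h1 z)
  (v10E : forall z, normal z -> dot v10 z = dot h1 z)
  (v11E : forall z, normal z -> dot v11 z = dot h2 z).
Hypotheses (d000x : dot d000 x = 0) (d001x : dot d001 x = 0)
  (d010x : dot d010 x = 0) (d011x : dot d011 x = 0)
  (d100x : dot d100 x = 0) (d101x : dot d101 x = 0)
  (d110x : dot d110 x = 0) (d111x : dot d111 x = 0).
Hypotheses (d000a : dot d000 a = - dot h0 h0) (d000b : dot d000 b = - dot h0 h1)
  (d001a : dot d001 a = - dot h1 h0) (d001b : dot d001 b = - dot h1 h1)
  (d010a : dot d010 a = - dot h1 h0) (d010b : dot d010 b = - dot h1 h1)
  (d011a : dot d011 a = - dot h2 h0) (d011b : dot d011 b = - dot h2 h1)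
  (d100a : dot d100 a = - dot h0 h1) (d100b : dot d100 b = - dot h0 h2)
  (d101a : dot d101 a = - dot h1 h1) (d101b : dot d101 b = - dot h1 h2)
  (d110a : dot d110 a = - dot h1 h1) (d110b : dot d110 b = - dot h1 h2)
  (d111a : dot d111 a = - dot h2 h1) (d111b : dot d111 b = - dot h2 h2).
Local Notation wv := (wedge_velocity (s := s) x a b).
Hypothesis lap0 : forall p q r,
  tri s x h0 b p q r + tri s x a h1 p q r = 0 ->
  tri s x h1 b p q r + tri s x a h2 p q r = 0 ->
  G * wv h0 h1 a v00 v01 d000 d001 p q r
  - F * (wv h1 h2 a v00 v01 d010 d011 p q r + wv h0 h1 b v10 v11 d100 d101 p q r)
  + E * wv h1 h2 b v10 v11 d110 d111 p q r = 0.

Let normal_nproj z : normal (nproj s x a b z).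
Proof. by split; [exact: nproj_x|exact: nproj_a|exact: nproj_b]. Qed.

(** Along [a /\ b /\ z] with [z] normal, only the terms in which [x] itself
    moves contribute. *)
Lemma mean_curvature_zero xi :
  mean_curv E F G (dot h0 xi) (dot h1 xi) (dot h2 xi) = 0.
Proof.
have key z : normal z -> mean_curv E F G (dot h0 z) (dot h1 z) (dot h2 z) = 0.
  move=> nz; have := lap0 (tri_tangent_normal uf h0 h1 nz) (tri_tangent_normal uf h1 h2 nz).
  rewrite !(wedge_velocity_a uf) // !(wedge_velocity_b uf) // => H.
  have : - gdet s a b * mean_curv E F G (dot h0 z) (dot h1 z) (dot h2 z) = 0.
    by rewrite -H /mean_curv; ring.
  by move/eqP; rewrite mulf_eq0 oppr_eq0 (gt_eqF pos_det) /= => /eqP.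
case: nh0 => *; case: nh1 => *; case: nh2 => *.
rewrite (pdot_nproj (x := x) (a := a) (b := b) (v := h0)) //.
rewrite (pdot_nproj (x := x) (a := a) (b := b) (v := h1)) //.
rewrite (pdot_nproj (x := x) (a := a) (b := b) (v := h2)) //.
exact: key.
Qed.

Let pos_det' : 0 < E * G - F * F := pos_det.

(** Along [x /\ y /\ z] with normal [y] and [z], only the terms in which both
    [a] and [b] are replaced by normal vectors contribute; they are the wedge
    products of the values of the second fundamental form. *)
Lemma sff_wedge xi eta :
  [/\ dot h0 xi * dot h1 eta = dot h0 eta * dot h1 xi,
      dot h0 xi * dot h2 eta = dot h0 eta * dot h2 xi
    & dot h1 xi * dot h2 eta = dot h1 eta * dot h2 xi].
Proof.
have key y z : normal y -> normal z ->
  [/\ dot h0 y * dot h1 z = dot h0 z * dot h1 y,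
      dot h0 y * dot h2 z = dot h0 z * dot h2 y
    & dot h1 y * dot h2 z = dot h1 z * dot h2 y].
  move=> ny nz.
  have := lap0 (tri_normal_normal uf h0 h1 ny nz) (tri_normal_normal uf h1 h2 ny nz).
  have la : a = a \/ a = b by left.
  have rb : b = a \/ b = b by right.
  rewrite !(wedge_velocity_normal uf) // !v00E // !v01E // !v10E // !v11E // => H.
  apply: (tracefree_wedge pos_a pos_det'); try exact: mean_curvature_zero.
  move: H; move: (dot h0 y) (dot h1 y) (dot h2 y) (dot h0 z) (dot h1 z) (dot h2 z).
  move=> x0 x1 x2 y0 y1 y2 H.
  have two0 : (2 : R) != 0 by rewrite pnatr_eq0.
  by apply: (mulfI two0); rewrite mulr0 -[RHS]H; ring.
have P h z : normal h -> dot h z = dot h (nproj s x a b z).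
  by move=> [? ? ?]; exact: pdot_nproj.
rewrite (P h0 xi) // (P h0 eta) // (P h1 xi) // (P h1 eta) // (P h2 xi) // (P h2 eta) //.
exact: key.
Qed.

Lemma sff_prop_coord (j k : 'I_n) :
  [/\ h0 0 j * h1 0 k = h0 0 k * h1 0 j, h0 0 j * h2 0 k = h0 0 k * h2 0 j
    & h1 0 j * h2 0 k = h1 0 k * h2 0 j].
Proof. by have := sff_wedge (dual_vec (s := s) j) (dual_vec (s := s) k); rewrite !pdot_dual. Qed.

(** Along [x /\ a /\ b] the derivatives of the second fundamental form enter
    through the Weingarten equation.  For values [w N] the result is the squared
    norm of [w] times [<N, N>], and the first factor is positive because the
    metric is definite. *)
Lemma sff_null : [/\ dot h0 h0 = 0, dot h1 h1 = 0 & dot h2 h2 = 0].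
Proof.
have base : G * (G * dot h0 h0 - F * (dot h0 h1 + dot h1 h0) + E * dot h1 h1)
  - 2 * F * (G * dot h1 h0 - F * (dot h1 h1 + dot h2 h0) + E * dot h2 h1)
  + E * (G * dot h1 h1 - F * (dot h1 h2 + dot h2 h1) + E * dot h2 h2) = 0.
  have := lap0 (tri_normal_frame uf nh0 nh1) (tri_normal_frame uf nh1 nh2).
  rewrite !(wedge_velocity_frame uf) // d000a d000b d001a d001b d010a d010b d011a d011b
    d100a d100b d101a d101b d110a d110b d111a d111b => H.
  rewrite (pdotC h0 h1) (pdotC h0 h2) (pdotC h1 h2) in H *.
  by apply/eqP; rewrite -oppr_eq0; apply/eqP; rewrite -[RHS]H; ring.
have rank1 (N : 'rV[R]_n) w0 w1 w2 : h0 = w0 *: N -> h1 = w1 *: N -> h2 = w2 *: N ->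
    w0 != 0 \/ w1 != 0 \/ w2 != 0 -> (exists j, N 0 j != 0) -> dot N N = 0.
  move=> e0 e1 e2 nz [j Nj].
  have t : mean_curv E F G w0 w1 w2 = 0.
    have := mean_curvature_zero (dual_vec (s := s) j).
    rewrite e0 e1 e2 !pdotZl !pdot_dual => H.
    have : mean_curv E F G w0 w1 w2 * N 0 j = 0 by rewrite -H /mean_curv; ring.
    by move/eqP; rewrite mulf_eq0 (negPf Nj) orbF => /eqP.
  have dw := tracefree_det pos_a pos_det' t nz.
  move: base; rewrite e0 e1 e2 !pdotZl !pdotZr.
  move: dw t; rewrite /mean_curv; move: pos_det'; set e := E; set f := F; set g := G.
  move=> D0 dw t H.
  have : 2 * (e * g - f * f) * (w1 * w1 - w0 * w2) * dot N N = 0.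
    transitivity (((g * w0 - f * w1 - f * w1 + e * w2) ^+ 2
       + 2 * (e * g - f * f) * (w1 * w1 - w0 * w2)) * dot N N).
      by rewrite t expr0n /= add0r.
    by rewrite -[RHS]H; ring.
  move/eqP; rewrite !mulf_eq0 pnatr_eq0 (gt_eqF D0) (gt_eqF dw) /= => /eqP.
  by [].
have scale (u v : 'rV[R]_n) j : (forall k, u 0 j * v 0 k = u 0 k * v 0 j) ->
    u 0 j != 0 -> v = (v 0 j / u 0 j) *: u.
  move=> H uj; apply/rowP => k; rewrite mxE; apply: (mulfI uj).
  by rewrite H; field.
have C j k := sff_prop_coord j k.
have dec (u : 'rV[R]_n) : u = 0 \/ exists j, u 0 j != 0.
  have [/existsP[j Hj]|] := boolP [exists j, u 0 j != 0]; first by right; exists j.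
  rewrite negb_exists => /forallP H; left; apply/rowP => j; rewrite mxE.
  by apply/eqP; have := H j; rewrite negbK.
have N0 : forall j, h0 0 j != 0 -> dot h0 h0 = 0.
  move=> j Hj; apply: (rank1 h0 1 (h1 0 j / h0 0 j) (h2 0 j / h0 0 j)).
  - by rewrite scale1r.
  - by apply: scale => // k; have [] := C j k.
  - by apply: scale => // k; have [] := C j k.
  - by left.
  - by exists j.
have N1 : forall j, h1 0 j != 0 -> dot h1 h1 = 0.
  move=> j Hj; apply: (rank1 h1 (h0 0 j / h1 0 j) 1 (h2 0 j / h1 0 j)).
  - apply: scale => // k; have [H _ _] := C k j.
    by rewrite mulrC H mulrC.
  - by rewrite scale1r.
  - by apply: scale => // k; have [] := C j k.
  - by right; left.
  - by exists j.
have N2 : forall j, h2 0 j != 0 -> dot h2 h2 = 0.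
  move=> j Hj; apply: (rank1 h2 (h0 0 j / h2 0 j) (h1 0 j / h2 0 j) 1).
  - apply: scale => // k; have [_ H _] := C k j.
    by rewrite mulrC H mulrC.
  - apply: scale => // k; have [_ _ H] := C k j.
    by rewrite mulrC H mulrC.
  - by rewrite scale1r.
  - by right; right.
  - by exists j.
split.
- by have [->|[j /N0]] := dec h0; rewrite ?pdot0l.
- by have [->|[j /N1]] := dec h1; rewrite ?pdot0l.
- by have [->|[j /N2]] := dec h2; rewrite ?pdot0l.
Qed.

End HarmonicAlgebra.

Lemma inverse_contraction (R : realType) (g : 'M[R]_2) (K : 'I_2 -> 'I_2 -> R)
    (w : R) : \det g != 0 -> w != 0 -> g 1 0 = g 0 1 ->
  \sum_i \sum_j invmx g i j * (K i j / w) = 0 ->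
  g 1 1 * K 0 0 - g 0 1 * (K 0 1 + K 1 0) + g 0 0 * K 1 1 = 0.
Proof.
move=> d0 w0 g10; rewrite sum_I22; have [-> -> -> ->] := invmx2 d0.
rewrite g10; set D := \det _ in d0 *.
move: (g 0 0) (g 0 1) (g 1 1) (K 0 0) (K 0 1) (K 1 0) (K 1 1).
move=> g0 g1 g2 s0 s1 s2 s3 H.
have -> : g2 * s0 - g1 * (s1 + s2) + g0 * s3 = D * w *
   (D^-1 * g2 * (s0 / w) + - (D^-1 * g1) * (s1 / w)
    + (- (D^-1 * g1) * (s2 / w) + D^-1 * g0 * (s3 / w))).
  by field; rewrite d0 w0.
by rewrite H mulr0.
Qed.

Section HarmonicPoint.
Context {R : realType} {n s : nat} {U : set 'rV[R]_2}
  {X : 'rV[R]_2 -> 'rV[R]_n.+1}.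
Hypothesis pX : is_patch s U X.
Variable g : 'rV[R]_2 -> 'M[R]_2.
Hypothesis gE : forall q, U q -> forall i j,
  g q i j = pdot s (pd i X q) (pd j X q).
Implicit Types (q : 'rV[R]_2) (i j k l : 'I_2) (a b c xi eta : 'rV[R]_n.+1).
Local Notation dot := (pdot s).
Local Notation oU := (patch_open pX).
Local Notation XX i j := (pd i (pd j X)).
Local Notation h := (@sff R n s X).
Local Notation normal q := (is_normal (s := s) (X q) (pd 0 X q) (pd 1 X q)).

Lemma det_metric q : U q -> \det (g q) = gdet s (pd 0 X q) (pd 1 X q).
Proof.
move=> Uq; rewrite det2 (gE Uq 0 0) (gE Uq 0 1) (gE Uq 1 0) (gE Uq 1 1).
have A u v : dot u u * dot v v - dot u v * dot v u = gdet s u v.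
  by rewrite /gdet (pdotC v).
exact: A.
Qed.

Lemma smooth_metric_patch : smooth_metric U g.
Proof.
split; first exact: oU.
- move=> k i j; apply: Ck_on_eq oU _ (Ck_on_metric pX k i j) => p Up.
  by rewrite gE.
- by move=> q Uq; rewrite det_metric // (patch_det pX).
Qed.

Lemma normal_sff i j q : U q -> normal q (h i j q).
Proof.
by move=> Uq; split; [exact: (pdot_sff_X pX i j Uq)
  |exact: (pdot_sff_Xk pX i j 0 Uq)|exact: (pdot_sff_Xk pX i j 1 Uq)].
Qed.

Definition wedge_vel i j q a b c : R :=
  wedge_velocity (s := s) (X q) (pd 0 X q) (pd 1 X q) (h j 0 q) (h j 1 q)
    (pd i X q) (XX i 0 q) (XX i 1 q) (pd i (h j 0) q) (pd i (h j 1) q) a b c.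

(** The derivative of the area multiplies the first derivative of the Gauss
    map, which vanishes at [q] by assumption. *)
Lemma pd2_gauss_comp i j a b c q : U q ->
  tri s (X q) (h j 0 q) (pd 1 X q) a b c
    + tri s (X q) (pd 0 X q) (h j 1 q) a b c = 0 ->
  pd i (pd j (gauss_comp (s := s) (X := X) a b c)) q
    = wedge_vel i j q a b c / Num.sqrt (gdet s (pd 0 X q) (pd 1 X q)).
Proof.
move=> Uq T0.
rewrite (pd_eq_on i oU Uq (fun p Up => pd_gauss_comp pX a b c j Up)).
have dw := is_derive_pd (Ck_on_derivable (i := i) Uq (Ck_on_invsqrt pX 1)).
have dT := is_deriveD
  (is_derive_tri s a b c (d1X pX i Uq) (dsff pX i j 0 Uq) (d2X pX i 1 Uq))
  (is_derive_tri s a b c (d1X pX i Uq) (d2X pX i 0 Uq) (dsff pX i j 1 Uq)).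
apply: etrans (pd_is_derive (is_derive_mul dT dw)) _.
by rewrite /= [X in _ + X * _]T0 mul0r addr0.
Qed.

(** At a critical point of the component, the Laplacian reduces to the
    contraction of the second derivatives with the inverse metric. *)
Lemma laplacian_gauss_comp a b c q : U q ->
  (forall j, tri s (X q) (h j 0 q) (pd 1 X q) a b c
    + tri s (X q) (pd 0 X q) (h j 1 q) a b c = 0) ->
  laplacian g (gauss_comp (s := s) (X := X) a b c) q = 0 ->
  g q 1 1 * wedge_vel 0 0 q a b c
  - g q 0 1 * (wedge_vel 0 1 q a b c + wedge_vel 1 0 q a b c)
  + g q 0 0 * wedge_vel 1 1 q a b c = 0.
Proof.
move=> Uq T0; have [v E] := laplacian_expand smooth_metric_patch Uq.
have d0 : \det (g q) != 0 by rewrite det_metric //; exact: (gdet_neq0 pX Uq).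
have w0 := sqrt_gdet_neq0 pX Uq.
rewrite (E _ (Ck_on_gauss_comp pX 2 a b c)).
have P1 j : v j * pd j (gauss_comp (s := s) (X := X) a b c) q = 0.
  by rewrite (pd_gauss_comp pX a b c j Uq) T0 mul0r mulr0.
rewrite [X in _ + X]big1 ?addr0; last by move=> j _; exact: P1.
have g10 : g q 1 0 = g q 0 1 by rewrite (gE Uq 1 0) (gE Uq 0 1); exact: pdotC.
move=> H.
apply: (@inverse_contraction R (g q) (fun i j => wedge_vel i j q a b c) _ d0 w0 g10).
apply: etrans H; apply: eq_bigr => i _; apply: eq_bigr => j _.
exact: (congr1 (fun z => invmx (g q) i j * z) (esym (pd2_gauss_comp i Uq (T0 j)))).
Qed.

(** The pointwise content of harmonicity: the second fundamental form is trace
    free, its values are proportional, and they are null vectors. *)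
Definition null_point q :=
  [/\ forall xi, mean_curv (dot (pd 0 X q) (pd 0 X q)) (dot (pd 0 X q) (pd 1 X q))
        (dot (pd 1 X q) (pd 1 X q)) (dot (h 0 0 q) xi) (dot (h 0 1 q) xi)
        (dot (h 1 1 q) xi) = 0,
      forall j k : 'I_n.+1,
        [/\ h 0 0 q 0 j * h 0 1 q 0 k = h 0 0 q 0 k * h 0 1 q 0 j,
            h 0 0 q 0 j * h 1 1 q 0 k = h 0 0 q 0 k * h 1 1 q 0 j
          & h 0 1 q 0 j * h 1 1 q 0 k = h 0 1 q 0 k * h 1 1 q 0 j]
    & [/\ dot (h 0 0 q) (h 0 0 q) = 0, dot (h 0 1 q) (h 0 1 q) = 0
        & dot (h 1 1 q) (h 1 1 q) = 0]].

(** The Laplacian is evaluated along constant 3-vectors, chosen as wedge products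
    of vectors of the frame and of normal vectors at the point [q]. *)
Lemma harmonic_point q : U q ->
  (forall a b c, laplacian g (gauss_comp (s := s) (X := X) a b c) q = 0) ->
  null_point q.
Proof.
move=> Uq lap0.
have uf := frame pX Uq.
have e10 : h 1 0 q = h 0 1 q by exact: (sffC pX 1 0 Uq).
have pN z v : normal q z ->
    dot v z = dot (nproj s (X q) (pd 0 X q) (pd 1 X q) v) z.
  move=> [z1 z2 z3]; apply: etrans (pdotC v z) _.
  apply: etrans (pdot_nproj v z1 z2 z3) _; exact: pdotC.
have v00 z : normal q z -> dot (XX 0 0 q) z = dot (h 0 0 q) z by exact: pN.
have v01 z : normal q z -> dot (XX 0 1 q) z = dot (h 0 1 q) z by exact: pN.
have v11 z : normal q z -> dot (XX 1 1 q) z = dot (h 1 1 q) z by exact: pN.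
have v10 z : normal q z -> dot (XX 1 0 q) z = dot (h 0 1 q) z.
  by move=> nz; rewrite -e10; exact: pN.
have dx k i j : dot (pd k (h i j) q) (X q) = 0 by exact: (pdot_dsff_X pX k i j Uq).
have dX k i j l : dot (pd k (h i j) q) (pd l X q) = - dot (h i j q) (h k l q).
  exact: (pdot_dsff_Xl pX k i j l Uq).
have n0 := normal_sff 0 0 Uq; have n1 := normal_sff 0 1 Uq.
have n2 := normal_sff 1 1 Uq.
have dXr k l (w : 'rV[R]_n.+1) i j : h i j q = w -> forall z, h k l q = z ->
    dot (pd k (h i j) q) (pd l X q) = - dot w z by move=> <- z <-; exact: dX.
have H a b c : tri s (X q) (h 0 0 q) (pd 1 X q) a b c
     + tri s (X q) (pd 0 X q) (h 0 1 q) a b c = 0 ->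
   tri s (X q) (h 0 1 q) (pd 1 X q) a b c
     + tri s (X q) (pd 0 X q) (h 1 1 q) a b c = 0 ->
   dot (pd 1 X q) (pd 1 X q) *
   wedge_velocity (s := s) (X q) (pd 0 X q) (pd 1 X q) (h 0 0 q) (h 0 1 q)
    (pd 0 X q) (XX 0 0 q) (XX 0 1 q) (pd 0 (h 0 0) q) (pd 0 (h 0 1) q) a b c
   - dot (pd 0 X q) (pd 1 X q) * (
   wedge_velocity (s := s) (X q) (pd 0 X q) (pd 1 X q) (h 0 1 q) (h 1 1 q)
    (pd 0 X q) (XX 0 0 q) (XX 0 1 q) (pd 0 (h 1 0) q) (pd 0 (h 1 1) q) a b c
   + wedge_velocity (s := s) (X q) (pd 0 X q) (pd 1 X q) (h 0 0 q) (h 0 1 q)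
    (pd 1 X q) (XX 1 0 q) (XX 1 1 q) (pd 1 (h 0 0) q) (pd 1 (h 0 1) q) a b c)
   + dot (pd 0 X q) (pd 0 X q) *
   wedge_velocity (s := s) (X q) (pd 0 X q) (pd 1 X q) (h 0 1 q) (h 1 1 q)
    (pd 1 X q) (XX 1 0 q) (XX 1 1 q) (pd 1 (h 1 0) q) (pd 1 (h 1 1) q) a b c = 0.
  move=> T0 T1; have := @laplacian_gauss_comp a b c q Uq _ (lap0 a b c).
  rewrite (gE Uq 1 1) (gE Uq 0 1) (gE Uq 0 0) /wedge_vel e10; apply.
  by apply: forall_I2; rewrite ?e10.
have A := mean_curvature_zero uf (patch_det pX Uq) n0 n1 n2 H.
split.
- exact: A.
- exact: (sff_prop_coord uf (patch_pos pX Uq) (patch_det pX Uq) n0 n1 n2 v00 v01 v10 v11 H).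
- exact: (sff_null uf (patch_pos pX Uq) (patch_det pX Uq) n0 n1 n2 v00 v01 v10 v11
   (dx 0 0 0) (dx 0 0 1) (dx 0 1 0) (dx 0 1 1) (dx 1 0 0) (dx 1 0 1) (dx 1 1 0) (dx 1 1 1)
   (dX 0 0 0 0) (dX 0 0 0 1) (dXr 0 0 _ 0 1 erefl _ erefl) (dX 0 0 1 1)
   (dXr 0 0 _ 1 0 e10 _ erefl) (dXr 0 1 _ 1 0 e10 _ erefl) (dX 0 1 1 0) (dX 0 1 1 1)
   (dXr 1 0 _ 0 0 erefl _ e10) (dX 1 0 0 1) (dXr 1 0 _ 0 1 erefl _ e10) (dX 1 0 1 1)
   (dXr 1 0 _ 1 0 e10 _ e10) (dXr 1 1 _ 1 0 e10 _ erefl) (dXr 1 0 _ 1 1 erefl _ e10) (dX 1 1 1 1) H).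
Qed.

End HarmonicPoint.

(** * Constancy of the null direction *)

(** Used for [f0 X_0 + f1 X_1 + g X + w N], the Gauss formula: differentiating it
    adds no normal vectors except those carried by [N]. *)
Lemma nproj_derivative (R : realType) (n s : nat) (x a b N dN dx v0 v1 : 'rV[R]_n)
    (f0 f1 g w df0 df1 dg dw w0 w1 : R) : unit_frame s x a b ->
  is_normal (s := s) x a b N -> is_normal (s := s) x a b dN ->
  dx = a \/ dx = b ->
  nproj s x a b v0 = w0 *: N -> nproj s x a b v1 = w1 *: N ->
  nproj s x a b (df0 *: a + f0 *: v0 + (df1 *: b + f1 *: v1)
     + (dg *: x + g *: dx) + (dw *: N + w *: dN))
  = (f0 * w0 + f1 * w1 + dw) *: N + w *: dN.
Proof.
move=> uf [n1 n2 n3] [m1 m2 m3] dxE e0 e1.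
have d0 : nproj s x a b dx = 0.
  by case: dxE => ->; [exact: nproj0a | exact: nproj0b].
rewrite !(nprojD, nprojZ) (nproj0a uf) (nproj0b uf) (nproj0x uf) d0 e0 e1.
rewrite (nproj_normal n1 n2 n3) (nproj_normal m1 m2 m3) !scaler0 !add0r addr0.
by rewrite !scalerA -!scalerDl addrA -!scalerDl.
Qed.

Lemma det_eq0_vectors (R : realType) (n : nat) (a b c d : R) (V0 V1 : 'rV[R]_n) :
  a * d - b * c != 0 -> a *: V1 = c *: V0 -> b *: V1 = d *: V0 -> V0 = 0 /\ V1 = 0.
Proof.
move=> D L0 L1.
have Z0 : (a * d - b * c) *: V0 = 0.
  by rewrite scalerBl -!scalerA -L1 -L0 !scalerA mulrC subrr.
have Z1 : (a * d - b * c) *: V1 = 0.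
  by rewrite scalerBl mulrC (mulrC b) -!scalerA L1 L0 !scalerA mulrC subrr.
have F (V : 'rV[R]_n) : (a * d - b * c) *: V = 0 -> V = 0.
  by move/eqP; rewrite scaler_eq0 (negPf D) => /eqP.
by split; apply: F.
Qed.

Lemma rV_neq0 (R : realType) (n : nat) (v : 'rV[R]_n) : v != 0 ->
  exists k, v 0 k != 0.
Proof.
move=> v0; have [/existsP[j Hj]|] := boolP [exists j, v 0 j != 0]; first by exists j.
rewrite negb_exists => /forallP H; case/eqP: v0.
by apply/rowP => j; rewrite mxE; apply/eqP; have := H j; rewrite negbK.
Qed.

Lemma proportional_scale (R : realType) (n : nat) (u v : 'rV[R]_n) k : u 0 k != 0 ->
  (forall a, u 0 k * v 0 a = u 0 a * v 0 k) -> v = v 0 k *: ((u 0 k)^-1 *: u).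
Proof.
move=> u0 H; apply/rowP => a; rewrite !mxE.
by apply: (mulfI u0); rewrite H; field.
Qed.

Lemma near_ball_sub (R : realType) (P : set 'rV[R]_2) (q : 'rV[R]_2) :
  (\forall r \near q, P r) -> exists2 e : R, 0 < e & ball q e `<=` P.
Proof. by move=> /nbhs_ballP[e e0 H]; exists e. Qed.

Lemma codazzi_difference (R : realType) (n : nat) (N V0 V1 : 'rV[R]_n) (a b c d : R) :
  a *: N + c *: V1 = b *: N + d *: V0 ->
  (a - b) *: N + c *: V1 - d *: V0 = 0.
Proof.
move=> H; have -> : (a - b) *: N + c *: V1 - d *: V0
    = (a *: N + c *: V1) - (b *: N + d *: V0).
  by apply/rowP => k; rewrite !mxE; ring.
by rewrite H subrr.
Qed.

Lemma symmetric_proportional (R : realType) (n : nat) (t : 'I_2 -> 'I_2 -> 'rV[R]_n) :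
  t 1 0 = t 0 1 ->
  (forall a b, [/\ t 0 0 0 a * t 0 1 0 b = t 0 0 0 b * t 0 1 0 a,
     t 0 0 0 a * t 1 1 0 b = t 0 0 0 b * t 1 1 0 a
   & t 0 1 0 a * t 1 1 0 b = t 0 1 0 b * t 1 1 0 a]) ->
  forall i j k l a b, t i j 0 a * t k l 0 b = t i j 0 b * t k l 0 a.
Proof.
move=> e P i j k l a b.
have S (u v : 'rV[R]_n) : (forall a b, u 0 a * v 0 b = u 0 b * v 0 a) ->
    v 0 a * u 0 b = v 0 b * u 0 a.
  by move=> H; rewrite mulrC H mulrC.
have T (u : 'rV[R]_n) : u 0 a * u 0 b = u 0 b * u 0 a by rewrite mulrC.
have P01 c d : t 0 0 0 c * t 0 1 0 d = t 0 0 0 d * t 0 1 0 c by have [] := P c d.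
have P02 c d : t 0 0 0 c * t 1 1 0 d = t 0 0 0 d * t 1 1 0 c by have [] := P c d.
have P12 c d : t 0 1 0 c * t 1 1 0 d = t 0 1 0 d * t 1 1 0 c by have [] := P c d.
move: i j k l; apply: forall_I2; apply: forall_I2; apply: forall_I2; apply: forall_I2;
 rewrite ?e; first [exact: T|exact: P01|exact: P02|exact: P12|exact: (S _ _ P01)
   |exact: (S _ _ P02)|exact: (S _ _ P12)].
Qed.

Lemma coordinate_split (R : realType) (n : nat) (N V0 V1 : 'rV[R]_n) (a b c : R) k :
  V0 0 k = 0 -> V1 0 k = 0 -> N 0 k = 1 ->
  (a *: N + b *: V1 - c *: V0) 0 k = (0 : 'rV[R]_n) 0 k -> a = 0.
Proof.
by move=> e0 e1 e; rewrite !mxE e0 e1 e !mulr0 subr0 addr0 mulr1.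
Qed.

Section Codazzi.
Context {R : realType} {n s : nat} {U : set 'rV[R]_2}
  {X : 'rV[R]_2 -> 'rV[R]_n.+1}.
Hypothesis pX : is_patch s U X.
Implicit Types (q : 'rV[R]_2) (i j k l : 'I_2).
Local Notation dot := (pdot s).
Local Notation oU := (patch_open pX).
Local Notation sX := (patch_smooth pX).
Local Notation XX i j := (pd i (pd j X)).
Local Notation h := (@sff R n s X).

(** Christoffel symbols; the upper index comes first. *)
Definition chris l i j q : R^o :=
  if l == 0 then tcoef s (pd 0 X q) (pd 1 X q) (XX i j q)
  else tcoef s (pd 1 X q) (pd 0 X q) (XX i j q).

Lemma Ck_on_chris k l i j : Ck_on k U (chris l i j).
Proof.
move: l; apply: forall_I2; first exact: (Ck_on_tcoef pX k i j).
exact: (Ck_on_tcoef' pX k i j).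
Qed.

Variables (om : 'I_2 -> 'I_2 -> 'rV[R]_2 -> R^o) (N : 'rV[R]_2 -> 'rV[R]_n.+1).
Hypotheses (s_om : forall i j, Ck_on 1 U (om i j)) (sN : Ck_on 1 U N).
Hypothesis hE : forall i j q, U q -> h i j q = om i j q *: N q.
Hypothesis nN : forall q, U q -> is_normal (s := s) (X q) (pd 0 X q) (pd 1 X q) (N q).
Hypothesis N0 : forall q, U q -> dot (N q) (N q) = 0.

Let dN k q : U q -> is_derive q (E2 k) N (pd k N q).
Proof. by move=> Uq; exact: is_derive_pd (Ck_on_derivable Uq sN). Qed.

Let NX i q : U q -> dot (N q) (pd i X q) = 0.
Proof. by move=> Uq; have [_ a b] := nN Uq; move: i; apply: forall_I2. Qed.

Let NXX k l q : U q -> dot (N q) (XX k l q) = 0.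
Proof.
move=> Uq; have [a b c] := nN Uq.
apply: etrans (pdot_nproj _ a b c) _.
apply: etrans (congr1 (pdot s (N q)) (hE k l Uq)) _.
by rewrite pdotZr (N0 Uq) mulr0.
Qed.

(** A derivative of [N] pairs with [X_l] as [N] does with [- X_kl], whose normal
    part is a multiple of the null vector [N]. *)
Lemma pd_null_normal k q : U q ->
  is_normal (s := s) (X q) (pd 0 X q) (pd 1 X q) (pd k N q).
Proof.
move=> Uq.
have x0 : dot (pd k N q) (X q) = 0.
  have := pd_const_on pX Uq (fun p Up => let: And3 a _ _ := nN Up in a)
    (is_derive_pdot (dN k Uq) (d1X pX k Uq)).
  by rewrite (NX k Uq) addr0.
have xl l : dot (pd k N q) (pd l X q) = 0.
  have := pd_const_on pX Uq (fun p Up => NX l Up)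
    (is_derive_pdot (dN k Uq) (d2X pX k l Uq)).
  by rewrite (NXX k l Uq) addr0.
by split; [exact: x0 | exact: (xl 0) | exact: (xl 1)].
Qed.

Lemma nproj_pd_XX k j i q : U q ->
  nproj s (X q) (pd 0 X q) (pd 1 X q) (pd k (XX j i) q)
  = (chris 0 j i q * om k 0 q + chris 1 j i q * om k 1 q + pd k (om j i) q) *: N q
    + om j i q *: pd k N q.
Proof.
move=> Uq.
pose f r := chris 0 j i r *: pd 0 X r + chris 1 j i r *: pd 1 X r
  + (- dot (pd j X r) (pd i X r)) *: X r + om j i r *: N r.
have E : pd k (XX j i) q = pd k f q.
  apply: (pd_eq_on k oU Uq) => p Up; apply: etrans (gauss_formula pX j i Up) _.
  by rewrite (hE j i Up) /f scaleNr.
have D0 := is_derive_pd (Ck_on_derivable (i := k) Uq (Ck_on_chris 1 0 j i)).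
have D1 := is_derive_pd (Ck_on_derivable (i := k) Uq (Ck_on_chris 1 1 j i)).
have Dg := is_derive_pd (Ck_on_derivable (i := k) Uq (Ck_onN oU (Ck_on_metric pX 1 j i))).
have Do := is_derive_pd (Ck_on_derivable (i := k) Uq (s_om j i)).
have Df := is_deriveD (is_deriveD (is_deriveD
   (is_derive_scale D0 (d2X pX k 0 Uq)) (is_derive_scale D1 (d2X pX k 1 Uq)))
   (is_derive_scale Dg (d1X pX k Uq))) (is_derive_scale Do (dN k Uq)).
rewrite E (pd_is_derive (f := f) Df).
have dxE : pd k X q = pd 0 X q \/ pd k X q = pd 1 X q.
  by move: k {E D0 D1 Dg Do Df}; apply: forall_I2; [left | right].
exact: (nproj_derivative _ _ _ _ _ _ _ _ (frame pX Uq) (nN Uq)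
  (pd_null_normal k Uq) dxE (hE k 0 Uq) (hE k 1 Uq)).
Qed.

(** The defect in the Codazzi equation for the coefficients [om]. *)
Definition codazzi_defect i q : R :=
  (chris 0 0 i q * om 1 0 q + chris 1 0 i q * om 1 1 q + pd 1 (om 0 i) q)
  - (chris 0 1 i q * om 0 0 q + chris 1 1 i q * om 0 1 q + pd 0 (om 1 i) q).

(** Compare the normal parts of [X_10i] and [X_01i]. *)
Lemma codazzi_vector i q : U q ->
  codazzi_defect i q *: N q + om 0 i q *: pd 1 N q - om 1 i q *: pd 0 N q = 0.
Proof.
move=> Uq.
have S : pd 1 (XX 0 i) q = pd 0 (XX 1 i) q.
  exact: (schwarz_rV 1 0 oU Uq (Ck_on_pd i (sX 3%N))).
exact: codazzi_difference (etrans (esym (nproj_pd_XX 1 0 i Uq))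
  (etrans (congr1 (nproj s (X q) (pd 0 X q) (pd 1 X q)) S) (nproj_pd_XX 0 1 i Uq))).
Qed.

(** The constant coordinate isolates the defect.  What is left is a homogeneous
    linear system for the derivatives of [N], with the matrix [om]. *)
Lemma codazzi_split (k0 : 'I_n.+1) : (forall q, U q -> N q 0 k0 = 1) ->
  (forall q, U q -> om 0 0 q * om 1 1 q - om 0 1 q * om 1 0 q != 0) ->
  forall q, U q -> (forall i, codazzi_defect i q = 0) /\ (forall k, pd k N q = 0).
Proof.
move=> N1 d0 q Uq.
have Nk k : pd k N q 0 k0 = 0.
  rewrite (pd_coord k0 (is_derive_derivable (dN k Uq))).
  rewrite (pd_eq_on (g := fun=> 1 : R^o) k oU Uq N1).
  exact: (pd_is_derive (is_derive_cst (1 : R^o) q (E2 k))).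
have K i : codazzi_defect i q = 0.
  have := congr1 (fun v : 'rV[R]_n.+1 => v 0 k0) (codazzi_vector i Uq).
  by move: (Nk 0) (Nk 1) (N1 q Uq); exact: (@coordinate_split R n.+1).
split; first exact: K.
have L i : om 0 i q *: pd 1 N q = om 1 i q *: pd 0 N q.
  have := codazzi_vector i Uq; rewrite K scale0r add0r => /eqP.
  by rewrite subr_eq0 => /eqP.
have [Z0 Z1] := det_eq0_vectors (d0 q Uq) (L 0) (L 1).
by apply: forall_I2; [exact: Z0 | exact: Z1].
Qed.

End Codazzi.

Section ConstantDirection.
Context {R : realType} {n s : nat} {U : set 'rV[R]_2}
  {X : 'rV[R]_2 -> 'rV[R]_n.+1}.
Hypothesis pX : is_patch s U X.
Local Notation dot := (pdot s).
Local Notation oU := (patch_open pX).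
Local Notation h := (@sff R n s X).

Hypothesis nullU : forall q, U q -> null_point (s := s) (X := X) q.

Lemma is_patch_sub (W : set 'rV[R]_2) : open W -> W `<=` U -> is_patch s W X.
Proof.
move=> oW WU; split.
- exact: oW.
- by move=> k; exact: (Ck_on_sub WU (patch_smooth pX k)).
- by move=> q /WU; exact: (patch_unit pX).
- by move=> q /WU; exact: (patch_pos pX).
- by move=> q /WU; exact: (patch_det pX).
Qed.

Lemma sff_null_all i j q : U q -> dot (h i j q) (h i j q) = 0.
Proof.
move=> Uq; have [_ _ [z0 z1 z2]] := nullU Uq.
have e10 := sffC pX 1 0 Uq.
move: i j; apply: forall_I2; apply: forall_I2.
- exact: z0.
- exact: z1.
- by rewrite e10; exact: z1.
- exact: z2.
Qed.

Lemma sff_prop_all i j k l (a b : 'I_n.+1) q : U q ->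
  h i j q 0 a * h k l q 0 b = h i j q 0 b * h k l q 0 a.
Proof.
move=> Uq; have [_ P _] := nullU Uq.
exact: (@symmetric_proportional R n.+1 (fun i j => h i j q) (sffC pX 1 0 Uq) P).
Qed.

(** Dividing a nonzero value of the second fundamental form by one of its
    coordinates gives a null vector field with a constant coordinate, to which
    [codazzi_split] applies. *)
Theorem constant_direction q0 i0 j0 : U q0 -> h i0 j0 q0 != 0 ->
  exists (e : R) (c : 'rV[R]_n.+1) (om : 'I_2 -> 'I_2 -> 'rV[R]_2 -> R^o),
  [/\ 0 < e /\ ball q0 e `<=` U, lightlike s c,
      forall k i j, Ck_on k (ball q0 e) (om i j),
      forall i j q, ball q0 e q -> h i j q = om i j q *: c
    & forall q, ball q0 e q ->
      [/\ om 1 0 q = om 0 1 q,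
          mean_curv (dot (pd 0 X q) (pd 0 X q)) (dot (pd 0 X q) (pd 1 X q))
            (dot (pd 1 X q) (pd 1 X q)) (om 0 0 q) (om 0 1 q) (om 1 1 q) = 0,
          0 < om 0 1 q * om 0 1 q - om 0 0 q * om 1 1 q
        & forall i, codazzi_defect (s := s) (X := X) om i q = 0]].
Proof.
move=> Uq0 h0.
have [k0 hk0] := rV_neq0 h0.
(* The coordinate [k0] of [N] below is 1, and [om] is that of [h]. *)
pose om i j : 'rV[R]_2 -> R^o := fun q => h i j q 0 k0.
have s_omU k i j : Ck_on k U (om i j).
  exact: ((Ck_on_rV k _ oU).1 (Ck_on_sff pX k i j) k0).
have near_om := near_neq0 (Ck_on_continuous Uq0 (s_omU 0%N i0 j0)) hk0.
have [e e0 He] := near_ball_sub (filterI (F := nbhs q0) (near_open oU Uq0) near_om).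
set W := ball q0 e in He *.
have oW : open W by exact: ball_open.
have WU : W `<=` U by move=> q /He[].
have om0 q : W q -> om i0 j0 q != 0 by move=> /He[].
have pW := is_patch_sub oW WU.
pose N q : 'rV[R]_n.+1 := (om i0 j0 q)^-1 *: h i0 j0 q.
have s_om k i j : Ck_on k W (om i j) by exact: Ck_on_sub WU (s_omU k i j).
have sN : Ck_on 1 W N.
  exact: (Ck_on_scale oW (Ck_onV oW om0 (s_om 1%N i0 j0)) (Ck_on_sff pW 1 i0 j0)).
have hE i j q : W q -> h i j q = om i j q *: N q.
  move=> Wq; exact: (proportional_scale (om0 q Wq)
    (fun a => sff_prop_all i0 j0 i j k0 a (WU q Wq))).
have N1 q : W q -> N q 0 k0 = 1.
  by move=> Wq; rewrite mxE mulVf //; exact: om0.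
have NX q : W q -> is_normal (s := s) (X q) (pd 0 X q) (pd 1 X q) (N q).
  move=> /WU Uq; have xX := pdot_sff_X pX i0 j0 Uq.
  have x0 := pdot_sff_Xk pX i0 j0 0 Uq; have x1 := pdot_sff_Xk pX i0 j0 1 Uq.
  by split; rewrite pdotZl ?xX ?x0 ?x1 mulr0.
have NN q : W q -> dot (N q) (N q) = 0.
  by move=> /WU Uq; rewrite pdotZl pdotZr (sff_null_all i0 j0 Uq) !mulr0.
have om10 q : W q -> om 1 0 q = om 0 1 q.
  by move=> /WU Uq; exact: (congr1 (fun v : 'rV[R]_n.+1 => v 0 k0) (sffC pX 1 0 Uq)).
have trace q : W q ->
    mean_curv (dot (pd 0 X q) (pd 0 X q)) (dot (pd 0 X q) (pd 1 X q))
            (dot (pd 1 X q) (pd 1 X q)) (om 0 0 q) (om 0 1 q) (om 1 1 q) = 0.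
  move=> /WU Uq; have [T _ _] := nullU Uq.
  have D i j : om i j q = dot (h i j q) (dual_vec (s := s) k0) by rewrite pdot_dual.
  by rewrite (D 0 0) (D 0 1) (D 1 1); exact: T.
have det_om q : W q -> 0 < om 0 1 q * om 0 1 q - om 0 0 q * om 1 1 q.
  move=> Wq; apply: (tracefree_det (patch_pos pW Wq) (patch_det pW Wq) (trace q Wq)).
  have nz := om0 q Wq; have s10 := om10 q Wq; move: nz s10.
  move: i0 j0 {near_om h0 hk0 He om0 N sN hE N1 NX NN}.
  apply: forall_I2; apply: forall_I2 => nz s10.
  - by left.
  - by right; left.
  - by right; left; rewrite -s10.
  - by right; right.
have C q (Wq : W q) := codazzi_split pW (fun i j => s_om 1%N i j) sN hE NX NN N1
  (fun q Wq => ltac:(rewrite (om10 q Wq) subr_eq0 eq_sym -subr_eq0;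
      exact: lt0r_neq0 (det_om q Wq))) Wq.
have cN q : W q -> N q = N q0.
  move=> Wq; apply/rowP => a.
  apply: (@ball_constant R (fun r => N r 0 a) q0 e) Wq => i z Wz.
  have dN : derivable N z (E2 i) by exact: Ck_on_derivable Wz sN.
  have := is_derive_pd ((derivable_rV _ _ _).1 dN a).
  by rewrite -(pd_coord a dN) ((C z Wz).2 i) mxE.
have Wq0 : W q0 by exact: ballxx.
exists e, (N q0), om; split.
- by [].
- split; first exact: NN.
  apply/eqP => N0; have := N1 q0 Wq0; rewrite N0 mxE => /esym/eqP.
  by rewrite oner_eq0.
- exact: s_om.
- by move=> i j q Wq; rewrite -(cN q Wq); exact: hE.
- move=> q Wq; split.
  + exact: om10.
  + exact: trace.
  + exact: det_om.
  + exact: (C q Wq).1.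
Qed.

End ConstantDirection.

(** * Closed forms that diagonalize the second fundamental form *)

Section FormAlgebra.
Context {R : realType}.
Variables (E F G w0 w1 w2 lam : R).
Hypotheses (E0 : 0 < E) (D0 : 0 < E * G - F * F) (l0 : 0 < lam).
Hypothesis trace0 : mean_curv E F G w0 w1 w2 = 0.
Hypothesis lamE : lam * lam * (E * G - F * F) = w1 * w1 - w0 * w2.

Let P00 := (lam * E + w0) / 2.
Let P01 := (lam * F + w1) / 2.
Let P11 := (lam * G + w2) / 2.

Let two0 : (2 : R) != 0. Proof. by rewrite pnatr_eq0. Qed.

(** The trace condition removes the mixed terms of the determinant, and [lam]
    is chosen to cancel the others. *)
Lemma half_sum_det : P00 * P11 = P01 * P01.
Proof.
apply: (mulfI two0); apply: (mulfI two0); apply/eqP; rewrite -subr_eq0; apply/eqP.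
transitivity (lam * lam * (E * G - F * F) - (w1 * w1 - w0 * w2)
   + lam * mean_curv E F G w0 w1 w2).
  by rewrite /P00 /P01 /P11 /mean_curv; field.
by rewrite lamE trace0 subrr mulr0 addr0.
Qed.

Lemma half_sum_trace : G * P00 - 2 * F * P01 + E * P11 = lam * (E * G - F * F).
Proof.
apply: (mulfI two0).
transitivity (2 * (lam * (E * G - F * F)) + mean_curv E F G w0 w1 w2).
  by rewrite /P00 /P01 /P11 /mean_curv; field.
by rewrite trace0 addr0.
Qed.

(** The choice of [lam] and the trace condition give
    [(lam E)^2 - w0^2 = (E w1 - F w0)^2 / (E G - F^2)]. *)
Lemma half_sum_ge0 : 0 <= P00.
Proof.
have H : (lam * E) ^+ 2 * (E * G - F * F)
    = (E * w1 - F * w0) ^+ 2 + (E * G - F * F) * w0 ^+ 2.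
  have -> : (lam * E) ^+ 2 * (E * G - F * F)
    = E * E * (lam * lam * (E * G - F * F)) by ring.
  rewrite lamE; have -> : E * E * (w1 * w1 - w0 * w2) = (E * w1 - F * w0) ^+ 2
     + (E * G - F * F) * w0 ^+ 2 - E * w0 * mean_curv E F G w0 w1 w2.
    by rewrite /mean_curv; ring.
  by rewrite trace0 mulr0 subr0.
have H2 : w0 ^+ 2 <= (lam * E) ^+ 2.
  rewrite -(ler_pM2r D0) H mulrC lerDr; exact: sqr_ge0.
have lE : 0 < lam * E by exact: mulr_gt0.
rewrite /P00 divr_ge0 // -lerBlDl sub0r.
have := ler_sqrt (w0 ^+ 2) (exprn_ge0 2 (ltW lE)).
rewrite H2 !sqrtr_sqr (gtr0_norm lE) ler_norml => /andP[h _].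
exact: h.
Qed.

End FormAlgebra.

Section FormRoots.
Context {R : realType}.

(** A nonnegative degenerate form with vanishing diagonal is zero, but this one
    has the positive trace [lam]. *)
Lemma half_sum_pos (E F G w0 w1 w2 lam : R) :
  0 < E -> 0 < E * G - F * F -> 0 < lam -> mean_curv E F G w0 w1 w2 = 0 ->
  lam * lam * (E * G - F * F) = w1 * w1 - w0 * w2 ->
  0 < (lam * E + w0) / 2 \/ 0 < (lam * G + w2) / 2.
Proof.
move=> E0 D0 l0 t lE.
have G0 : 0 < G.
  have : 0 < E * G by have := sqr_ge0 F; rewrite expr2; lra.
  by rewrite pmulr_rgt0.
have p0 := half_sum_ge0 E0 D0 l0 t lE.
have p1 : 0 <= (lam * G + w2) / 2.
  apply: (@half_sum_ge0 _ G F E w2 w1 w0) => //.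
  - by rewrite mulrC.
  - by rewrite -t /mean_curv; ring.
  - by rewrite (mulrC G) lE; ring.
have dt := half_sum_det t lE; have tr := half_sum_trace lam t.
have [z0|nz0] := eqVneq ((lam * E + w0) / 2) 0; last by left; rewrite lt0r nz0.
have [z1|nz1] := eqVneq ((lam * G + w2) / 2) 0; last by right; rewrite lt0r nz1.
move: dt tr; rewrite z0 z1 mul0r !mulr0 => /esym/eqP.
rewrite mulf_eq0 orbb => /eqP ->; rewrite mulr0 subrr add0r => /esym/eqP.
by rewrite mulf_eq0 (gt_eqF l0) (gt_eqF D0).
Qed.

(** The form [b] is [a] turned by a right angle, so [a^2 + b^2] is the multiple of
    the metric with the same trace. *)
Lemma rotated_form (E F G w0 w1 w2 lam W a0 a1 : R) :
  W != 0 -> W * W = E * G - F * F -> mean_curv E F G w0 w1 w2 = 0 ->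
  a0 * a0 = (lam * E + w0) / 2 -> a0 * a1 = (lam * F + w1) / 2 ->
  a1 * a1 = (lam * G + w2) / 2 ->
  let b0 := (F * a0 - E * a1) / W in let b1 := (G * a0 - F * a1) / W in
  [/\ b0 * b0 = (lam * E - w0) / 2, b0 * b1 = (lam * F - w1) / 2,
      b1 * b1 = (lam * G - w2) / 2 & a0 * b1 - a1 * b0 = lam * W].
Proof.
move=> W0 WW t e00 e01 e11 b0 b1.
have two0 : (2 : R) != 0 by rewrite pnatr_eq0.
have tr := half_sum_trace lam t.
rewrite -e00 -e01 -e11 -WW in tr.
have h0 : w0 = 2 * (a0 * a0) - lam * E by rewrite e00; field.
have h1 : w1 = 2 * (a0 * a1) - lam * F by rewrite e01; field.
have h2 : w2 = 2 * (a1 * a1) - lam * G by rewrite e11; field.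
split.
- apply: (mulfI W0); apply: (mulfI W0); apply: (mulfI two0).
  transitivity (2 * (E * (G * (a0 * a0) - 2 * F * (a0 * a1) + E * (a1 * a1))
     - (E * G - F * F) * (a0 * a0))); first by rewrite /b0; field.
  by rewrite tr -WW h0; field.
- apply: (mulfI W0); apply: (mulfI W0); apply: (mulfI two0).
  transitivity (2 * (F * (G * (a0 * a0) - 2 * F * (a0 * a1) + E * (a1 * a1))
     - (E * G - F * F) * (a0 * a1))); first by rewrite /b0 /b1; field.
  by rewrite tr -WW h1; field.
- apply: (mulfI W0); apply: (mulfI W0); apply: (mulfI two0).
  transitivity (2 * (G * (G * (a0 * a0) - 2 * F * (a0 * a1) + E * (a1 * a1))
     - (E * G - F * F) * (a1 * a1))); first by rewrite /b1; field.
  by rewrite tr -WW h2; field.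
- apply: (mulfI W0).
  transitivity (G * (a0 * a0) - 2 * F * (a0 * a1) + E * (a1 * a1)).
    by rewrite /b0 /b1; field.
  by rewrite tr; ring.
Qed.

Section Closed.
Variables (a0 a1 b0 b1 M M0 M1 : R).
Variables (a00 a01 a10 a11 b00 b01 b10 b11 : R).
Variables (v000 v001 v010 v011 v110 v111 : R).
Hypotheses (M_neq0 : M != 0) (D_neq0 : a0 * b1 - a1 * b0 != 0).
Let E := M * (a0 * a0 + b0 * b0).
Let F := M * (a0 * a1 + b0 * b1).
Let G := M * (a1 * a1 + b1 * b1).
Let dd m x y dx dy (z w dz dw : R) :=
  m * (x * y + z * w) + M * (dx * y + x * dy + (dz * w + z * dw)).
Hypotheses
  (E0 : v000 + v000 = dd M0 a0 a0 a00 a00 b0 b0 b00 b00)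
  (E1 : v010 + v010 = dd M1 a0 a0 a01 a01 b0 b0 b01 b01)
  (F0 : v001 + v010 = dd M0 a0 a1 a00 a10 b0 b1 b00 b10)
  (F1 : v011 + v110 = dd M1 a0 a1 a01 a11 b0 b1 b01 b11)
  (G0 : v011 + v011 = dd M0 a1 a1 a10 a10 b1 b1 b10 b10)
  (G1 : v111 + v111 = dd M1 a1 a1 a11 a11 b1 b1 b11 b11).
Let c0 x y := (G * x - F * y) / (E * G - F * F).
Let c1 x y := (E * y - F * x) / (E * G - F * F).
Let o00 := a0 * a0 - b0 * b0.
Let o01 := a0 * a1 - b0 * b1.
Let o11 := a1 * a1 - b1 * b1.

(** The metric being [M (a^2 + b^2)] and the second fundamental form [a^2 - b^2],
    the Codazzi equations become linear in the derivatives of [a] and [b]; those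
    of the conformal factor [M] cancel because the form is trace free. *)
Lemma codazzi_forms :
  (c0 v000 v001 * o01 + c1 v000 v001 * o11
      + (a01 * a0 + a0 * a01 - (b01 * b0 + b0 * b01)))
    - (c0 v010 v011 * o00 + c1 v010 v011 * o01
      + (a10 * a0 + a1 * a00 - (b10 * b0 + b1 * b00)))
    = 2 * (a0 * (a01 - a10) - b0 * (b01 - b10)) /\
  (c0 v010 v011 * o01 + c1 v010 v011 * o11
      + (a01 * a1 + a0 * a11 - (b01 * b1 + b0 * b11)))
    - (c0 v110 v111 * o00 + c1 v110 v111 * o01
      + (a10 * a1 + a1 * a10 - (b10 * b1 + b1 * b10)))
    = 2 * (a1 * (a01 - a10) - b1 * (b01 - b10)).
Proof.
have two0 : (2 : R) != 0 by rewrite pnatr_eq0.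
have h (x y : R) : x + x = y -> x = y / 2 by move=> <-; field.
have e000 := h _ _ E0; have e010 := h _ _ E1; have e011 := h _ _ G0.
have e111 := h _ _ G1.
have e001 : v001 = dd M0 a0 a1 a00 a10 b0 b1 b00 b10 - v010 by rewrite -F0 addrK.
have e110 : v110 = dd M1 a0 a1 a01 a11 b0 b1 b01 b11 - v011 by rewrite -F1 addrC addKr.
have DE : E * G - F * F = M * M * (a0 * b1 - a1 * b0) * (a0 * b1 - a1 * b0).
  by rewrite /E /F /G; ring.
rewrite /c0 /c1 DE e001 e110 e000 e010 e011 e111 /E /F /G /dd /o00 /o01 /o11.
split; field; rewrite ?M_neq0 ?D_neq0 ?two0 //.
Qed.

Lemma closed_forms (K0 K1 : R) :
  K0 = 2 * (a0 * (a01 - a10) - b0 * (b01 - b10)) ->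
  K1 = 2 * (a1 * (a01 - a10) - b1 * (b01 - b10)) ->
  K0 = 0 -> K1 = 0 -> a01 = a10 /\ b01 = b10.
Proof.
move=> -> -> k0 k1; have two0 : (2 : R) != 0 by rewrite pnatr_eq0.
have z c : 2 * ((a0 * b1 - a1 * b0) * c) = 0 -> c = 0.
  by move/eqP; rewrite !mulf_eq0 (negPf two0) (negPf D_neq0) /= => /eqP.
split; apply/eqP; rewrite -subr_eq0; apply/eqP; apply: z.
  transitivity (b1 * (2 * (a0 * (a01 - a10) - b0 * (b01 - b10)))
    - b0 * (2 * (a1 * (a01 - a10) - b1 * (b01 - b10)))); first by ring.
  by rewrite k0 k1 !mulr0 subrr.
transitivity (a1 * (2 * (a0 * (a01 - a10) - b0 * (b01 - b10)))
    - a0 * (2 * (a1 * (a01 - a10) - b1 * (b01 - b10)))); first by ring.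
by rewrite k0 k1 !mulr0 subrr.
Qed.

End Closed.
End FormRoots.

Lemma rank_one_root (R : realType) (a b c r : R) : r != 0 -> r * r = a ->
  a * c = b * b ->
  [/\ a / r * (a / r) = a, a / r * (b / r) = b & b / r * (b / r) = c].
Proof.
move=> r0 <- H; split; [by field | by field |].
have -> : b / r * (b / r) = b * b / (r * r) by field.
by rewrite -H; field.
Qed.

Lemma two_forms_algebra (R : realType) (g om : 'I_2 -> 'I_2 -> R) (a b : 'I_2 -> R)
    (lam W : R) : g 1 0 = g 0 1 -> om 1 0 = om 0 1 -> 0 < W ->
  W * W = g 0 0 * g 1 1 - g 0 1 * g 0 1 -> 0 < lam ->
  mean_curv (g 0 0) (g 0 1) (g 1 1) (om 0 0) (om 0 1) (om 1 1) = 0 ->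
  a 0 * a 0 = (lam * g 0 0 + om 0 0) / 2 -> a 0 * a 1 = (lam * g 0 1 + om 0 1) / 2 ->
  a 1 * a 1 = (lam * g 1 1 + om 1 1) / 2 ->
  (forall i, b i = (g i 1 * a 0 - g i 0 * a 1) / W) ->
  [/\ 0 < a 0 * b 1 - a 1 * b 0,
      forall i j, lam * g i j = a i * a j + b i * b j
    & forall i j, om i j = a i * a j - b i * b j].
Proof.
move=> g10 o10 W0 WW l0 t p0 p1 p2 bE; have two0 : (2 : R) != 0 by rewrite pnatr_eq0.
have [b0 b1 b2 Delta] := rotated_form (lt0r_neq0 W0) WW t p0 p1 p2.
have b1E : b 1 = (g 1 1 * a 0 - g 0 1 * a 1) / W by rewrite bE g10.
rewrite -(bE 0) -b1E in b0 b1 b2 Delta.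
split; first by rewrite Delta mulr_gt0.
  apply: forall_I2; apply: forall_I2.
  - by rewrite p0 b0; field.
  - by rewrite p1 b1; field.
  - by rewrite g10 (mulrC (a 1)) (mulrC (b 1)) p1 b1; field.
  - by rewrite p2 b2; field.
apply: forall_I2; apply: forall_I2.
- by rewrite p0 b0; field.
- by rewrite p1 b1; field.
- by rewrite o10 // (mulrC (a 1)) (mulrC (b 1)) p1 b1; field.
- by rewrite p2 b2; field.
Qed.

Lemma tcoefE (R : realType) (n s : nat) (a b v : 'rV[R]_n) (E F G x y : R) :
  pdot s a a = E -> pdot s a b = F -> pdot s b b = G ->
  pdot s v a = x -> pdot s v b = y ->
  tcoef s a b v = (G * x - F * y) / (E * G - F * F) /\
  tcoef s b a v = (E * y - F * x) / (E * G - F * F).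
Proof.
by move=> <- <- <- <- <-; rewrite /tcoef (gdetC s a b) (pdotC b a).
Qed.

Lemma codazzi_value (R : realType) (c0 c1 c2 c3 o10 o11 o00 o01 d1 d0
    c0' c1' c2' c3' o10' o11' o00' o01' d1' d0' : R) :
  c0 = c0' -> c1 = c1' -> c2 = c2' -> c3 = c3' ->
  o10 = o10' -> o11 = o11' -> o00 = o00' -> o01 = o01' -> d1 = d1' -> d0 = d0' ->
  c0 * o10 + c1 * o11 + d1 - (c2 * o00 + c3 * o01 + d0) = 0 ->
  c0' * o10' + c1' * o11' + d1' - (c2' * o00' + c3' * o01' + d0') = 0.
Proof. by move=> -> -> -> -> -> -> -> -> -> ->. Qed.

Section IsothermalForms.
Context {R : realType} {n s : nat} {U : set 'rV[R]_2}
  {X : 'rV[R]_2 -> 'rV[R]_n.+1}.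
Hypothesis pX : is_patch s U X.
Implicit Types (q : 'rV[R]_2) (i j : 'I_2).
Local Notation dot := (pdot s).
Local Notation oU := (patch_open pX).
Local Notation XX i j := (pd i (pd j X)).
Variable om : 'I_2 -> 'I_2 -> 'rV[R]_2 -> R^o.
Hypothesis s_om : forall k i j, Ck_on k U (om i j).
Hypothesis omU : forall q, U q ->
      [/\ om 1 0 q = om 0 1 q,
          mean_curv (dot (pd 0 X q) (pd 0 X q)) (dot (pd 0 X q) (pd 1 X q))
            (dot (pd 1 X q) (pd 1 X q)) (om 0 0 q) (om 0 1 q) (om 1 1 q) = 0,
          0 < om 0 1 q * om 0 1 q - om 0 0 q * om 1 1 q
        & forall i, codazzi_defect (s := s) (X := X) om i q = 0].

(** Up to the factor [lam], the metric is [al^2 + be^2] and the second fundamental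
    form is [al^2 - be^2]. *)
Definition diagonal_forms (al be : 'I_2 -> 'rV[R]_2 -> R^o) (lam : 'rV[R]_2 -> R) q :=
  [/\ 0 < lam q, 0 < al 0 q * be 1 q - al 1 q * be 0 q,
      forall i j, lam q * dot (pd i X q) (pd j X q) = al i q * al j q + be i q * be j q
    & forall i j, om i j q = al i q * al j q - be i q * be j q].

(** With [lam^2 = - det om / D], the forms [(lam g + om) / 2] and
    [(lam g - om) / 2] are degenerate and nonnegative, hence squares. *)
Lemma exists_diagonal_forms q0 : U q0 ->
  exists (e : R) (al be : 'I_2 -> 'rV[R]_2 -> R^o) (lam : 'rV[R]_2 -> R^o),
  [/\ 0 < e, ball q0 e `<=` U, forall k i, Ck_on k (ball q0 e) (al i),
      forall k i, Ck_on k (ball q0 e) (be i)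
    & (forall k, Ck_on k (ball q0 e) lam) /\
      (forall q, ball q0 e q -> diagonal_forms al be lam q)].
Proof.
move=> Uq0.
pose g i j : 'rV[R]_2 -> R^o := fun q => dot (pd i X q) (pd j X q).
have sg k i j : Ck_on k U (g i j) by exact: (Ck_on_metric pX k i j).
pose D : 'rV[R]_2 -> R^o := fun q => gdet s (pd 0 X q) (pd 1 X q).
have sD k : Ck_on k U D by exact: (Ck_on_gdet pX k).
have D0 q : U q -> 0 < D q by exact: (patch_det pX).
have DE q : D q = g 0 0 q * g 1 1 q - g 0 1 q * g 0 1 q by [].
pose det_om : 'rV[R]_2 -> R^o := fun q => om 0 1 q * om 0 1 q - om 0 0 q * om 1 1 q.
have sdet k : Ck_on k U det_om.
  exact: (Ck_onB oU (Ck_onM oU (s_om k 0 1) (s_om k 0 1))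
                    (Ck_onM oU (s_om k 0 0) (s_om k 1 1))).
have det0 q : U q -> 0 < det_om q by move=> /omU[].
have Dn q : U q -> D q != 0 by move=> /D0 h; rewrite gt_eqF.
pose lam : 'rV[R]_2 -> R^o := fun q => Num.sqrt (det_om q * (D q)^-1).
have pos q : U q -> 0 < det_om q * (D q)^-1.
  by move=> Uq; rewrite mulr_gt0 ?det0 // invr_gt0 D0.
have slam k : Ck_on k U lam.
  exact: (Ck_on_sqrt oU pos (Ck_onM oU (sdet k) (Ck_onV oU Dn (sD k)))).
have lam0 q : U q -> 0 < lam q by move=> Uq; rewrite sqrtr_gt0 pos.
have lamE q : U q -> lam q * lam q * D q = det_om q.
  move=> Uq; rewrite -expr2 sqr_sqrtr; last exact: ltW (pos q Uq).
  by rewrite divfK // Dn.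
pose W : 'rV[R]_2 -> R^o := fun q => Num.sqrt (D q).
have sW k : Ck_on k U W by exact: (Ck_on_sqrt oU D0 (sD k)).
have W0 q : U q -> 0 < W q by move=> Uq; rewrite sqrtr_gt0 D0.
have Wn q : U q -> W q != 0 by move=> /W0 h; rewrite gt_eqF.
have WW q : U q -> W q * W q = D q.
  by move=> Uq; rewrite -expr2 sqr_sqrtr // ltW // D0.
pose P i j : 'rV[R]_2 -> R^o := fun q => 2^-1 * (lam q * g i j q + om i j q).
have sP k i j : Ck_on k U (P i j).
  exact: (Ck_onZ _ oU (Ck_onD oU (Ck_onM oU (slam k) (sg k i j)) (s_om k i j))).
have PE i j q : P i j q = (lam q * g i j q + om i j q) / 2 by rewrite /P mulrC.
have E0 q : U q -> 0 < g 0 0 q by exact: (patch_pos pX).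
have T0 q : U q -> mean_curv (g 0 0 q) (g 0 1 q) (g 1 1 q)
    (om 0 0 q) (om 0 1 q) (om 1 1 q) = 0 by move=> /omU[].
have o10 q : U q -> om 1 0 q = om 0 1 q by move=> /omU[].
have g10 q : g 1 0 q = g 0 1 q by exact: pdotC.
have P10 q : U q -> P 1 0 q = P 0 1 q by move=> Uq; rewrite !PE g10 o10.
have Pdet q : U q -> P 0 0 q * P 1 1 q = P 0 1 q * P 0 1 q.
  move=> Uq; rewrite !PE; exact: (half_sum_det (T0 q Uq) (lamE q Uq)).
(* A rank-one form [P] has the root [P_ik / sqrt P_kk], smooth where [P_kk > 0]. *)
have [k Pk] : exists k, 0 < P k k q0.
  have [h|h] := half_sum_pos (E0 q0 Uq0) (D0 q0 Uq0) (lam0 q0 Uq0) (T0 q0 Uq0) (lamE q0 Uq0).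
    by exists 0; rewrite PE.
  by exists 1; rewrite PE.
have [e e0 He] := near_ball_sub (filterI (F := nbhs q0) (near_open oU Uq0)
  (near_gt0 (Ck_on_continuous Uq0 (sP 0%N k k)) Pk)).
have BU : ball q0 e `<=` U by move=> q /He[].
have Pk0 q : ball q0 e q -> 0 < P k k q by move=> /He[].
have oB : open (ball q0 e) by exact: ball_open.
pose rt : 'rV[R]_2 -> R^o := fun q => Num.sqrt (P k k q).
have srt l : Ck_on l (ball q0 e) rt.
  exact: (Ck_on_sqrt oB Pk0 (Ck_on_sub BU (sP l k k))).
have rt0 q : ball q0 e q -> rt q != 0 by move=> /Pk0 h; rewrite sqrtr_eq0 -ltNge.
have rtE q : ball q0 e q -> rt q * rt q = P k k q.
  by move=> /Pk0 h; rewrite -expr2 sqr_sqrtr // ltW.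
pose al i : 'rV[R]_2 -> R^o := fun q => P i k q * (rt q)^-1.
have sal l i : Ck_on l (ball q0 e) (al i).
  exact: (Ck_onM oB (Ck_on_sub BU (sP l i k)) (Ck_onV oB rt0 (srt l))).
pose be i : 'rV[R]_2 -> R^o := fun q =>
  (g i 1 q * al 0 q - g i 0 q * al 1 q) * (W q)^-1.
have WnB q : ball q0 e q -> W q != 0 by move=> /BU; exact: Wn.
have sbe l i : Ck_on l (ball q0 e) (be i).
  exact: (Ck_onM oB (Ck_onB oB (Ck_onM oB (Ck_on_sub BU (sg l i 1)) (sal l 0))
    (Ck_onM oB (Ck_on_sub BU (sg l i 0)) (sal l 1)))
    (Ck_onV oB WnB (Ck_on_sub BU (sW l)))).
have alP q : ball q0 e q -> [/\ al 0 q * al 0 q = P 0 0 q,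
    al 0 q * al 1 q = P 0 1 q & al 1 q * al 1 q = P 1 1 q].
  move=> Bq; have := rt0 q Bq; have := rtE q Bq; have := Pdet q (BU q Bq).
  have := P10 q (BU q Bq); have := lt0r_neq0 (Pk0 q Bq); rewrite /al.
  move: (rt q) => r.
  move: k {Pk He Pk0 rt srt rt0 rtE al sal be sbe}; apply: forall_I2 => p0 p10 pd rr r0.
  - by have [h0 h1 h2] := rank_one_root r0 rr pd; rewrite p10 h1; split.
  - rewrite mulrC in pd; have [h0 h1 h2] := rank_one_root r0 rr pd.
    by split; [exact: h2 | rewrite mulrC; exact: h1 | exact: h0].
exists e, al, be, lam; split.
- exact: e0.
- exact: BU.
- exact: sal.
- exact: sbe.
- split; first by move=> l; exact: (Ck_on_sub BU (slam l)).
  move=> q Bq; have Uq := BU q Bq; have [p0 p1 p2] := alP q Bq.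
  have [H0 H1 H2] := @two_forms_algebra R (fun i j => g i j q) (fun i j => om i j q)
    (al^~ q) (be^~ q) (lam q) (W q) (g10 q) (o10 q Uq) (W0 q Uq) (WW q Uq) (lam0 q Uq)
    (T0 q Uq) (etrans p0 (PE 0 0 q)) (etrans p1 (PE 0 1 q)) (etrans p2 (PE 1 1 q))
    (fun i => erefl _).
  split; [exact: lam0 | exact: H0 | exact: H1 | exact: H2].
Qed.

(** By [codazzi_forms], the two Codazzi equations are a linear system for [d al]
    and [d be], invertible because the two forms are independent. *)
Lemma diagonal_forms_closed (V : set 'rV[R]_2) (al be : 'I_2 -> 'rV[R]_2 -> R^o)
    (lam : 'rV[R]_2 -> R^o) : open V -> V `<=` U ->
  (forall i, Ck_on 1 V (al i)) -> (forall i, Ck_on 1 V (be i)) -> Ck_on 1 V lam ->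
  (forall q, V q -> diagonal_forms al be lam q) ->
  forall q, V q -> pd 0 (al 1) q = pd 1 (al 0) q /\ pd 0 (be 1) q = pd 1 (be 0) q.
Proof.
move=> oV VU sal sbe slam diag q Vq; have Uq := VU q Vq.
have l0 p : V p -> lam p != 0 by move=> /diag[h _ _ _]; rewrite gt_eqF.
pose M : 'rV[R]_2 -> R^o := fun p => (lam p)^-1.
have sM : Ck_on 1 V M by exact: (Ck_onV oV l0 slam).
have gE i j p : V p ->
    dot (pd i X p) (pd j X p) = M p * (al i p * al j p + be i p * be j p).
  by move=> Vp; have [_ _ H _] := diag p Vp; rewrite -H mulKf // l0.
have dal k i := is_derive_pd (Ck_on_derivable (i := k) Vq (sal i)).
have dbe k i := is_derive_pd (Ck_on_derivable (i := k) Vq (sbe i)).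
have dM k := is_derive_pd (Ck_on_derivable (i := k) Vq sM).
have Dg k i j : dot (XX k i q) (pd j X q) + dot (XX k j q) (pd i X q)
   = pd k M q * (al i q * al j q + be i q * be j q)
     + M q * (pd k (al i) q * al j q + al i q * pd k (al j) q
              + (pd k (be i) q * be j q + be i q * pd k (be j) q)).
  have d1 := is_derive_pdot (s := s) (d2X pX k i Uq) (d2X pX k j Uq).
  have d2 := is_derive_mul (dM k) (is_deriveD (is_derive_mul (dal k i) (dal k j))
      (is_derive_mul (dbe k i) (dbe k j))).
  apply: etrans (congr1 (fun z => _ + z) (pdotC _ _)) _.
  have e1 := pd_is_derive d1; have e2 := pd_is_derive d2.
  have e3 := @pd_eq_on R R^o V (fun p => dot (pd i X p) (pd j X p))
    (fun p => M p * (al i p * al j p + be i p * be j p)) q k oV Vq (gE i j).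
  have e4 := etrans e3 e2.
  exact: (etrans (esym e1) e4).
have Do k i j : pd k (om i j) q = pd k (al i) q * al j q + al i q * pd k (al j) q
      - (pd k (be i) q * be j q + be i q * pd k (be j) q).
  have d2 := is_deriveB (is_derive_mul (dal k i) (dal k j))
      (is_derive_mul (dbe k i) (dbe k j)).
  have E p : V p -> om i j p = al i p * al j p - be i p * be j p.
    by move=> Vp; have [_ _ _ H] := diag p Vp.
  exact: (etrans (pd_eq_on k oV Vq E) (pd_is_derive d2)).
have [_ Delta _ omE] := diag q Vq.
have [_ _ _ cod] := omU Uq.
have X10 l : dot (XX 1 0 q) (pd l X q) = dot (XX 0 1 q) (pd l X q).
  exact: (congr1 (fun v => dot v (pd l X q)) (XXC pX 1 0 Uq)).
have E0 := Dg 0 0 0; have E1 := Dg 1 0 0; have F0 := Dg 0 0 1.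
have F1 := Dg 1 0 1; have G0 := Dg 0 1 1; have G1 := Dg 1 1 1.
have {}E1 := etrans (esym (congr2 (fun x y => x + y) (X10 0) (X10 0))) E1.
have {}F1 := etrans (esym (congr2 (fun x y => x + y) (X10 1) erefl)) F1.
have Mn : M q != 0 by rewrite invr_eq0 l0.
have [k0 k1] := codazzi_forms Mn (lt0r_neq0 Delta) E0 E1 F0 F1 G0 G1.
have C j i x y (ex : dot (XX j i q) (pd 0 X q) = x) (ey : dot (XX j i q) (pd 1 X q) = y)
  := tcoefE (gE 0 0 q Vq) (gE 0 1 q Vq) (gE 1 1 q Vq) ex ey.
have [c000 c100] := C 0 0 _ _ erefl erefl.
have [c001 c101] := C 0 1 _ _ erefl erefl.
have [c010 c110] := C 1 0 _ _ (X10 0) (X10 1).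
have [c011 c111] := C 1 1 _ _ erefl erefl.
have o10 : om 1 0 q = al 0 q * al 1 q - be 0 q * be 1 q.
  by rewrite omE mulrC [X in _ - X]mulrC.
have K0 := codazzi_value c000 c100 c010 c110 o10 (omE 1 1) (omE 0 0) (omE 0 1)
  (Do 1 0 0) (Do 0 1 0) (cod 0).
have K1 := codazzi_value c001 c101 c011 c111 o10 (omE 1 1) (omE 0 0) (omE 0 1)
  (Do 1 0 1) (Do 0 1 1) (cod 1).
have [cl1 cl2] := closed_forms (lt0r_neq0 Delta) k0 k1 K0 K1.
split; [exact: (esym cl1) | exact: (esym cl2)].
Qed.

End IsothermalForms.

(** Local primitives of the two forms are the components of a map whose Jacobian
    matrix has the forms as columns. *)
Lemma coframe_coordinates (R : realType) (V : set 'rV[R]_2) (q0 : 'rV[R]_2)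
    (al be : 'I_2 -> 'rV[R]_2 -> R^o) : open V -> V q0 ->
  (forall k i, Ck_on k V (al i)) -> (forall k i, Ck_on k V (be i)) ->
  (forall q, V q -> pd 0 (al 1) q = pd 1 (al 0) q) ->
  (forall q, V q -> pd 0 (be 1) q = pd 1 (be 0) q) ->
  al 0 q0 * be 1 q0 - al 1 q0 * be 0 q0 != 0 ->
  exists (B : set 'rV[R]_2) (psi chi : 'rV[R]_2 -> 'rV[R]_2),
  [/\ [/\ open B, B q0 & B `<=` V], open (psi @` B),
      forall q, B q -> chi (psi q) = q,
      smooth_on B psi /\ smooth_on (psi @` B) chi
    & forall q, B q -> forall i, pd i psi q 0 0 = al i q /\ pd i psi q 0 1 = be i q].
Proof.
move=> oV Vq0 sal sbe cal cbe Delta.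
have [e1 [u [e10 e1V du]]] := poincare oV Vq0 (sal 1%N) cal.
have [e2 [v [e20 e2V dv]]] := poincare oV Vq0 (sbe 1%N) cbe.
pose e := Num.min e1 e2; have e0 : 0 < e by rewrite lt_min e10.
have B1 : ball q0 e `<=` ball q0 e1 by apply: le_ball; rewrite ge_min lexx.
have B2 : ball q0 e `<=` ball q0 e2 by apply: le_ball; rewrite ge_min lexx orbT.
have oB : open (ball q0 e) by exact: ball_open.
have BV : ball q0 e `<=` V by move=> q /B1 /e1V.
have smooth (f : 'rV[R]_2 -> R^o) (a : 'I_2 -> 'rV[R]_2 -> R^o) :
    (forall k i, Ck_on k V (a i)) ->
    (forall i q, ball q0 e q -> is_derive q (E2 i) f (a i q)) ->
    forall k, Ck_on k (ball q0 e) f.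
  move=> sa df; have cf q : ball q0 e q -> {for q, continuous f}.
    move=> Bq; apply: differentiable_continuous.
    apply: (@C1_differentiable R (ball q0 e) f q oB Bq).
      by move=> i z Bz; exact: is_derive_derivable (df i z Bz).
    move=> i; apply: (@continuous_eq_on R R^o (ball q0 e) (a i) _ q oB Bq).
      by move=> p Bp; rewrite (pd_is_derive (df i p Bp)).
    exact: (Ck_on_continuous (BV q Bq) (sa 0%N i)).
  case=> [|k]; first by split=> // q; exact: cf.
  apply: (@Ck_on_intro R R^o k _ f a oB cf df) => i.
  exact: Ck_on_sub BV (sa k i).
have du' i q : ball q0 e q -> is_derive q (E2 i) u (al i q).
  by move=> /B1; exact: du.
have dv' i q : ball q0 e q -> is_derive q (E2 i) v (be i q).
  by move=> /B2; exact: dv.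
have su := smooth u al sal du'; have sv := smooth v be sbe dv'.
pose psi q : 'rV[R]_2 := \row_j (if j == 0 then u q else v q).
have psi0 : (fun r => psi r 0 0 : R^o) = u by apply/funext => r; rewrite mxE.
have psi1 : (fun r => psi r 0 1 : R^o) = v by apply/funext => r; rewrite mxE.
have spsi : smooth_on (ball q0 e) psi.
  move=> k; apply/(Ck_on_rV k psi oB); apply: forall_I2.
    by rewrite psi0; exact: su.
  by rewrite psi1; exact: sv.
have J q : ball q0 e q -> forall i, pd i psi q 0 0 = al i q /\ pd i psi q 0 1 = be i q.
  move=> Bq i; have d : derivable psi q (E2 i).
    exact: Ck_on_derivable Bq (spsi 1%N).
  rewrite !(pd_coord _ d) psi0 psi1.
  by rewrite (pd_is_derive (du' i q Bq)) (pd_is_derive (dv' i q Bq)).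
have Bq0 : ball q0 e q0 by exact: ballxx.
have det0 : \det (jac psi q0) != 0.
  have j0 i : jac psi q0 i 0 = al i q0 := etrans (jacE psi q0 i 0) (J q0 Bq0 i).1.
  have j1 i : jac psi q0 i 1 = be i q0 := etrans (jacE psi q0 i 1) (J q0 Bq0 i).2.
  rewrite det2 (j0 0) (j0 1) (j1 0) (j1 1).
  by rewrite [X in _ - X]mulrC.
have [B [chi [[oB' Bq BB] oI chiK schi]]] := inverse_function oB Bq0 spsi det0.
exists B, psi, chi; split.
- by split=> // q /BB /BV.
- exact: oI.
- exact: chiK.
- by split=> // k; exact: Ck_on_sub BB (spsi k).
- by move=> q /BB; exact: J.
Qed.

(** * The structure equations in isothermal coordinates *)

Lemma isothermal_pairings_algebra (R : realType)
    (m m0 m1 x000 x001 x010 x011 x110 x111 x100 x101 : R) :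
  x000 + x000 = (0 == 0 :> 'I_2)%:R * (2 * m * m0) ->
  x100 + x100 = (0 == 0 :> 'I_2)%:R * (2 * m * m1) ->
  x001 + x010 = (0 == 1 :> 'I_2)%:R * (2 * m * m0) ->
  x101 + x110 = (0 == 1 :> 'I_2)%:R * (2 * m * m1) ->
  x011 + x011 = (1 == 1 :> 'I_2)%:R * (2 * m * m0) ->
  x111 + x111 = (1 == 1 :> 'I_2)%:R * (2 * m * m1) ->
  x100 = x010 -> x101 = x011 ->
  [/\ x000 = m * m0 /\ x001 = - (m * m1),
      x010 = m * m1 /\ x011 = m * m0
    & x110 = - (m * m0) /\ x111 = m * m1].
Proof.
rewrite !eqxx !mul1r !mul0r => h0 h1 h2 h3 h4 h5 e0 e1.
rewrite e0 in h1; rewrite e1 in h3.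
have two (x y : R) : x + x = 2 * m * y -> x = m * y by lra.
have a := two _ _ h0; have b := two _ _ h1; have c := two _ _ h4; have d := two _ _ h5.
by split; split=> //; lra.
Qed.

Lemma isothermal_gauss_algebra (R : realType) (n : nat) (m x y t0 t1 d : R)
    (v a b X w z : 'rV[R]_n) (e : bool) : 0 < m ->
  v = t0 *: a + t1 *: b - d *: X + w ->
  t0 = ((1 == 1 :> 'I_2)%:R * m ^+ 2 * (m * x) - (0 == 1 :> 'I_2)%:R * m ^+ 2 * (m * y))
    / ((0 == 0 :> 'I_2)%:R * m ^+ 2 * ((1 == 1 :> 'I_2)%:R * m ^+ 2)
       - (0 == 1 :> 'I_2)%:R * m ^+ 2 * ((0 == 1 :> 'I_2)%:R * m ^+ 2)) ->
  t1 = ((0 == 0 :> 'I_2)%:R * m ^+ 2 * (m * y) - (0 == 1 :> 'I_2)%:R * m ^+ 2 * (m * x))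
    / ((0 == 0 :> 'I_2)%:R * m ^+ 2 * ((1 == 1 :> 'I_2)%:R * m ^+ 2)
       - (0 == 1 :> 'I_2)%:R * m ^+ 2 * ((0 == 1 :> 'I_2)%:R * m ^+ 2)) ->
  d = e%:R * m ^+ 2 -> w = z ->
  v = (x / m) *: a + (y / m) *: b - (e%:R * m ^+ 2) *: X + z.
Proof.
move=> m0 -> -> -> -> ->; have mn := lt0r_neq0 m0.
rewrite !eqxx (_ : (0 == 1 :> 'I_2) = false) // !mul1r !mul0r !subr0.
have -> : m ^+ 2 * (m * x) / (m ^+ 2 * m ^+ 2) = x / m by field.
by have -> : m ^+ 2 * (m * y) / (m ^+ 2 * m ^+ 2) = y / m by field.
Qed.

Section GaussPairing.
Context {R : realType} {n s : nat}.
Local Notation dot := (pdot s).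
Variables (x a b c v0 v1 v2 : 'rV[R]_n) (m m0 m1 : R).
Hypotheses (mn : m != 0) (aa : dot a a = (0 == 0 :> 'I_2)%:R * m ^+ 2)
  (ab : dot a b = (0 == 1 :> 'I_2)%:R * m ^+ 2)
  (bb : dot b b = (1 == 1 :> 'I_2)%:R * m ^+ 2).
Hypotheses (ax : dot a x = 0) (bx : dot b x = 0) (xx : dot x x = 1)
  (cx : dot c x = 0) (ca : dot c a = 0) (cb : dot c b = 0) (cc : dot c c = 0).

Lemma gauss_pairing0 :
  v0 = (m0 / m) *: a - (m1 / m) *: b - (m ^+ 2) *: x + c ->
  v2 = - ((m0 / m) *: a) + (m1 / m) *: b - (m ^+ 2) *: x - c ->
  dot v0 v2 = - (m0 * m0) - m1 * m1 + m ^+ 4.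
Proof.
move=> -> ->; rewrite !(pdotlE, pdotrE) (pdotC b a) (pdotC x a) (pdotC x b)
  (pdotC x c) (pdotC a c) (pdotC b c) aa ab bb ax bx xx cx ca cb cc.
by rewrite !eqxx (_ : (0 == 1 :> 'I_2) = false) //= !mul1r !mul0r; field.
Qed.

Lemma gauss_pairing1 : v1 = (m1 / m) *: a + (m0 / m) *: b ->
  dot v1 v1 = m0 * m0 + m1 * m1.
Proof.
move=> ->; rewrite !(pdotlE, pdotrE) (pdotC b a) aa ab bb.
by rewrite !eqxx (_ : (0 == 1 :> 'I_2) = false) //= !mul1r !mul0r; field.
Qed.

End GaussPairing.

Lemma gauss_final (R : realType) (m m0 m1 m00 m11 T z0 z1 : R) : m != 0 ->
  T + z0 = - (m1 * m1 + m * m11) -> T + z1 = m0 * m0 + m * m00 ->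
  z0 = - (m0 * m0) - m1 * m1 + m ^+ 4 -> z1 = m0 * m0 + m1 * m1 ->
  - m^-1 * m^-1 * m0 * m0 + m^-1 * m00 + (- m^-1 * m^-1 * m1 * m1 + m^-1 * m11)
   = - m ^+ 2.
Proof.
move=> mn h0 h1 e0 e1.
have H : m * (m00 + m11) = m0 * m0 + m1 * m1 - m ^+ 4.
  rewrite e0 in h0; rewrite e1 in h1.
  have -> : m * (m00 + m11) = (m0 * m0 + m * m00) - m0 * m0 - m1 * m1
    - (- (m1 * m1 + m * m11)) by ring.
  by rewrite -h0 -h1; ring.
transitivity ((m * (m00 + m11) - m0 * m0 - m1 * m1) / (m * m)); first by field.
by rewrite H; field.
Qed.

Section IsothermalEquations.
Context {R : realType} {n s : nat} {V : set 'rV[R]_2}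
  {Y : 'rV[R]_2 -> 'rV[R]_n.+1}.
Hypothesis pY : is_patch s V Y.
Implicit Types (q : 'rV[R]_2) (i j k l : 'I_2).
Local Notation dot := (pdot s).
Local Notation oV := (patch_open pY).
Local Notation YY i j := (pd i (pd j Y)).
Variables (mu : 'rV[R]_2 -> R^o) (c : 'rV[R]_n.+1).
Hypothesis smu : forall l : nat, Ck_on l V mu.
Hypothesis mu0 : forall q, V q -> 0 < mu q.
Hypothesis metric : forall q, V q -> forall i j,
  dot (pd i Y q) (pd j Y q) = (i == j)%:R * mu q ^+ 2.
Hypothesis sff00 : forall q, V q -> sff (s := s) (X := Y) 0 0 q = c.
Hypothesis sff01 : forall q, V q -> sff (s := s) (X := Y) 0 1 q = 0.
Hypothesis sff11 : forall q, V q -> sff (s := s) (X := Y) 1 1 q = - c.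
Hypothesis c0 : dot c c = 0.

Let dmu i q : V q -> is_derive q (E2 i) mu (pd i mu q).
Proof. by move=> Vq; exact: is_derive_pd (Ck_on_derivable Vq (smu 1%N)). Qed.

Let d_metric k i j q : V q ->
  dot (YY k i q) (pd j Y q) + dot (YY k j q) (pd i Y q)
   = (i == j)%:R * (2 * mu q * pd k mu q).
Proof.
move=> Vq.
have d1 := is_derive_pdot (s := s) (d2X pY k i Vq) (d2X pY k j Vq).
have d2 := is_derive_mul (is_derive_cst ((i == j)%:R : R^o) q (E2 k))
  (is_derive_mul (dmu k Vq) (dmu k Vq)).
have E p : V p -> dot (pd i Y p) (pd j Y p) = (i == j)%:R * (mu p * mu p).
  by move=> Vp; rewrite -expr2; exact: metric.
have e3 := @pd_eq_on R R^o V (fun p => dot (pd i Y p) (pd j Y p))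
    (fun p => (i == j)%:R * (mu p * mu p)) q k oV Vq E.
apply: etrans (congr1 (fun z => _ + z) (pdotC _ _)) _.
have e4 := etrans (etrans (esym (pd_is_derive d1)) e3) (pd_is_derive d2).
apply: etrans e4 _.
by move: (pd k mu q) (mu q) => x y; rewrite /cst /=; ring.
Qed.

(** Solve the derivatives of the metric for the pairings, as for Christoffel
    symbols. *)
Lemma isothermal_pairings q : V q ->
  [/\ dot (YY 0 0 q) (pd 0 Y q) = mu q * pd 0 mu q /\
      dot (YY 0 0 q) (pd 1 Y q) = - (mu q * pd 1 mu q),
      dot (YY 0 1 q) (pd 0 Y q) = mu q * pd 1 mu q /\
      dot (YY 0 1 q) (pd 1 Y q) = mu q * pd 0 mu q
    & dot (YY 1 1 q) (pd 0 Y q) = - (mu q * pd 0 mu q) /\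
      dot (YY 1 1 q) (pd 1 Y q) = mu q * pd 1 mu q].
Proof.
move=> Vq.
have X10 l : dot (YY 1 0 q) (pd l Y q) = dot (YY 0 1 q) (pd l Y q).
  exact: (congr1 (fun v => dot v (pd l Y q)) (XXC pY 1 0 Vq)).
exact: (isothermal_pairings_algebra (d_metric 0 0 0 Vq) (d_metric 1 0 0 Vq)
  (d_metric 0 0 1 Vq) (d_metric 1 0 1 Vq) (d_metric 0 1 1 Vq) (d_metric 1 1 1 Vq)
  (X10 0) (X10 1)).
Qed.

Lemma isothermal_gauss_formula i j q (x y : R) z : V q ->
  dot (YY i j q) (pd 0 Y q) = mu q * x -> dot (YY i j q) (pd 1 Y q) = mu q * y ->
  sff (s := s) (X := Y) i j q = z ->
  YY i j q = (x / mu q) *: pd 0 Y q + (y / mu q) *: pd 1 Y q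
    - ((i == j)%:R * mu q ^+ 2) *: Y q + z.
Proof.
move=> Vq ex ey ez.
have [t0 t1] := tcoefE (metric Vq 0 0) (metric Vq 0 1) (metric Vq 1 1) ex ey.
have H := (isothermal_gauss_algebra (mu0 Vq) (gauss_formula pY i j Vq) t0 t1
  (metric Vq i j) ez).
exact: H.
Qed.

Lemma isothermal_system q : V q ->
  [/\ pd 0 (pd 0 Y) q = (pd 0 mu q / mu q) *: pd 0 Y q
         - (pd 1 mu q / mu q) *: pd 1 Y q - (mu q ^+ 2) *: Y q + c,
      pd 1 (pd 0 Y) q = (pd 1 mu q / mu q) *: pd 0 Y q
         + (pd 0 mu q / mu q) *: pd 1 Y q
    & pd 1 (pd 1 Y) q = - ((pd 0 mu q / mu q) *: pd 0 Y q)
         + (pd 1 mu q / mu q) *: pd 1 Y q - (mu q ^+ 2) *: Y q - c].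
Proof.
move=> Vq; have [[a0 a1] [b0 b1] [e0 e1]] := isothermal_pairings Vq.
rewrite -mulrN in a1; rewrite -mulrN in e0.
have H0 := isothermal_gauss_formula Vq a0 a1 (sff00 Vq).
have H1 := isothermal_gauss_formula Vq b0 b1 (sff01 Vq).
have H2 := isothermal_gauss_formula Vq e0 e1 (sff11 Vq).
split.
- by apply: etrans H0 _; rewrite eqxx mul1r mulNr scaleNr.
- apply: etrans (XXC pY 1 0 Vq) _; apply: etrans H1 _.
  by rewrite mul0r scale0r subr0 addr0.
- by apply: etrans H2 _; rewrite eqxx mul1r mulNr scaleNr.
Qed.

(** Gauss equation: subtract the [u]-derivative of [<Y_uv, Y_v>] from the
    [v]-derivative of [<Y_uu, Y_v>].  The third derivatives cancel, and the vector
    [c] does not contribute to [<Y_uu, Y_vv>] since it is null and normal. *)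
Lemma isothermal_gauss q : V q ->
  pd 0 (pd 0 (fun r => ln (mu r) : R^o)) q + pd 1 (pd 1 (fun r => ln (mu r) : R^o)) q
   = - (mu q ^+ 2).
Proof.
move=> Vq; have m0 := mu0 Vq; have mn := lt0r_neq0 m0.
have dl i p : V p -> pd i (fun r => ln (mu r) : R^o) p = (mu p)^-1 * pd i mu p.
  by move=> Vp; exact: (pd_is_derive (is_derive_ln (mu0 Vp) (dmu i Vp))).
have dmu2 i : is_derive q (E2 i) (pd i mu) (pd i (pd i mu) q).
  exact: is_derive_pd (Ck_on_derivable Vq (Ck_on_pd i (smu 2%N))).
have ddl i : pd i (pd i (fun r => ln (mu r) : R^o)) q
    = - (mu q)^-1 * (mu q)^-1 * pd i mu q * pd i mu q + (mu q)^-1 * pd i (pd i mu) q.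
  apply: etrans (pd_eq_on i oV Vq (fun p Vp => dl i p Vp)) _.
  exact: (pd_is_derive (is_derive_mul (is_derive_inv mn (dmu i Vq)) (dmu2 i))).
have d3 i j k : is_derive q (E2 i) (YY j k) (pd i (YY j k) q) by exact: (d3X pY i j k Vq).
have p1 : dot (pd 1 (YY 0 0) q) (pd 1 Y q) + dot (YY 0 0 q) (YY 1 1 q)
   = - (pd 1 mu q * pd 1 mu q + mu q * pd 1 (pd 1 mu) q).
  have d1 := is_derive_pdot (s := s) (d3 1 0 0) (d2X pY 1 1 Vq).
  have d2 := is_deriveN (is_derive_mul (dmu 1 Vq) (dmu2 1)).
  have E p : V p -> dot (YY 0 0 p) (pd 1 Y p) = - (mu p * pd 1 mu p).
    by move=> Vp; have [[_ H] _ _] := isothermal_pairings Vp.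
  have e3 := @pd_eq_on R R^o V (fun p => dot (YY 0 0 p) (pd 1 Y p))
    (fun p => - (mu p * pd 1 mu p)) q 1 oV Vq E.
  exact: (etrans (etrans (esym (pd_is_derive d1)) e3) (pd_is_derive d2)).
have p0 : dot (pd 0 (YY 0 1) q) (pd 1 Y q) + dot (YY 0 1 q) (YY 0 1 q)
   = pd 0 mu q * pd 0 mu q + mu q * pd 0 (pd 0 mu) q.
  have d1 := is_derive_pdot (s := s) (d3 0 0 1) (d2X pY 0 1 Vq).
  have d2 := is_derive_mul (dmu 0 Vq) (dmu2 0).
  have E p : V p -> dot (YY 0 1 p) (pd 1 Y p) = mu p * pd 0 mu p.
    by move=> Vp; have [_ [_ H] _] := isothermal_pairings Vp.
  have e3 := @pd_eq_on R R^o V (fun p => dot (YY 0 1 p) (pd 1 Y p))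
    (fun p => mu p * pd 0 mu p) q 0 oV Vq E.
  exact: (etrans (etrans (esym (pd_is_derive d1)) e3) (pd_is_derive d2)).
have S : pd 1 (YY 0 0) q = pd 0 (YY 0 1) q.
  apply: etrans (schwarz_rV 1 0 oV Vq (Ck_on_pd 0 (patch_smooth pY 3%N))) _.
  exact: (pd_eq_on 0 oV Vq (fun p Vp => XXC pY 1 0 Vp)).
have p1' := etrans (congr1 (fun v => dot v (pd 1 Y q) + dot (YY 0 0 q) (YY 1 1 q)) (esym S)) p1.
have [H0 H1 H2] := isothermal_system Vq.
have H1' := etrans (XXC pY 0 1 Vq) H1.
have [[a0 a1] [b0 b1] [e0 e1]] := isothermal_pairings Vq.
have N0 : dot c (pd 0 Y q) = 0.
  by rewrite -(sff00 Vq); exact: (pdot_sff_Xk pY 0 0 0 Vq).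
have N1 : dot c (pd 1 Y q) = 0.
  by rewrite -(sff00 Vq); exact: (pdot_sff_Xk pY 0 0 1 Vq).
have Nx : dot c (Y q) = 0.
  by rewrite -(sff00 Vq); exact: (pdot_sff_X pY 0 0 Vq).
have q0 : dot (YY 0 0 q) (YY 1 1 q) = - (pd 0 mu q * pd 0 mu q)
    - pd 1 mu q * pd 1 mu q + mu q ^+ 4.
  exact: (gauss_pairing0 mn (metric Vq 0 0) (metric Vq 0 1) (metric Vq 1 1)
    (pdot_XiX pY 0 Vq) (pdot_XiX pY 1 Vq) (patch_unit pY Vq) Nx N0 N1 c0 H0 H2).
have q1 : dot (YY 0 1 q) (YY 0 1 q) = pd 0 mu q * pd 0 mu q + pd 1 mu q * pd 1 mu q.
  exact: (gauss_pairing1 mn (metric Vq 0 0) (metric Vq 0 1) (metric Vq 1 1) H1').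
apply: etrans (congr2 (fun x y => x + y) (ddl 0) (ddl 1)) _.
exact: (gauss_final mn p1' p0 q0 q1).
Qed.

End IsothermalEquations.

(** * Change of coordinates *)

Lemma lin_coord (R : realType) (n : nat) (u v : 'rV[R]_n) (a b : R) k :
  (a *: u + b *: v) 0 k = a * u 0 k + b * v 0 k.
Proof. by rewrite !mxE. Qed.

Lemma Ck_on_comp_vector (R : realType) (n k : nat) (U W : set 'rV[R]_2)
    (f : 'rV[R]_2 -> 'rV[R]_n) (h : 'rV[R]_2 -> 'rV[R]_2) : open U -> open W ->
  (forall q, W q -> U (h q)) -> Ck_on k U f -> Ck_on k W h ->
  Ck_on k W (fun r => f (h r)).
Proof.
move=> oU oW WU sf sh; apply/(Ck_on_rV k _ oW) => c.
exact: (Ck_on_comp oU oW WU ((Ck_on_rV k f oU).1 sf c) sh).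
Qed.

Lemma gdet_conformal (R : realType) (n s : nat) (a b : 'rV[R]_n) (l : R) : 0 < l ->
  pdot s a a = l -> pdot s a b = 0 -> pdot s b b = l -> 0 < gdet s a b.
Proof. by move=> l0 e0 e1 e2; rewrite /gdet e0 e1 e2 mul0r subr0 mulr_gt0. Qed.

Lemma is_derive_comp_vector (R : realType) (n : nat) (U : set 'rV[R]_2)
    (f : 'rV[R]_2 -> 'rV[R]_n) (h : 'rV[R]_2 -> 'rV[R]_2) q i : open U ->
  Ck_on 1 U f -> U (h q) -> derivable h q (E2 i) ->
  is_derive q (E2 i) (fun r => f (h r))
    (pd i h q 0 0 *: pd 0 f (h q) + pd i h q 0 1 *: pd 1 f (h q)).
Proof.
move=> oU sf Uh dh.
have coord c : is_derive q (E2 i) (fun r => f (h r) 0 c : R^o)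
    ((pd i h q 0 0 *: pd 0 f (h q) + pd i h q 0 1 *: pd 1 f (h q)) 0 c).
  have sfc := (Ck_on_rV 1 f oU).1 sf c.
  apply: is_derive_eq (is_derive_comp_plane oU sfc Uh dh) _.
  have d j : derivable f (h q) (E2 j) by exact: Ck_on_derivable Uh sf.
  rewrite lin_coord.
  exact: (congr2 (fun x y => pd i h q 0 0 * x + pd i h q 0 1 * y)
    (esym (pd_coord c (d 0))) (esym (pd_coord c (d 1)))).
have der : derivable (fun r => f (h r)) q (E2 i).
  by apply/derivable_rV => c; exact: is_derive_derivable (coord c).
apply: DeriveDef => //; rewrite derive_mx //; apply/rowP => c.
by rewrite mxE; case: (coord c).
Qed.

(** The squares of two independent linear forms and their symmetric product are
    linearly independent. *)
Lemma quad_form0 (R : realType) (a b : 'I_2 -> R) (p q r : R) :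
  a 0 * b 1 - a 1 * b 0 != 0 ->
  (forall i j, a i * a j * p + (a i * b j + b i * a j) * q + b i * b j * r = 0) ->
  [/\ p = 0, q = 0 & r = 0].
Proof.
move=> D H; set d := a 0 * b 1 - a 1 * b 0 in D.
have key z : d * (d * z) = 0 -> z = 0.
  by move/eqP; rewrite !mulf_eq0 (negPf D) /= => /eqP.
have Q00 := H 0 0; have Q01 := H 0 1; have Q11 := H 1 1.
move: Q00 Q01 Q11 {H}; set A := (X in X = 0 -> _); set Bq := (X in _ -> X = 0 -> _);
  set C := (X in _ -> _ -> X = 0 -> _) => hA hB hC.
split; apply: key.
- transitivity (b 1 * b 1 * A - 2 * (b 0 * b 1) * Bq + b 0 * b 0 * C).
    by rewrite /A /Bq /C /d; ring.
  by rewrite hA hB hC !mulr0 subr0 addr0.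
- transitivity (- (a 1 * b 1) * A + (a 0 * b 1 + a 1 * b 0) * Bq - a 0 * b 0 * C).
    by rewrite /A /Bq /C /d; ring.
  by rewrite hA hB hC !mulr0 subr0 addr0.
- transitivity (a 1 * a 1 * A - 2 * (a 0 * a 1) * Bq + a 0 * a 0 * C).
    by rewrite /A /Bq /C /d; ring.
  by rewrite hA hB hC !mulr0 subr0 addr0.
Qed.

Lemma metric_reparam_algebra (R : realType) (n s : nat) (A0 A1 : 'rV[R]_n)
    (X : 'I_2 -> 'rV[R]_n) (a b : 'I_2 -> R) (l : R) : a 0 * b 1 - a 1 * b 0 != 0 ->
  (forall i, X i = a i *: A0 + b i *: A1) ->
  (forall i j, pdot s (X i) (X j) = l * (a i * a j + b i * b j)) ->
  [/\ pdot s A0 A0 = l, pdot s A0 A1 = 0 & pdot s A1 A1 = l].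
Proof.
move=> D XE H.
have Q i j : a i * a j * (pdot s A0 A0 - l) + (a i * b j + b i * a j) * pdot s A0 A1
    + b i * b j * (pdot s A1 A1 - l) = 0.
  have := H i j; rewrite (XE i) (XE j) !(pdotlE, pdotrE) (pdotC A1 A0) => h.
  by apply/eqP; rewrite -(subrr (l * (a i * a j + b i * b j))) -{1}h; apply/eqP; ring.
have [/eqP h0 h1 /eqP h2] := quad_form0 D Q.
by rewrite !subr_eq0 in h0 h2; split=> //; exact/eqP.
Qed.

(** The normal parts of the second derivatives are determined by their pairings
    with normal vectors, on which the first-order terms vanish; [quad_form0]
    then compares coefficients. *)
Lemma sff_reparam_algebra (R : realType) (n s : nat) (x A0 A1 c : 'rV[R]_n)
    (B00 B01 B10 B11 k00 k01 k11 : 'rV[R]_n) (X : 'I_2 -> 'rV[R]_n)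
    (XX : 'I_2 -> 'I_2 -> 'rV[R]_n) (a b : 'I_2 -> R) (da db : 'I_2 -> 'I_2 -> R) :
  unit_frame s x A0 A1 -> a 0 * b 1 - a 1 * b 0 != 0 ->
  (forall i, X i = a i *: A0 + b i *: A1) ->
  (forall j i, XX j i = da j i *: A0 + a i *: (a j *: B00 + b j *: B10)
     + (db j i *: A1 + b i *: (a j *: B01 + b j *: B11))) ->
  B10 = B01 ->
  (forall z, is_normal (s := s) x (X 0) (X 1) z -> forall i j,
    pdot s (XX i j) z = (a i * a j - b i * b j) * pdot s c z) ->
  pdot s c x = 0 -> pdot s c (X 0) = 0 -> pdot s c (X 1) = 0 ->
  k00 = nproj s x A0 A1 B00 -> k01 = nproj s x A0 A1 B01 ->
  k11 = nproj s x A0 A1 B11 ->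
  [/\ k00 = c, k01 = 0 & k11 = - c].
Proof.
move=> uf D XE XXE B10E P cx c0 c1 e00 e01 e11.
have A0E : A0 = (a 0 * b 1 - a 1 * b 0)^-1 *: (b 1 *: X 0 - b 0 *: X 1).
  by rewrite !XE; apply/rowP => j; rewrite !mxE; field.
have A1E : A1 = (a 0 * b 1 - a 1 * b 0)^-1 *: (a 0 *: X 1 - a 1 *: X 0).
  by rewrite !XE; apply/rowP => j; rewrite !mxE; field.
have cA0 : pdot s c A0 = 0 by rewrite A0E !pdotrE c0 c1 !mulr0 subrr mulr0.
have cA1 : pdot s c A1 = 0 by rewrite A1E !pdotrE c0 c1 !mulr0 subrr mulr0.
have K z : pdot s z x = 0 -> pdot s z A0 = 0 -> pdot s z A1 = 0 ->
    [/\ pdot s B00 z = pdot s c z, pdot s B01 z = 0 & pdot s B11 z = - pdot s c z].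
  move=> zx z0 z1.
  have nz : is_normal (s := s) x (X 0) (X 1) z.
    by split; rewrite ?XE ?pdotrE ?zx ?z0 ?z1 ?mulr0 ?addr0.
  have Q i j : a i * a j * (pdot s B00 z - pdot s c z)
     + (a i * b j + b i * a j) * pdot s B01 z
     + b i * b j * (pdot s B11 z + pdot s c z) = 0.
    have := P z nz i j; rewrite XXE B10E !pdotlE (pdotC A0 z) z0 (pdotC A1 z) z1 => h.
    apply/eqP; rewrite -(subrr ((a i * a j - b i * b j) * pdot s c z)) -{1}h.
    by apply/eqP; ring.
  have [/eqP h0 h1 /eqP h2] := quad_form0 D Q.
  rewrite subr_eq0 in h0; rewrite addr_eq0 in h2.
  by split=> //; exact/eqP.
have nE v := And3 (nproj_x uf v) (nproj_a uf v) (nproj_b uf v).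
have main v w : pdot s w x = 0 -> pdot s w A0 = 0 -> pdot s w A1 = 0 ->
    (forall z, pdot s z x = 0 -> pdot s z A0 = 0 -> pdot s z A1 = 0 ->
      pdot s v z = pdot s w z) -> nproj s x A0 A1 v = w.
  move=> w0 w1 w2 H; have [v0 v1 v2] := nE v.
  have vz z (z0 : pdot s z x = 0) (z1 : pdot s z A0 = 0) (z2 : pdot s z A1 = 0) :
      pdot s (nproj s x A0 A1 v) z = pdot s w z.
    by rewrite pdotC -(pdot_nproj v z0 z1 z2) pdotC H.
  move: (nproj s x A0 A1 v) v0 v1 v2 vz => u v0 v1 v2 vz.
  apply/eqP; rewrite -subr_eq0; apply/eqP.
  apply: (normal_eq0 uf); rewrite ?pdotBl ?v0 ?v1 ?v2 ?w0 ?w1 ?w2 ?subrr //.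
  by move=> z z0 z1 z2; rewrite pdotBl vz // subrr.
split.
- by rewrite e00; apply: main => // z z0 z1 z2; have [] := K z z0 z1 z2.
- rewrite e01; apply: main; rewrite ?pdot0l //.
  by move=> z z0 z1 z2; rewrite pdot0l; have [] := K z z0 z1 z2.
- rewrite e11; apply: main; rewrite ?pdotNl ?cx ?cA0 ?cA1 ?oppr0 //.
  by move=> z z0 z1 z2; rewrite pdotNl; have [] := K z z0 z1 z2.
Qed.

Section ChangeOfCoordinates.
Context {R : realType} {n s : nat} {U : set 'rV[R]_2}
  {X : 'rV[R]_2 -> 'rV[R]_n.+1}.
Hypothesis pX : is_patch s U X.
Implicit Types (q : 'rV[R]_2) (i j : 'I_2).
Local Notation dot := (pdot s).
Local Notation XX i j := (pd i (pd j X)).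
Variables (B : set 'rV[R]_2) (psi chi : 'rV[R]_2 -> 'rV[R]_2).
Variables (om : 'I_2 -> 'I_2 -> 'rV[R]_2 -> R^o) (c : 'rV[R]_n.+1)
  (al be : 'I_2 -> 'rV[R]_2 -> R^o) (lam : 'rV[R]_2 -> R^o).
Hypotheses (oB : open B) (BU : B `<=` U) (oV : open (psi @` B))
  (chiK : forall q, B q -> chi (psi q) = q)
  (spsi : smooth_on B psi) (schi : smooth_on (psi @` B) chi)
  (dpsi : forall q, B q -> forall i, pd i psi q 0 0 = al i q /\ pd i psi q 0 1 = be i q)
  (sal : forall i, Ck_on 1 B (al i)) (sbe : forall i, Ck_on 1 B (be i)).
Hypothesis hE : forall i j q, B q -> sff (s := s) (X := X) i j q = om i j q *: c.
Hypothesis diag : forall q, B q -> diagonal_forms (s := s) (X := X) om al be lam q.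
Hypothesis nc : forall q, B q -> is_normal (s := s) (X q) (pd 0 X q) (pd 1 X q) c.

Let Y := X \o chi.
Let V := psi @` B.
Local Notation YY i j := (pd i (pd j Y)).

Let sY : smooth_on V Y.
Proof.
move=> k; have VU r : V r -> U (chi r).
  by move=> [q Bq <-]; rewrite chiK //; exact: BU.
exact: (Ck_on_comp_vector (patch_open pX) oV VU (patch_smooth pX k) (schi k)).
Qed.

Let VB q : B q -> V (psi q). Proof. by exists q. Qed.

Lemma pd_reparam i q : B q ->
  pd i X q = al i q *: pd 0 Y (psi q) + be i q *: pd 1 Y (psi q).
Proof.
move=> Bq; have [<- <-] := dpsi Bq i.
have E p : B p -> X p = Y (psi p) by move=> Bp; rewrite /Y /= chiK.
apply: etrans (pd_eq_on i oB Bq E) _; apply: pd_is_derive.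
exact: (is_derive_comp_vector oV (sY 1%N) (VB Bq) (Ck_on_derivable Bq (spsi 1%N))).
Qed.

Lemma pd2_reparam j i q : B q -> XX j i q =
  pd j (al i) q *: pd 0 Y (psi q)
  + al i q *: (al j q *: YY 0 0 (psi q) + be j q *: YY 1 0 (psi q))
  + (pd j (be i) q *: pd 1 Y (psi q)
     + be i q *: (al j q *: YY 0 1 (psi q) + be j q *: YY 1 1 (psi q))).
Proof.
move=> Bq; apply: etrans (pd_eq_on j oB Bq (fun p Bp => pd_reparam i Bp)) _.
have [<- <-] := dpsi Bq j.
have dps : derivable psi q (E2 j) by exact: Ck_on_derivable Bq (spsi 1%N).
have D k := is_derive_comp_vector oV (Ck_on_pd k (sY 2%N)) (VB Bq) dps.
have da := is_derive_pd (Ck_on_derivable (i := j) Bq (sal i)).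
have db := is_derive_pd (Ck_on_derivable (i := j) Bq (sbe i)).
exact: (pd_is_derive (is_deriveD (is_derive_scale da (D 0)) (is_derive_scale db (D 1)))).
Qed.

Lemma metric_reparam q : B q -> forall i j,
  dot (pd i Y (psi q)) (pd j Y (psi q)) = (i == j)%:R * (lam q)^-1.
Proof.
move=> Bq; have [l0 Delta gE _] := diag Bq.
have H i j : dot (pd i X q) (pd j X q) = (lam q)^-1 * (al i q * al j q + be i q * be j q).
  by rewrite -gE mulKf // gt_eqF.
have [e0 e1 e2] := metric_reparam_algebra (lt0r_neq0 Delta)
  (fun i => pd_reparam i Bq) H.
have e1' := etrans (pdotC _ _) e1.
by apply: forall_I2; apply: forall_I2; rewrite ?eqxx ?mul1r ?mul0r;
  [exact: e0 | exact: e1 | exact: e1' | exact: e2].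
Qed.

Lemma patch_reparam : is_patch s V Y.
Proof.
split.
- exact: oV.
- exact: sY.
- by move=> _ [q Bq <-]; rewrite /Y /= chiK //; exact: (patch_unit pX (BU Bq)).
- move=> _ [q Bq <-]; have [l0 _ _ _] := diag Bq.
  by rewrite (metric_reparam Bq 0 0) mul1r invr_gt0.
- move=> _ [q Bq <-]; have [l0 _ _ _] := diag Bq.
  have li : 0 < (lam q)^-1 by rewrite invr_gt0.
  exact: (gdet_conformal li (etrans (metric_reparam Bq 0 0) (mul1r _))
    (etrans (metric_reparam Bq 0 1) (mul0r _)) (etrans (metric_reparam Bq 1 1) (mul1r _))).
Qed.

Lemma sff_reparam q : B q ->
  [/\ sff (s := s) (X := Y) 0 0 (psi q) = c, sff (s := s) (X := Y) 0 1 (psi q) = 0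
    & sff (s := s) (X := Y) 1 1 (psi q) = - c].
Proof.
move=> Bq; have Uq := BU Bq; have Vq := VB Bq; have pY := patch_reparam.
have [l0 Delta gE omE] := diag Bq.
have xE : Y (psi q) = X q by rewrite /Y /= chiK.
have [c0 c1 c2] := nc Bq.
have pE i : pd i X q = al i q *: pd 0 Y (psi q) + be i q *: pd 1 Y (psi q).
  exact: pd_reparam.
have := frame pY Vq; rewrite xE => uf.
have N i j : dot (sff (s := s) (X := Y) i j (psi q)) (X q) = 0.
  by have := pdot_sff_X pY i j Vq; rewrite xE.
have P z : is_normal (s := s) (X q) (pd 0 X q) (pd 1 X q) z -> forall i j,
    dot (XX i j q) z = (al i q * al j q - be i q * be j q) * dot c z.
  move=> [z0 z1 z2] i j; rewrite -omE -pdotZl.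
  apply: etrans (pdotC _ _) _; apply: etrans (pdot_nproj _ z0 z1 z2) _.
  by apply: etrans (pdotC _ _) _; exact: (congr1 (fun v => dot v z) (hE i j Bq)).
exact: (sff_reparam_algebra uf (lt0r_neq0 Delta) pE (fun i j => pd2_reparam i j Bq)
  (XXC pY 1 0 Vq) P c0 c1 c2 (congr1 (fun x => nproj s x _ _ _) xE)
  (congr1 (fun x => nproj s x _ _ _) xE) (congr1 (fun x => nproj s x _ _ _) xE)).
Qed.

End ChangeOfCoordinates.

(** * Local form of the immersion *)

(** The metric enters through the first derivatives of [Y], so that the system
    makes sense for a map that is not yet given by a chart. *)
Definition isothermal_solution (R : realType) (n s : nat) (V : set 'rV[R]_2)
    (Y : 'rV[R]_2 -> 'rV[R]_n.+1) (mu : 'rV[R]_2 -> R^o) (c : 'rV[R]_n.+1) :=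
  forall q, V q -> [/\ 0 < mu q,
    forall i j, pdot s (pd i Y q) (pd j Y q) = (i == j)%:R * mu q ^+ 2,
    [/\ pd 0 (pd 0 Y) q = (pd 0 mu q / mu q) *: pd 0 Y q
         - (pd 1 mu q / mu q) *: pd 1 Y q - (mu q ^+ 2) *: Y q + c,
      pd 1 (pd 0 Y) q = (pd 1 mu q / mu q) *: pd 0 Y q
         + (pd 0 mu q / mu q) *: pd 1 Y q
    & pd 1 (pd 1 Y) q = - ((pd 0 mu q / mu q) *: pd 0 Y q)
         + (pd 1 mu q / mu q) *: pd 1 Y q - (mu q ^+ 2) *: Y q - c]
    & pd 0 (pd 0 (fun r => ln (mu r) : R^o)) q + pd 1 (pd 1 (fun r => ln (mu r) : R^o)) q
     = - (mu q ^+ 2)].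

Section LocalIsothermal.
Context {R : realType} {n s : nat} {U : set 'rV[R]_2}
  {X : 'rV[R]_2 -> 'rV[R]_n.+1}.
Hypothesis pX : is_patch s U X.
Hypothesis nullU : forall q, U q -> null_point (s := s) (X := X) q.

Theorem local_isothermal q0 i0 j0 : U q0 -> sff (s := s) (X := X) i0 j0 q0 != 0 ->
  exists (B : set 'rV[R]_2) (psi chi : 'rV[R]_2 -> 'rV[R]_2) (mu : 'rV[R]_2 -> R^o)
    (c : 'rV[R]_n.+1),
  [/\ [/\ open B, B q0 & B `<=` U],
      [/\ open (psi @` B), forall q, B q -> chi (psi q) = q, smooth_on B psi
        & smooth_on (psi @` B) chi],
      smooth_on (psi @` B) mu, lightlike s c
    & isothermal_solution s (psi @` B) (X \o chi) mu c].
Proof.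
move=> Uq0 h0.
have [e [c [om [[e0 eU] [cc cn] s_om hE omE]]]] := constant_direction pX nullU Uq0 h0.
set W := ball q0 e in eU s_om hE omE *.
have oW : open W by exact: ball_open.
have pW := is_patch_sub pX oW eU.
have Wq0 : W q0 by exact: ballxx.
have [e' [al [be [lam [e'0 e'W sal sbe [slam diag]]]]]] :=
  exists_diagonal_forms pW s_om omE Wq0.
set W' := ball q0 e' in e'W sal sbe slam diag *.
have oW' : open W' by exact: ball_open.
have cl := diagonal_forms_closed pW omE oW' e'W (sal 1%N) (sbe 1%N) (slam 1%N) diag.
have W'q0 : W' q0 by exact: ballxx.
have Delta : al 0 q0 * be 1 q0 - al 1 q0 * be 0 q0 != 0.
  by have [_ d _ _] := diag q0 W'q0; rewrite gt_eqF.
have [B [psi [chi [[oB Bq0 BW] oV chiK [spsi schi] dpsi]]]] :=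
  coframe_coordinates oW' W'q0 sal sbe (fun q Vq => (cl q Vq).1)
    (fun q Vq => (cl q Vq).2) Delta.
have BW1 : B `<=` W by move=> q /BW /e'W.
have BU : B `<=` U by move=> q /BW1 /eU.
have nc q : B q -> is_normal (s := s) (X q) (pd 0 X q) (pd 1 X q) c.
  move=> Bq; have Uq := BU q Bq; have [_ _ det_om _] := omE q (BW1 q Bq).
  have [i [j oij]] : exists i j, om i j q != 0.
    have [z|nz] := eqVneq (om 0 1 q) 0; last by exists 0, 1.
    have [z0|nz0] := eqVneq (om 0 0 q) 0; last by exists 0, 0.
    by move: det_om; rewrite z z0 !mul0r subrr ltxx.
  have cE : c = (om i j q)^-1 *: sff (s := s) (X := X) i j q.
    by rewrite (hE i j q (BW1 q Bq)) scalerA mulVf // scale1r.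
  have nh := normal_sff pX i j Uq.
  by rewrite cE; case: nh => n0 n1 n2; split; rewrite pdotZl ?n0 ?n1 ?n2 mulr0.
have hB i j q (Bq : B q) := hE i j q (BW1 q Bq).
have dB q (Bq : B q) := diag q (BW q Bq).
have salB i := Ck_on_sub BW (sal 1%N i).
have sbeB i := Ck_on_sub BW (sbe 1%N i).
have pY : is_patch s (psi @` B) (X \o chi).
  exact: (patch_reparam pX oB BU oV chiK spsi schi dpsi dB).
pose Y := X \o chi; set V := psi @` B in oV schi pY *.
pose mu : 'rV[R]_2 -> R^o := fun r => Num.sqrt (pdot s (pd 0 Y r) (pd 0 Y r)).
have smu : smooth_on V mu.
  by move=> k; exact: (Ck_on_sqrt oV (patch_pos pY) (Ck_on_metric pY k 0 0)).
have mu0 q : V q -> 0 < mu q by move=> Vq; rewrite sqrtr_gt0; exact: (patch_pos pY).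
have mu2 q : V q -> mu q ^+ 2 = pdot s (pd 0 Y q) (pd 0 Y q).
  by move=> Vq; rewrite sqr_sqrtr // ltW //; exact: (patch_pos pY).
have metric q : V q -> forall i j,
    pdot s (pd i Y q) (pd j Y q) = (i == j)%:R * mu q ^+ 2.
  move=> Vq i j; case: (Vq) => p Bp pq.
  have M := metric_reparam pX oB BU oV chiK spsi schi dpsi dB Bp.
  have E : mu q ^+ 2 = (lam p)^-1.
    apply: etrans (mu2 q Vq) _; rewrite -pq; exact: (etrans (M 0 0) (mul1r _)).
  by rewrite E -pq; exact: M.
have S q : V q -> [/\ sff (s := s) (X := Y) 0 0 q = c,
     sff (s := s) (X := Y) 0 1 q = 0 & sff (s := s) (X := Y) 1 1 q = - c].
  move=> [p Bp <-].
  exact: (sff_reparam pX oB BU oV chiK spsi schi dpsi salB sbeB hB dB nc Bp).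
have S0 q (Vq : V q) := let: And3 h _ _ := S q Vq in h.
have S1 q (Vq : V q) := let: And3 _ h _ := S q Vq in h.
have S2 q (Vq : V q) := let: And3 _ _ h := S q Vq in h.
exists B, psi, chi, mu, c; split.
- by [].
- by [].
- exact: smu.
- by [].
- move=> q Vq; split.
  + exact: mu0.
  + exact: metric.
  + exact: (isothermal_system pY smu mu0 metric S0 S1 S2 Vq).
  + exact: (isothermal_gauss pY smu mu0 metric S0 S1 S2 cc Vq).
Qed.

End LocalIsothermal.

(** * Harmonicity in isothermal coordinates *)

Section GaussVelocity.
Context {R : realType} {n : nat} (s : nat).
Variables (x y z Y0 A B c v w0 w1 : 'rV[R]_n) (m0 m1 m i : R) (k k' : R).
Local Notation T u v w := (tri s u v w x y z).

Lemma gauss_velocity0 : w0 = (m0 / m) *: A - (m1 / m) *: B - k *: Y0 + c ->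
  v = (m1 / m) *: A + (m0 / m) *: B ->
  (T A A B + T Y0 w0 B + T Y0 A v) * i + T Y0 A B * (- 2 * (m0 / m) * i)
   = T Y0 c B * i.
Proof. by move=> -> ->; rewrite /tri /det33 !pdotlE; ring. Qed.

Lemma gauss_velocity1 : v = (m1 / m) *: A + (m0 / m) *: B ->
  w1 = - ((m0 / m) *: A) + (m1 / m) *: B - k *: Y0 - c ->
  (T B A B + T Y0 v B + T Y0 A w1) * i + T Y0 A B * (- 2 * (m1 / m) * i)
   = T Y0 c A * i.
Proof. by move=> -> ->; rewrite /tri /det33 !pdotlE; ring. Qed.

Lemma gauss_acceleration : v = (m1 / m) *: A + (m0 / m) *: B ->
  w0 = (m1 / m) *: A + (m0 / m) *: B ->
  (T A c B + T Y0 0 B + T Y0 c v) * i + T Y0 c B * (- 2 * (m0 / m) * i)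
  + ((T B c A + T Y0 0 A + T Y0 c w0) * i + T Y0 c A * (- 2 * (m1 / m) * i)) = 0.
Proof. by move=> -> ->; rewrite /tri /det33 !pdotlE; ring. Qed.

End GaussVelocity.

Section HarmonicTriple.
Context {R : realType} {n s : nat} {V : set 'rV[R]_2}
  {Y : 'rV[R]_2 -> 'rV[R]_n.+1} {mu : 'rV[R]_2 -> R^o} {c : 'rV[R]_n.+1}.
Hypotheses (oV : open V) (sY : smooth_on V Y) (smu : smooth_on V mu).
Hypothesis sol : isothermal_solution s V Y mu c.
Variables (x y z : 'rV[R]_n.+1).
Local Notation T u v w := (tri s u v w x y z).

(** The component of the Gauss map in isothermal coordinates, where the area
    factor is [mu^2]. *)
Definition isothermal_gauss_map : 'rV[R]_2 -> R^o := fun q =>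
  T (Y q) (pd 0 Y q) (pd 1 Y q) * (mu q ^- 2).

Let inv2 : 'rV[R]_2 -> R^o := fun q => mu q ^- 2.

Let mu0 q : V q -> mu q != 0.
Proof. by move=> /sol[h _ _ _]; rewrite gt_eqF. Qed.

Let sinv k : Ck_on k V inv2.
Proof.
have H := Ck_onV oV mu0 (smu k).
apply: Ck_on_eq oV _ (Ck_onM oV H H) => q _.
by rewrite /inv2 expr2 invfM.
Qed.

Let dinv i q : V q -> is_derive q (E2 i) inv2 (- 2 * (pd i mu q / mu q) * inv2 q).
Proof.
move=> Vq; have mn := mu0 Vq.
have d := is_derive_inv mn (is_derive_pd (Ck_on_derivable (i := i) Vq (smu 1%N))).
have := is_derive_mul d d.
rewrite (_ : (fun r => _ * _) = inv2); last first.
  by apply/funext => r; rewrite /inv2 expr2 invfM.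
move=> H; apply: is_derive_eq H _; rewrite /inv2 expr2.
by move: (pd i mu q) (mu q) mn => a b b0; field.
Qed.

Let dY i q : V q -> is_derive q (E2 i) Y (pd i Y q).
Proof. by move=> Vq; exact: is_derive_pd (Ck_on_derivable Vq (sY 1%N)). Qed.

Let d2Y i j q : V q -> is_derive q (E2 i) (pd j Y) (pd i (pd j Y) q).
Proof. by move=> Vq; exact: is_derive_pd (Ck_on_derivable Vq (Ck_on_pd j (sY 2%N))). Qed.

Lemma Ck_on_isothermal_gauss_map k : Ck_on k V isothermal_gauss_map.
Proof.
exact: (Ck_onM oV (Ck_on_tri s x y z oV (sY k) (Ck_on_pd 0 (sY k.+1))
  (Ck_on_pd 1 (sY k.+1))) (sinv k)).
Qed.

Let YYC q : V q -> pd 0 (pd 1 Y) q = pd 1 (pd 0 Y) q.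
Proof. by move=> Vq; exact: (schwarz_rV 0 1 oV Vq (sY 2%N)). Qed.

(** The tangential parts of the second derivatives cancel against the derivative
    of [mu^-2], and those along [Y] drop out; only [c] remains. *)
Lemma pd_isothermal_gauss_map q : V q ->
  pd 0 isothermal_gauss_map q = T (Y q) c (pd 1 Y q) * inv2 q /\
  pd 1 isothermal_gauss_map q = T (Y q) c (pd 0 Y q) * inv2 q.
Proof.
move=> Vq; have [_ _ [H0 H1 H2] _] := sol Vq.
have H1' := etrans (YYC Vq) H1.
split.
- apply: etrans (pd_is_derive (is_derive_mul (is_derive_tri s x y z (dY 0 Vq)
    (d2Y 0 0 Vq) (d2Y 0 1 Vq)) (dinv 0 Vq))) _.
  exact: (gauss_velocity0 s x y z _ H0 H1').
- apply: etrans (pd_is_derive (is_derive_mul (is_derive_tri s x y z (dY 1 Vq)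
    (d2Y 1 0 Vq) (d2Y 1 1 Vq)) (dinv 1 Vq))) _.
  exact: (gauss_velocity1 s x y z _ H1 H2).
Qed.

(** The terms [Y_u /\ c /\ Y_v] and [Y_v /\ c /\ Y_u] cancel, and the tangential parts
    of [Y_uv] are compensated by the derivatives of [mu^-2]. *)
Lemma isothermal_gauss_map_harmonic q : V q ->
  pd 0 (pd 0 isothermal_gauss_map) q + pd 1 (pd 1 isothermal_gauss_map) q = 0.
Proof.
move=> Vq; have [_ _ [H0 H1 H2] _] := sol Vq.
have H1' := etrans (YYC Vq) H1.
have P0 : pd 0 (pd 0 isothermal_gauss_map) q
   = pd 0 (fun p => T (Y p) c (pd 1 Y p) * inv2 p : R^o) q.
  exact: (pd_eq_on 0 oV Vq (fun p Vp => (pd_isothermal_gauss_map Vp).1)).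
have P1 : pd 1 (pd 1 isothermal_gauss_map) q
   = pd 1 (fun p => T (Y p) c (pd 0 Y p) * inv2 p : R^o) q.
  exact: (pd_eq_on 1 oV Vq (fun p Vp => (pd_isothermal_gauss_map Vp).2)).
have D0 := pd_is_derive (is_derive_mul (is_derive_tri s x y z (dY 0 Vq)
    (is_derive_cst c q (E2 0)) (d2Y 0 1 Vq)) (dinv 0 Vq)).
have D1 := pd_is_derive (is_derive_mul (is_derive_tri s x y z (dY 1 Vq)
    (is_derive_cst c q (E2 1)) (d2Y 1 0 Vq)) (dinv 1 Vq)).
apply: etrans (congr2 (fun u v => u + v) (etrans P0 D0) (etrans P1 D1)) _.
exact: (gauss_acceleration s x y z _ _ _ H1' H1).
Qed.

End HarmonicTriple.

(** The flux [sqrt(det g) g^ij f_j] is the Hodge star of [df], which in dimension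
    two does not involve the conformal factor [l]; the sign [sigma] of the
    Jacobian makes up for the orientation. *)
Lemma flux_algebra (R : realType) (g : 'M[R]_2) (a b : 'I_2 -> R) (l sigma f0 f1 Fu Fv : R) :
  0 < l -> (forall i j, g i j = l * (a i * a j + b i * b j)) ->
  0 < sigma * (a 0 * b 1 - a 1 * b 0) -> sigma * sigma = 1 ->
  f0 = sigma * (a 0 * Fu + b 0 * Fv) -> f1 = sigma * (a 1 * Fu + b 1 * Fv) ->
  Num.sqrt (\det g) * invmx g 0 0 * f0 + Num.sqrt (\det g) * invmx g 0 1 * f1
    = b 1 * Fu - a 1 * Fv /\
  Num.sqrt (\det g) * invmx g 1 0 * f0 + Num.sqrt (\det g) * invmx g 1 1 * f1
    = a 0 * Fv - b 0 * Fu.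
Proof.
move=> l0 gE o s1 -> ->; set D := a 0 * b 1 - a 1 * b 0 in o.
have ln := lt0r_neq0 l0.
have Dn : D != 0 by apply/eqP => D0; rewrite D0 mulr0 ltxx in o.
have sn : sigma != 0 by apply/eqP => z; rewrite z mul0r ltxx in o.
have dE : \det g = (l * (sigma * D)) ^+ 2.
  transitivity (sigma * sigma * (l * D) ^+ 2); last by ring.
  by rewrite s1 mul1r det2 !gE /D; ring.
have dn : \det g != 0.
  by rewrite dE expf_neq0 // !mulf_neq0.
have [-> -> -> ->] := invmx2 dn.
have pos : 0 < l * (sigma * D) by exact: mulr_gt0.
rewrite dE sqrtr_sqr (gtr0_norm pos) !gE.
have sV : sigma^-1 = sigma by apply: (mulfI sn); rewrite mulfV.
split; rewrite /D; field; rewrite -/D; by rewrite Dn ln sn.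
Qed.

Lemma divergence_algebra (R : realType) (a0 a1 b0 b1 a01 a10 b01 b10
    Fu Fv Fuu Fuv Fvu Fvv : R) :
  a10 = a01 -> b10 = b01 -> Fuv = Fvu -> Fuu + Fvv = 0 ->
  b10 * Fu + b1 * (a0 * Fuu + b0 * Fvu) - (a10 * Fv + a1 * (a0 * Fuv + b0 * Fvv))
  + (a01 * Fv + a0 * (a1 * Fuv + b1 * Fvv) - (b01 * Fu + b0 * (a1 * Fuu + b1 * Fvu))) = 0.
Proof.
move=> -> -> -> H; transitivity ((a0 * b1 - a1 * b0) * (Fuu + Fvv)); first by ring.
by rewrite H mulr0.
Qed.

Section ConformalInvariance.
Context {R : realType} {B V : set 'rV[R]_2} {g : 'rV[R]_2 -> 'M[R]_2}
  {psi : 'rV[R]_2 -> 'rV[R]_2} {F f : 'rV[R]_2 -> R^o} {l : 'rV[R]_2 -> R} {sigma : R}.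
Hypotheses (oV : open V) (sg : smooth_metric B g) (spsi : smooth_on B psi)
  (BV : forall q, B q -> V (psi q)).
Let al i : 'rV[R]_2 -> R^o := fun q => pd i psi q 0 0.
Let be i : 'rV[R]_2 -> R^o := fun q => pd i psi q 0 1.
Hypotheses (l0 : forall q, B q -> 0 < l q)
  (gE : forall q, B q -> forall i j,
    g q i j = l q * (pd i psi q 0 0 * pd j psi q 0 0 + pd i psi q 0 1 * pd j psi q 0 1))
  (orient : forall q, B q ->
    0 < sigma * (pd 0 psi q 0 0 * pd 1 psi q 0 1 - pd 1 psi q 0 0 * pd 0 psi q 0 1))
  (sigma1 : sigma * sigma = 1)
  (sF : Ck_on 2 V F) (fE : forall q, B q -> f q = sigma * F (psi q))
  (harm : forall q, V q -> pd 0 (pd 0 F) q + pd 1 (pd 1 F) q = 0).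

Let oB : open B. Proof. by case: sg. Qed.

Let sal k i : Ck_on k B (al i).
Proof. exact: ((Ck_on_rV k _ oB).1 (Ck_on_pd i (spsi k.+1)) 0). Qed.

Let sbe k i : Ck_on k B (be i).
Proof. exact: ((Ck_on_rV k _ oB).1 (Ck_on_pd i (spsi k.+1)) 1). Qed.

Let closed (a : 'I_2) q : B q ->
  pd 0 (fun r => pd 1 psi r 0 a : R^o) q = pd 1 (fun r => pd 0 psi r 0 a : R^o) q.
Proof.
move=> Bq; have S := schwarz_rV 0 1 oB Bq (spsi 2%N).
have D k : derivable (pd k psi) q (E2 (1 - k)).
  exact: Ck_on_derivable Bq (Ck_on_pd k (spsi 2%N)).
have D' i k : derivable (pd k psi) q (E2 i).
  exact: Ck_on_derivable Bq (Ck_on_pd k (spsi 2%N)).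
exact: (etrans (esym (pd_coord a (D' 0 1))) (etrans
  (congr1 (fun v : 'rV[R]_2 => v 0 a) S) (pd_coord a (D' 1 0)))).
Qed.

(** By [flux_algebra], the flux of [F \o psi] is the pullback of the Hodge star of
    [dF], whose divergence is a multiple of the flat Laplacian of [F]. *)
Lemma laplacian_conformal q : B q -> laplacian g f q = 0.
Proof.
move=> Bq.
have dF k p : B p -> is_derive p (E2 k) (fun r => F (psi r) : R^o)
    (al k p * pd 0 F (psi p) + be k p * pd 1 F (psi p)).
  move=> Bp; exact: (is_derive_comp_plane oV (Ck_onS sF) (BV Bp)
    (Ck_on_derivable Bp (spsi 1%N))).
have d2F k m p : B p -> is_derive p (E2 k) (fun r => pd m F (psi r) : R^o)
    (al k p * pd 0 (pd m F) (psi p) + be k p * pd 1 (pd m F) (psi p)).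
  move=> Bp; exact: (is_derive_comp_plane oV (Ck_on_pd m sF) (BV Bp)
    (Ck_on_derivable Bp (spsi 1%N))).
have df k p : B p -> pd k f p = sigma * (al k p * pd 0 F (psi p) + be k p * pd 1 F (psi p)).
  move=> Bp; apply: etrans (pd_eq_on k oB Bp fE) _; apply: pd_is_derive.
  apply: is_derive_eq (is_derive_mul (is_derive_cst (sigma : R^o) p (E2 k)) (dF k p Bp)) _.
  by rewrite mul0r add0r.
have flux p : B p ->
    flux_coef g 0 0 p * pd 0 f p + flux_coef g 0 1 p * pd 1 f p
      = be 1 p * pd 0 F (psi p) - al 1 p * pd 1 F (psi p) /\
    flux_coef g 1 0 p * pd 0 f p + flux_coef g 1 1 p * pd 1 f p
      = al 0 p * pd 1 F (psi p) - be 0 p * pd 0 F (psi p).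
  move=> Bp; exact: (flux_algebra (l0 Bp) (gE Bp) (orient Bp) sigma1 (df 0 p Bp) (df 1 p Bp)).
rewrite laplacian_flux.
have e0 := pd_eq_on 0 oB Bq (fun p Bp => (flux p Bp).1).
have e1 := pd_eq_on 1 oB Bq (fun p Bp => (flux p Bp).2).
have dal k m := is_derive_pd (Ck_on_derivable (i := k) Bq (sal 1 m)).
have dbe k m := is_derive_pd (Ck_on_derivable (i := k) Bq (sbe 1 m)).
have D0 := pd_is_derive (is_deriveB (is_derive_mul (dbe 0 1) (d2F 0 0 q Bq))
  (is_derive_mul (dal 0 1) (d2F 0 1 q Bq))).
have D1 := pd_is_derive (is_deriveB (is_derive_mul (dal 1 0) (d2F 1 1 q Bq))
  (is_derive_mul (dbe 1 0) (d2F 1 0 q Bq))).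
have S : pd 0 (pd 1 F) (psi q) = pd 1 (pd 0 F) (psi q).
  exact: (schwarz 0 1 oV (BV Bq) sF).
have H := divergence_algebra (al 0 q) (al 1 q) (be 0 q) (be 1 q) (pd 0 F (psi q))
  (pd 1 F (psi q)) (closed 0 Bq) (closed 1 Bq) S (harm (BV Bq)).
apply: etrans (congr1 (fun z => (Num.sqrt (\det (g q)))^-1 * z)
  (congr2 (fun u v => u + v) (etrans e0 D0) (etrans e1 D1))) _.
exact: (etrans (congr1 (fun z => (Num.sqrt (\det (g q)))^-1 * z) H) (mulr0 _)).
Qed.

End ConformalInvariance.

(** * Components of the Gauss map *)

Section Alternating.
Context {R : realType} {n : nat}.
Variables (L : 'rV[R]_n -> 'rV[R]_n -> 'rV[R]_n -> R) (e : 'I_n -> 'rV[R]_n)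
  (co : 'rV[R]_n -> 'I_n -> R).
Hypotheses (L_lin : forall k a d b c, L (k *: d + a) b c = k * L d b c + L a b c)
  (L12 : forall a b c, L b a c = - L a b c) (L23 : forall a b c, L a c b = - L a b c)
  (span : forall a, a = \sum_i co a i *: e i)
  (base : forall i j k : 'I_n, (i < j < k)%N -> L (e i) (e j) (e k) = 0).

Let L0 b c : L 0 b c = 0.
Proof.
have := L_lin (-1) 0 0 b c; rewrite scaler0 addr0 mulN1r addNr; exact.
Qed.

Let repeat0 a c : L a a c = 0.
Proof.
have H : L a a c + L a a c = 0 by rewrite {1}L12 addNr.
by move/eqP: H; rewrite -mulr2n mulrn_eq0 /= => /eqP.
Qed.

Let all_base i j k : L (e i) (e j) (e k) = 0.
Proof.
have opp0 (x : R) : - x = 0 -> x = 0 by move=> h; rewrite -[x]opprK h oppr0.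
have [ij|ji|/val_inj ->] := ltngtP i j; last exact: repeat0.
- have [jk|kj|/val_inj ->] := ltngtP j k.
  + by apply: base; rewrite ij.
  + have [ik|ki|/val_inj ->] := ltngtP i k.
    * by apply: opp0; rewrite -L23 base // ik.
    * by rewrite L23 L12 opprK base // ki.
    * by apply: opp0; rewrite -L23 repeat0.
  + by apply: opp0; rewrite -L12 L23 repeat0 oppr0.
- have [ik|ki|/val_inj ->] := ltngtP i k.
  + by apply: opp0; rewrite -L12 base // ji.
  + have [jk|kj|/val_inj ->] := ltngtP j k.
    * by rewrite L12 L23 opprK base // jk.
    * by apply: opp0; rewrite -L12 L23 L12 opprK base // kj.
    * by apply: opp0; rewrite -L12 L23 repeat0 oppr0.
  + by apply: opp0; rewrite -L23 repeat0.
Qed.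

Let extend b c : (forall i, L (e i) b c = 0) -> forall a, L a b c = 0.
Proof.
move=> H a; rewrite (span a); elim/big_rec: _ => [|i z _ ih]; first exact: L0.
by rewrite L_lin H mulr0 add0r.
Qed.

(** Permutations bring any triple of the family into increasing order, repeated
    entries give zero, and linearity extends from the family to its span. *)
Lemma alternating_zero a b c : L a b c = 0.
Proof.
have H1 j k a' : L a' (e j) (e k) = 0 by apply: extend => i; exact: all_base.
have H2 b' k a' : L a' b' (e k) = 0.
  rewrite L12; apply/eqP; rewrite oppr_eq0; apply/eqP.
  by apply: extend => i; rewrite L12 H1 oppr0.
rewrite L23 L12 opprK; apply: extend => i.
by rewrite L12 L23 opprK H2.
Qed.

End Alternating.

Section GaussComponents.
Context {R : realType} {n s : nat} {U : set 'rV[R]_2}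
  {X : 'rV[R]_2 -> 'rV[R]_n.+1}.
Hypothesis pX : is_patch s U X.
Variable g : 'rV[R]_2 -> 'M[R]_2.
Hypothesis gE : forall q, U q -> forall i j,
  g q i j = pdot s (pd i X q) (pd j X q).
Local Notation gc := (gauss_comp (s := s) (X := X)).

Lemma laplacian_gauss_comp_lin q k a d b c : U q ->
  laplacian g (gc (k *: d + a) b c) q
   = k * laplacian g (gc d b c) q + laplacian g (gc a b c) q.
Proof.
move=> Uq.
rewrite -(laplacian_lin (smooth_metric_patch pX gE) k Uq (Ck_on_gauss_comp pX 2 d b c)
  (Ck_on_gauss_comp pX 2 a b c)).
apply: (laplacian_eq_on (patch_open pX) Uq) => // p _.
have E x y z : tri s x y z (k *: d + a) b c = k * tri s x y z d b c + tri s x y z a b c.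
  by rewrite addrC tri_col1 addrC.
by rewrite /gauss_comp E mulrDl -mulrA.
Qed.

Lemma laplacian_gauss_comp_opp q a b c a' b' c' : U q ->
  (forall x y z, tri s x y z a' b' c' = - tri s x y z a b c) ->
  laplacian g (gc a' b' c') q = - laplacian g (gc a b c) q.
Proof.
move=> Uq H.
have Z : laplacian g (fun r => (-1) * gc a b c r + gc a b c r) q = 0.
  by rewrite (laplacian_lin (smooth_metric_patch pX gE) _ Uq (Ck_on_gauss_comp pX 2 a b c)
    (Ck_on_gauss_comp pX 2 a b c)) mulN1r addNr.
have Z2 : laplacian g (fun r => (-1) * gc a b c r + ((-1) * gc a b c r + gc a b c r)) q
   = - laplacian g (gc a b c) q.
  rewrite (laplacian_lin (smooth_metric_patch pX gE) _ Uq (Ck_on_gauss_comp pX 2 a b c)).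
    by rewrite mulN1r Z addr0.
  exact: (Ck_onD (patch_open pX) (Ck_onZ (-1) (patch_open pX) (Ck_on_gauss_comp pX 2 a b c))
   (Ck_on_gauss_comp pX 2 a b c)).
rewrite -Z2; apply: (laplacian_eq_on (patch_open pX) Uq) => // p _.
rewrite /gauss_comp H; set T := tri _ _ _ _ a b c; set w := _^-1.
by move: T w => T w; ring.
Qed.

(** Harmonicity of the Gauss map is given along increasing coordinate triples,
    while [harmonic_point] uses 3-vectors adapted to the frame at a point. *)
Lemma laplacian_gauss_comp_all q : U q ->
  (forall i j k : 'I_n.+1, (i < j < k)%N ->
    laplacian g (gc (dual_vec (s := s) i) (dual_vec (s := s) j) (dual_vec (s := s) k)) q = 0) ->
  forall a b c, laplacian g (gc a b c) q = 0.
Proof.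
move=> Uq; apply: (@alternating_zero R n.+1 (fun a b c => laplacian g (gc a b c) q)
  (dual_vec (s := s)) (fun a i => sgn_coord (s := s) i * a 0 i)).
- by move=> k a d b c; exact: laplacian_gauss_comp_lin.
- by move=> a b c; apply: (laplacian_gauss_comp_opp Uq) => x y z; exact: tri_swap12.
- by move=> a b c; apply: (laplacian_gauss_comp_opp Uq) => x y z; exact: tri_swap23.
- by move=> a; exact: sum_dual.
Qed.

End GaussComponents.

Lemma det3 (R : realType) (M : 'M[R]_3) : \det M =
  det33 (M 0 0) (M 0 1) (M 0 2) (M 1 0) (M 1 1) (M 1 2) (M 2 0) (M 2 1) (M 2 2).
Proof.
rewrite /det33 (expand_det_row _ 0).
have E (i j : 'I_3) : val i = val j -> i = j by exact: val_inj.
rewrite big_ord_recl big_ord_recl big_ord1 /cofactor !det2 !mxE.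
rewrite (E (lift ord0 (lift ord0 ord0)) 2) // (E (lift ord0 ord0) 1) // (E ord0 0) //.
rewrite (E (lift 0 1) 2) // (E (lift 1 0) 0) // (E (lift 1 1) 2) //.
by rewrite (E (lift 2 0) 0) // (E (lift 2 1) 1) //=; ring.
Qed.

Lemma wedge3E (R : realType) (n s : nat) (a b c : 'rV[R]_n) (t : triple n) :
  wedge3 a b c t = tri s a b c (dual_vec (s := s) (val t).1.1)
    (dual_vec (s := s) (val t).1.2) (dual_vec (s := s) (val t).2).
Proof.
by rewrite /wedge3 det3 /tri !pdot_dual !mxE !(tnth_nth 0) !(tnth_nth (val t).2).
Qed.

Lemma projection_algebra (R : realType) (n s : nat) (x v : 'rV[R]_n)
    (X : 'I_2 -> 'rV[R]_n) (G : 'M[R]_2) :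
  G 0 0 = (gdet s (X 0) (X 1))^-1 * pdot s (X 1) (X 1) ->
  G 0 1 = - ((gdet s (X 0) (X 1))^-1 * pdot s (X 0) (X 1)) ->
  G 1 0 = - ((gdet s (X 0) (X 1))^-1 * pdot s (X 1) (X 0)) ->
  G 1 1 = (gdet s (X 0) (X 1))^-1 * pdot s (X 0) (X 0) ->
  v - \sum_(k < 2) \sum_(l < 2) (G k l * pdot s v (X k)) *: X l - pdot s v x *: x
   = nproj s x (X 0) (X 1) v.
Proof.
move=> e00 e01 e10 e11; rewrite sum_I22 e00 e01 e10 e11 /nproj; congr (_ - _ - _).
rewrite /tcoef (gdetC s (X 0) (X 1)) (pdotC (X 1) (X 0)).
by apply/rowP => j; rewrite !mxE; ring.
Qed.

Lemma second_fundamental_formE (R : realType) (n s : nat)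
    (X : 'rV[R]_2 -> 'rV[R]_n.+1) q i j : gdet s (pd 0 X q) (pd 1 X q) != 0 ->
  second_fundamental_form s X q i j = sff (s := s) (X := X) i j q.
Proof.
move=> d0; have gm k l : gram s X q k l = pdot s (pd k X q) (pd l X q) by rewrite mxE.
have dE : \det (gram s X q) = gdet s (pd 0 X q) (pd 1 X q).
  rewrite det2 (gm 0 0) (gm 1 1) (gm 0 1) (gm 1 0).
  exact: (congr1 (fun z => _ - _ * z) (pdotC _ _)).
have dn : \det (gram s X q) != 0 by rewrite dE.
have [i00 i01 i10 i11] := invmx2 dn.
rewrite dE (gm 1 1) in i00; rewrite dE (gm 0 1) in i01; rewrite dE (gm 1 0) in i10.
rewrite dE (gm 0 0) in i11.
exact: (projection_algebra (X q) (pd i (pd j X) q) i00 i01 i10 i11).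
Qed.

(** * Charts *)

Section ChartTopology.
Context {R : realType} {M : topologicalType}.
Implicit Types (phi : chart R M) (p : M) (q : 'rV[R]_2).

Lemma cimg_cinv phi q : cimg phi q -> cdom phi (cinv phi q) /\ cmap phi (cinv phi q) = q.
Proof. by move=> [p dp <-]; rewrite cmapK. Qed.

Lemma open_preimage_on (T1 T2 : topologicalType) (f : T1 -> T2) (A : set T1) (C : set T2) :
  open A -> (forall a, A a -> {for a, continuous f}) -> open C ->
  open (A `&` f @^-1` C).
Proof.
move=> oA cf oC; rewrite openE => a [Aa Ca].
apply: filterI; first exact: open_nbhs_nbhs.
by apply: (cf a Aa); exact: open_nbhs_nbhs.
Qed.

(** The inverse of a chart is continuous on the open image of the chart. *)
Lemma open_chart_image phi (A : set M) : open A -> A `<=` cdom phi ->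
  open (cmap phi @` A).
Proof.
move=> oA Ad.
have -> : cmap phi @` A = cimg phi `&` cinv phi @^-1` A.
  apply/seteqP; split => [_ [p Ap <-]|q [iq Aq]].
    by split; [exists p => //; exact: Ad | rewrite /= cmapK //; exact: Ad].
  by exists (cinv phi q) => //; have [] := cimg_cinv iq.
exact: (open_preimage_on (@cimg_open R M phi) (@cinv_continuous R M phi) oA).
Qed.

Lemma reparam_chart phi (B : set 'rV[R]_2) (psi chi : 'rV[R]_2 -> 'rV[R]_2) :
  open B -> B `<=` cimg phi -> open (psi @` B) ->
  (forall q, B q -> chi (psi q) = q) -> Ck_on 0 B psi -> Ck_on 0 (psi @` B) chi ->
  exists w : chart R M, [/\ cdom w = cdom phi `&` cmap phi @^-1` B,
    cmap w = psi \o cmap phi, cinv w = cinv phi \o chi & cimg w = psi @` B].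
Proof.
move=> oB Bim oV chiK spsi schi.
pose D := cdom phi `&` cmap phi @^-1` B.
have imE : (psi \o cmap phi) @` D = psi @` B.
  apply/seteqP; split => [_ [p [dp Bp] <-]|_ [q Bq <-]]; first by exists (cmap phi p).
  have [d e] := cimg_cinv (Bim q Bq).
  by exists (cinv phi q); rewrite /= ?e //; split; rewrite //= e.
have oD : open D.
  exact: open_preimage_on (cdom_open phi) (@cmap_continuous _ _ phi) oB.
have oI : open ((psi \o cmap phi) @` D) by rewrite imE.
have K p : D p -> (cinv phi \o chi) ((psi \o cmap phi) p) = p.
  by move=> [dp Bp]; rewrite /= chiK // cmapK.
have cm p : D p -> {for p, continuous (psi \o cmap phi)}.
  move=> [dp Bp]; apply: continuous_comp; first exact: cmap_continuous.
  exact: Ck_on_continuous Bp spsi.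
have ci q : ((psi \o cmap phi) @` D) q -> {for q, continuous (cinv phi \o chi)}.
  rewrite imE => Vq; apply: continuous_comp; first exact: Ck_on_continuous Vq schi.
  by case: Vq => r Br <-; rewrite chiK //; apply: cinv_continuous; exact: Bim.
by exists (@Chart R M D (psi \o cmap phi) (cinv phi \o chi) oD oI K cm ci); split.
Qed.

Variable S : oriented_surface R M.

Lemma atlas_coordinate_system phi : atlas S phi -> coordinate_system S phi.
Proof. by move=> h psi h'; split; [exact: (atlas_smooth h h') | exact: (atlas_smooth h' h)]. Qed.

Lemma reparam_coordinate_system phi w (B : set 'rV[R]_2) (psi chi : 'rV[R]_2 -> 'rV[R]_2) :
  atlas S phi -> B `<=` cimg phi -> (forall q, B q -> chi (psi q) = q) ->
  smooth_on B psi -> smooth_on (psi @` B) chi ->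
  cdom w = cdom phi `&` cmap phi @^-1` B -> cmap w = psi \o cmap phi ->
  cinv w = cinv phi \o chi -> coordinate_system S w.
Proof.
move=> aphi Bim chiK spsi schi dE mE iE eta aeta.
have oB1 (a b : chart R M) : open (cmap a @` (cdom a `&` cdom b)).
  by apply: open_chart_image; [apply: openI; exact: cdom_open | move=> p []].
split=> k.
- have E : transition w eta = (fun q => transition phi eta (chi q)).
    by apply/funext => q; rewrite /transition iE.
  rewrite E.
  have ODV : cmap w @` (cdom w `&` cdom eta) `<=` psi @` B.
    by rewrite dE mE => _ [p [[dp Bp] ep] <-]; exists (cmap phi p).
  apply: (Ck_on_comp_vector (oB1 phi eta) (oB1 w eta) _
    (atlas_smooth aphi aeta k) (Ck_on_sub ODV (schi k))).
  rewrite dE mE => _ [p [[dp Bp] ep] <-]; rewrite /= chiK //.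
  by exists p.
- have E : transition eta w = (fun q => psi (transition eta phi q)).
    by apply/funext => q; rewrite /transition mE.
  rewrite E.
  have ODV : cmap eta @` (cdom eta `&` cdom w) `<=` cmap eta @` (cdom eta `&` cdom phi).
    by rewrite dE => _ [p [ep [dp Bp]] <-]; exists p.
  have oB : open (cimg w) by exact: cimg_open.
  have oBB : open (cmap phi @` cdom w).
    apply: open_chart_image; first exact: cdom_open.
    by rewrite dE => p [].
  have BB : cmap phi @` cdom w `<=` B by rewrite dE => _ [p [dp Bp] <-].
  apply: (Ck_on_comp_vector oBB (oB1 eta w) _ (Ck_on_sub BB (spsi k))
    (Ck_on_sub ODV (atlas_smooth aeta aphi k))).
  move=> _ [p [ep wp] <-]; rewrite /transition /= cmapK //.
  by exists p.
Qed.

End ChartTopology.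

(** The frame is that of Gram and Schmidt; its matrix is triangular with positive
    diagonal and determinant [1 / sqrt D]. *)
Lemma gram_schmidt (R : realType) (n s : nat) (a b : 'rV[R]_n) :
  0 < pdot s a a -> 0 < gdet s a b ->
  exists A : 'M[R]_2, let e1 := A 0 0 *: a + A 0 1 *: b in
    let e2 := A 1 0 *: a + A 1 1 *: b in
  [/\ 0 < \det A, pdot s e1 e1 = 1, pdot s e2 e2 = 1, pdot s e1 e2 = 0
    & forall x p q r, tri s x e1 e2 p q r = tri s x a b p q r / Num.sqrt (gdet s a b)].
Proof.
move=> E0 D0; pose E := pdot s a a; pose F := pdot s a b.
pose r := Num.sqrt E; pose w := Num.sqrt (gdet s a b).
have r0 : 0 < r by rewrite sqrtr_gt0.
have w0 : 0 < w by rewrite sqrtr_gt0.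
have rr : r * r = E by rewrite -expr2 sqr_sqrtr // ltW.
have ww : w * w = E * pdot s b b - F * F by rewrite -expr2 sqr_sqrtr // ltW.
have rn := lt0r_neq0 r0; have wn := lt0r_neq0 w0.
pose A : 'M[R]_2 := \matrix_(i, j) (if i == 0 then if j == 0 then r^-1 else 0
  else if j == 0 then - F / (r * w) else r / w).
have [A00 A01 A10 A11] : [/\ A 0 0 = r^-1, A 0 1 = 0, A 1 0 = - F / (r * w)
  & A 1 1 = r / w] by rewrite !mxE.
have GE : pdot s b b = (w * w + F * F) / (r * r).
  by rewrite ww rr addrNK mulrAC mulfV ?mul1r // gt_eqF.
exists A; rewrite A00 A01 A10 A11 /=; split.
- rewrite det2 A00 A01 A10 A11 mul0r subr0.
  by rewrite mulKf // invr_gt0.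
- rewrite !(pdotlE, pdotrE) -/E -rr !mul0r !addr0 ?mulr0 ?addr0; by field.
- rewrite !(pdotlE, pdotrE) (pdotC b a) -/E -/F GE -rr; field; by rewrite rn wn.
- rewrite !(pdotlE, pdotrE) (pdotC b a) -/E -/F -rr; field; by rewrite rn wn.
- move=> x p q t; rewrite -/w /tri /det33 !pdotlE; field; by rewrite rn wn.
Qed.

Section ChartGeometry.
Context {R : realType} {M : topologicalType} {S : oriented_surface R M} {m s : nat}
  {g : riemannian_metric S} {x : M -> 'rV[R]_m.+1}.
Hypothesis hx : isometric_immersion s g x.
Implicit Types (phi : chart R M) (p : M) (q : 'rV[R]_2).

Lemma metric_coefE phi q i j : coordinate_system S phi -> cimg phi q ->
  metric_coef g phi q i j = pdot s (pd i (x \o cinv phi) q) (pd j (x \o cinv phi) q).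
Proof.
by move=> cs iq; have [_ _ H] := hx; rewrite -(H phi cs q iq) mxE.
Qed.

(** The metric is evaluated on [(1, 0)] for the first coefficient, and on
    [(- g_01, g_00)] for the determinant. *)
Lemma chart_patch phi : coordinate_system S phi -> is_patch s (cimg phi) (x \o cinv phi).
Proof.
move=> cs; have [h1 h2 h3] := hx.
have gE q iq i j := metric_coefE (phi := phi) (q := q) i j cs iq.
have pos q : cimg phi q -> 0 < metric_coef g phi q 0 0.
  move=> iq; have e0 : (E2 0 : 'rV[R]_2) != 0.
    by apply/eqP => /(congr1 (fun v : 'rV[R]_2 => v 0 0)) /eqP; rewrite E2E mxE eqxx oner_eq0.
  have := metric_pos g cs iq e0; rewrite -rowE mxE sum_I2 !mxE /=.
  by rewrite mulr1 mulr0 addr0.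
have det q : cimg phi q -> 0 < metric_coef g phi q 0 0 * metric_coef g phi q 1 1
    - metric_coef g phi q 0 1 * metric_coef g phi q 0 1.
  move=> iq; pose a : 'rV[R]_2 := \row_j (if j == 0 then - metric_coef g phi q 0 1
    else metric_coef g phi q 0 0).
  have p0 := pos q iq.
  have a0 : a != 0.
    apply/eqP => /(congr1 (fun v : 'rV[R]_2 => v 0 1)) /eqP.
    by rewrite !mxE /= (gt_eqF p0).
  have g10 : metric_coef g phi q 1 0 = metric_coef g phi q 0 1.
    by rewrite -{1}(Defs.metric_sym g cs iq) mxE.
  have := metric_pos g cs iq a0; rewrite mxE sum_I2 !mul_rV2 !mxE /= g10.
  set E := metric_coef _ _ _ 0 0 in p0 *; set F := metric_coef _ _ _ 0 1.
  set G := metric_coef _ _ _ 1 1.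
  have -> : (- F * E + E * F) * - F + (- F * F + E * G) * E = E * (E * G - F * F) by ring.
  by rewrite pmulr_rgt0.
split.
- exact: cimg_open.
- exact: h2.
- by move=> q _; exact: h1.
- by move=> q iq; have := pos q iq; rewrite (gE q iq).
- by move=> q iq; have := det q iq; rewrite (gE q iq 0 0) (gE q iq 1 1) (gE q iq 0 1).
Qed.

Lemma nongeodesic_sff p : ~ geodesic_point S s x p ->
  exists phi i j, [/\ atlas S phi, cdom phi p
    & sff (s := s) (X := x \o cinv phi) i j (cmap phi p) != 0].
Proof.
move=> ng; apply: contrapT => H; apply: ng => phi aphi dp i j.
have pX := chart_patch (atlas_coordinate_system aphi).
have iq : cimg phi (cmap phi p) by exists p.
apply: etrans (second_fundamental_formE i j (gdet_neq0 pX iq)) _.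
by apply: contrapT => /eqP h; apply: H; exists phi, i, j.
Qed.

Variable nu : M -> Lambda3 R m.+1.
Hypothesis hnu : is_gauss_map S s x nu.

(** Evaluate the defining property of the Gauss map on the orthonormal frame of
    [gram_schmidt]. *)
Lemma gauss_map_chart phi q (t : triple m.+1) : atlas S phi -> cimg phi q ->
  nu (cinv phi q) t = gauss_comp (s := s) (X := x \o cinv phi)
    (dual_vec (s := s) (val t).1.1) (dual_vec (s := s) (val t).1.2)
    (dual_vec (s := s) (val t).2) q.
Proof.
move=> aphi iq; set X := x \o cinv phi.
have pX := chart_patch (atlas_coordinate_system aphi).
have [dp mp] := cimg_cinv iq.
have [A [dA g1 g2 g3 gT]] := gram_schmidt (patch_pos pX iq) (patch_det pX iq).
have rowA i : row i (A *m jac X q) = A i 0 *: pd 0 X q + A i 1 *: pd 1 X q.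
  by apply/rowP => c; rewrite lin_coord mxE mxE sum_I2 !jacE.
have ob : oriented_orthonormal_basis S s x (cinv phi q)
    (row 0 (A *m jac X q)) (row 1 (A *m jac X q)).
  split; [by rewrite (rowA 0) | by rewrite (rowA 1) | by rewrite (rowA 0) (rowA 1) |].
  by exists phi, A; split; [| | | rewrite mp].
rewrite (hnu ob) (wedge3E s) !rowA.
exact: (gT (X q)).
Qed.

End ChartGeometry.

(** * The equivalence *)

Lemma gdet_value (R : realType) (n s : nat) (a b : 'rV[R]_n) (l a0 a1 b0 b1 : R) :
  pdot s a a = l * (a0 * a0 + b0 * b0) -> pdot s a b = l * (a0 * a1 + b0 * b1) ->
  pdot s b b = l * (a1 * a1 + b1 * b1) ->
  gdet s a b = (l * (a0 * b1 - a1 * b0)) ^+ 2.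
Proof. by rewrite /gdet => -> -> ->; ring. Qed.

Lemma gauss_comp_value (R : realType) (n s : nat) (x x' X0 X1 A B a b d : 'rV[R]_n)
    (a0 a1 b0 b1 w sigma l : R) : x = x' ->
  X0 = a0 *: A + b0 *: B -> X1 = a1 *: A + b1 *: B ->
  w = sigma * (a0 * b1 - a1 * b0) * l -> sigma * (a0 * b1 - a1 * b0) != 0 ->
  sigma * sigma = 1 -> l != 0 ->
  tri s x X0 X1 a b d / w = sigma * (tri s x' A B a b d * l^-1).
Proof.
move=> -> -> -> -> n0 s1 l0.
have -> : tri s x' (a0 *: A + b0 *: B) (a1 *: A + b1 *: B) a b d
    = (a0 * b1 - a1 * b0) * tri s x' A B a b d.
  by rewrite /tri /det33 !pdotlE; ring.
rewrite mulf_eq0 negb_or in n0; case/andP: n0 => sn dn.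
have sV : sigma^-1 = sigma by apply: (mulfI sn); rewrite mulfV.
rewrite !invfM sV; field; by rewrite dn l0.
Qed.

Lemma tri_zero_algebra (R : realType) (n s : nat) (p q r x a b h0 h1 : 'rV[R]_n)
    (w : R) : h0 = 0 -> h1 = 0 ->
  (tri s x h0 b p q r + tri s x a h1 p q r) / w = 0.
Proof. by move=> -> ->; rewrite /tri /det33 !pdot0l; ring. Qed.

Section Equivalence.
Context {R : realType} {M : topologicalType} {S : oriented_surface R M} {m s : nat}
  {g : riemannian_metric S} {x : M -> 'rV[R]_m.+1} {nu : M -> Lambda3 R m.+1}.
Hypotheses (hx : isometric_immersion s g x) (hnu : is_gauss_map S s x nu).
Implicit Types (phi w : chart R M) (p : M) (q : 'rV[R]_2).

Theorem harmonic_isothermal p : harmonic_map g nu -> ~ geodesic_point S s x p ->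
  exists (w : chart R M) (mu : 'rV[R]_2 -> R^o) (c : 'rV[R]_m.+1),
  [/\ coordinate_system S w, cdom w p, smooth_on (cimg w) mu, lightlike s c
    & isothermal_solution s (cimg w) (x \o cinv w) mu c].
Proof.
move=> harm ng; have [phi [i [j [aphi dp hn]]]] := nongeodesic_sff hx ng.
have cs := atlas_coordinate_system aphi.
have pX := chart_patch hx cs.
have iq : cimg phi (cmap phi p) by exists p.
have gE q : cimg phi q -> forall k l, metric_coef g phi q k l
    = pdot s (pd k (x \o cinv phi) q) (pd l (x \o cinv phi) q).
  by move=> iq' k l; exact: (metric_coefE hx k l cs iq').
have nullU q : cimg phi q -> null_point (s := s) (X := x \o cinv phi) q.
  move=> Uq; apply: (harmonic_point pX gE Uq).
  apply: (laplacian_gauss_comp_all pX gE Uq) => a b c abc.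
  have h := harm phi aphi q Uq (exist _ (a, b, c) abc).
  apply: etrans h; apply: (laplacian_eq_on (patch_open pX) Uq) => // r Ur.
  exact: (esym (gauss_map_chart hx hnu (exist _ (a, b, c) abc) aphi Ur)).
have [B [psi [chi [mu [c [[oB Bp BU] [oV chiK spsi schi] smu lc sol]]]]]] :=
  local_isothermal pX nullU iq hn.
have [w [dE mE iE imE]] := reparam_chart oB BU oV chiK (spsi 0%N) (schi 0%N).
exists w, mu, c; split.
- exact: (reparam_coordinate_system aphi BU chiK spsi schi dE mE iE).
- by rewrite dE.
- by rewrite imE.
- exact: lc.
- by rewrite imE iE.
Qed.

Section Backward.
Variables (phi w : chart R M) (mu : 'rV[R]_2 -> R^o) (c : 'rV[R]_m.+1).
Hypotheses (aphi : atlas S phi) (cw : coordinate_system S w).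
Hypotheses (smu : smooth_on (cimg w) mu)
  (sol : isothermal_solution s (cimg w) (x \o cinv w) mu c).
Let X := x \o cinv phi.
Let Y := x \o cinv w.
Let psi := transition phi w.
Let B0 := cmap phi @` (cdom phi `&` cdom w).
Let cphi := atlas_coordinate_system aphi.
Let pX : is_patch s (cimg phi) X := chart_patch hx cphi.
Let pY : is_patch s (cimg w) Y := chart_patch hx cw.

Let oB0 : open B0.
Proof.
by apply: open_chart_image; [apply: openI; exact: cdom_open | move=> p []].
Qed.

Let B0U : B0 `<=` cimg phi. Proof. by move=> _ [p [dp _] <-]; exists p. Qed.

Let B0V q : B0 q -> cimg w (psi q).
Proof. by move=> [p [dp wp] <-]; exists p => //; rewrite /psi /transition /= cmapK. Qed.

Let XE q : B0 q -> X q = Y (psi q).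
Proof.
move=> [p [dp wp] <-].
by rewrite /X /Y /psi /transition /= (cmapK dp) (cmapK wp).
Qed.

Let spsi : smooth_on B0 psi. Proof. exact: (cw aphi).2. Qed.

Let metric q : B0 q -> forall i j, metric_coef g phi q i j
  = mu (psi q) ^+ 2 * (pd i psi q 0 0 * pd j psi q 0 0 + pd i psi q 0 1 * pd j psi q 0 1).
Proof.
move=> Bq i j; have Vq := B0V Bq; have [_ mY _ _] := sol Vq.
case: (Bq) => p [dp wp] pq.
have pw : cmap w p = psi q by rewrite -pq /psi /transition /= cmapK.
have H := metric_tensor g cphi cw dp wp.
rewrite /= pq pw in H; rewrite H.
have gw : metric_coef g w (psi q) = (mu (psi q) ^+ 2)%:M.
  apply/matrixP => k l; rewrite (metric_coefE hx k l cw Vq) mxE.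
  by apply: etrans (mY k l) _; rewrite mulr_natl.
rewrite gw mul_mx_scalar -scalemxAl mxE; congr (_ * _).
rewrite mxE sum_I2 !mxE; congr (_ * _ + _ * _).
Qed.

Let jdet q : R^o := pd 0 psi q 0 0 * pd 1 psi q 0 1 - pd 1 psi q 0 0 * pd 0 psi q 0 1.

Let s_jdet : Ck_on 0 B0 jdet.
Proof.
have C i j := (Ck_on_rV 0 _ oB0).1 (Ck_on_pd i (spsi 1%N)) j.
exact: (Ck_onB oB0 (Ck_onM oB0 (C 0 0) (C 1 1)) (Ck_onM oB0 (C 1 0) (C 0 1))).
Qed.

Let gdetE q : B0 q -> gdet s (pd 0 X q) (pd 1 X q) = (mu (psi q) ^+ 2 * jdet q) ^+ 2.
Proof.
move=> Bq; have iq := B0U Bq.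
have gE i j := etrans (esym (metric_coefE hx i j cphi iq)) (metric Bq i j).
exact: (gdet_value (gE 0 0) (gE 0 1) (gE 1 1)).
Qed.

Let jdet_neq0 q : B0 q -> jdet q != 0.
Proof.
move=> Bq; have := patch_det pX (B0U Bq); rewrite (gdetE Bq) => H.
by apply/eqP => z; rewrite z mulr0 expr0n ltxx in H.
Qed.

Let pd_X i q : B0 q ->
  pd i X q = pd i psi q 0 0 *: pd 0 Y (psi q) + pd i psi q 0 1 *: pd 1 Y (psi q).
Proof.
move=> Bq.
have E := pd_eq_on (f := X) (g := fun r => Y (psi r)) i oB0 Bq XE.
apply: etrans E _.
apply: pd_is_derive.
exact: (is_derive_comp_vector (patch_open pY) (patch_smooth pY 1%N) (B0V Bq)
  (Ck_on_derivable Bq (spsi 1%N))).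
Qed.

(** The transition map to the isothermal chart is conformal, so
    [laplacian_conformal] applies on a ball where its Jacobian determinant keeps
    the sign [sigma]. *)
Lemma isothermal_harmonic q a b d : B0 q ->
  laplacian (metric_coef g phi) (gauss_comp (s := s) (X := X) a b d) q = 0.
Proof.
move=> Bq.
pose sigma : R := Num.sg (jdet q).
have s1 : sigma * sigma = 1.
  by rewrite /sigma -expr2 sqr_sg (jdet_neq0 Bq).
have pos0 : 0 < sigma * jdet q by rewrite /sigma -normrEsg normr_gt0 jdet_neq0.
have sj : Ck_on 0 B0 (fun r => sigma * jdet r : R^o) by exact: (Ck_onZ sigma oB0 s_jdet).
have [e e0 He] := near_ball_sub (filterI (F := nbhs q) (near_open oB0 Bq)
  (near_gt0 (Ck_on_continuous Bq sj) pos0)).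
have BB : ball q e `<=` B0 by move=> r /He[].
have orient r : ball q e r -> 0 < sigma * jdet r by move=> /He[].
have oB : open (ball q e) by exact: ball_open.
have gE r (Ur : cimg phi r) i j := metric_coefE hx i j cphi Ur.
have sg : smooth_metric (ball q e) (metric_coef g phi).
  have [_ sg d0] := smooth_metric_patch pX gE.
  split; first exact: oB.
  - by move=> k i j; apply: Ck_on_sub (sg k i j) => r /BB /B0U.
  - by move=> r /BB /B0U; exact: d0.
have BV r : ball q e r -> cimg w (psi r) by move=> /BB; exact: B0V.
have mu0 r : ball q e r -> 0 < mu (psi r) ^+ 2.
  by move=> /BV /sol[h _ _ _]; exact: exprn_gt0.
have fE r : ball q e r -> gauss_comp (s := s) (X := X) a b d r
    = sigma * isothermal_gauss_map (s := s) (Y := Y) (mu := mu) a b d (psi r).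
  move=> Br; have B0r := BB r Br.
  have dE : Num.sqrt (gdet s (pd 0 X r) (pd 1 X r)) = sigma * jdet r * mu (psi r) ^+ 2.
    have nj : `|jdet r| = sigma * jdet r.
      by rewrite -[RHS](gtr0_norm (orient r Br)) normrM normr_sg (jdet_neq0 Bq) mul1r.
    by rewrite (gdetE B0r) sqrtr_sqr normrM nj (gtr0_norm (mu0 r Br)) mulrC.
  exact: (gauss_comp_value s a b d (XE B0r) (pd_X 0 B0r) (pd_X 1 B0r) dE
    (lt0r_neq0 (orient r Br)) s1 (lt0r_neq0 (mu0 r Br))).
have smuV k := smu k.
exact: (laplacian_conformal (patch_open pY) sg (fun k => Ck_on_sub BB (spsi k)) BV mu0
  (fun r Br => metric (BB r Br)) orient s1
  (Ck_on_isothermal_gauss_map (patch_open pY) (patch_smooth pY) smu sol a b d 2)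
  fE (fun r Vr => isothermal_gauss_map_harmonic (patch_open pY) (patch_smooth pY) smu sol a b d Vr)
  (ballxx q e0)).
Qed.

End Backward.

(** Where the second fundamental form vanishes on an open set, so do the first
    derivatives of the Gauss map. *)
Lemma geodesic_harmonic phi q (N : set 'rV[R]_2) a b d : atlas S phi -> open N ->
  N `<=` cimg phi -> N q -> (forall r, N r -> geodesic_point S s x (cinv phi r)) ->
  laplacian (metric_coef g phi) (gauss_comp (s := s) (X := x \o cinv phi) a b d) q = 0.
Proof.
move=> aphi oN NU Nq geo; have cs := atlas_coordinate_system aphi.
have pX := chart_patch hx cs.
have gE r (Ur : cimg phi r) i j := metric_coefE hx i j cs Ur.
have z r (Nr : N r) i j : sff (s := s) (X := x \o cinv phi) i j r = 0.
  have [dp mp] := cimg_cinv (NU r Nr).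
  have := geo r Nr phi aphi dp i j; rewrite mp.
  apply: etrans; apply: esym.
  exact: (second_fundamental_formE i j (gdet_neq0 pX (NU r Nr))).
have P1 j r : N r -> pd j (gauss_comp (s := s) (X := x \o cinv phi) a b d) r = 0.
  move=> Nr; apply: etrans (pd_gauss_comp pX a b d j (NU r Nr)) _.
  exact: (tri_zero_algebra s a b d _ _ _ _ (z r Nr j 0) (z r Nr j 1)).
have P2 i j : pd i (pd j (gauss_comp (s := s) (X := x \o cinv phi) a b d)) q = 0.
  have E := pd_eq_on (g := fun=> 0 : R^o) i oN Nq (P1 j).
  exact: (etrans E (pd_is_derive (is_derive_cst (0 : R^o) q (E2 i)))).
have [v E] := laplacian_expand (smooth_metric_patch pX gE) (NU q Nq).
apply: etrans (E _ (Ck_on_gauss_comp pX 2 a b d)) _.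
rewrite big1 ?add0r.
  by apply: big1 => j _; rewrite (P1 j q Nq) mulr0.
by move=> i _; apply: big1 => j _; rewrite P2 mulr0.
Qed.

(** If the Laplacian of a component were not zero at some point, it would not be
    zero nearby.  All points there would then be geodesic, by
    [isothermal_harmonic], contradicting [geodesic_harmonic]. *)
Theorem isothermal_harmonic_map :
  (forall p, ~ geodesic_point S s x p ->
    exists (w : chart R M) (mu : 'rV[R]_2 -> R^o) (c : 'rV[R]_m.+1),
    [/\ coordinate_system S w, cdom w p, smooth_on (cimg w) mu
      & isothermal_solution s (cimg w) (x \o cinv w) mu c]) ->
  harmonic_map g nu.
Proof.
move=> H phi aphi q iq t; have cs := atlas_coordinate_system aphi.
have pX := chart_patch hx cs.
have gE r (Ur : cimg phi r) i j := metric_coefE hx i j cs Ur.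
pose f := gauss_comp (s := s) (X := x \o cinv phi) (dual_vec (s := s) (val t).1.1)
  (dual_vec (s := s) (val t).1.2) (dual_vec (s := s) (val t).2).
have E : laplacian (metric_coef g phi) (fun r => nu (cinv phi r) t) q
    = laplacian (metric_coef g phi) f q.
  apply: (laplacian_eq_on (patch_open pX) iq) => // r Ur.
  exact: (gauss_map_chart hx hnu t aphi Ur).
apply: etrans E _; apply: contrapT => /eqP L0.
have cL := continuous_laplacian (smooth_metric_patch pX gE) iq (Ck_on_gauss_comp pX 2 _ _ _).
have [e e0 He] := near_ball_sub (filterI (F := nbhs q) (near_open (patch_open pX) iq)
  (near_neq0 (cL _ _ _) L0)).
have BU : ball q e `<=` cimg phi by move=> r /He[].
apply: (negP L0); apply/eqP.
have oB : open (ball q e) by exact: ball_open.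
have Bq : ball q e q by exact: ballxx.
apply: (@geodesic_harmonic phi q (ball q e) _ _ _ aphi oB BU Bq) => r Br.
apply: contrapT => ng.
have [dp mp] := cimg_cinv (BU r Br).
have [w [mu [c [cw wp smu sol]]]] := H _ ng.
have Lr : laplacian (metric_coef g phi) f r = 0.
  by apply: (isothermal_harmonic aphi cw smu sol); exists (cinv phi r).
by have [_] := He r Br; rewrite Lr eqxx.
Qed.

End Equivalence.

Theorem theorem4 (R : realType) (m s : nat) (M : topologicalType)
    (S : oriented_surface R M) (g : riemannian_metric S)
    (x : M -> 'rV[R]_m.+1) (nu : M -> Lambda3 R m.+1)
    (hs : (s <= m)%N)
    (hx : isometric_immersion s g x)
    (hng : ~ totally_geodesic S s x)
    (hnu : is_gauss_map S s x nu) :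
  harmonic_map g nu <->
  forall p : M, ~ geodesic_point S s x p ->
    exists (w : chart R M) (mu : 'rV[R]_2 -> R) (c : 'rV[R]_m.+1),
      [/\ coordinate_system S w,
          cdom w p,
          smooth_on (V := R^o) (cimg w) mu,
          lightlike s c
        & forall q : 'rV[R]_2, cimg w q ->
          let X := x \o cinv w in
          let d_u := pd 0 in
          let d_v := pd 1 in
          let mu_u := pd (V := R^o) 0 mu in
          let mu_v := pd (V := R^o) 1 mu in
          let lnmu := (fun r => ln (mu r)) : 'rV[R]_2 -> R^o in
          0 < mu q /\
          metric_coef g w q = (mu q ^+ 2)%:M /\
          d_u (d_u X) q = (mu_u q / mu q) *: d_u X q
                          - (mu_v q / mu q) *: d_v X q
                          - (mu q ^+ 2) *: X q + c /\
          d_v (d_u X) q = (mu_v q / mu q) *: d_u X q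
                          + (mu_u q / mu q) *: d_v X q /\
          d_v (d_v X) q = - ((mu_u q / mu q) *: d_u X q)
                          + (mu_v q / mu q) *: d_v X q
                          - (mu q ^+ 2) *: X q - c /\
          pd 0 (pd 0 lnmu) q + pd 1 (pd 1 lnmu) q = - (mu q ^+ 2)].
Proof.
split=> [harm p ng|H].
- have [w [mu [c [cw wp smu lc sol]]]] := harmonic_isothermal hx hnu harm ng.
  exists w, mu, c; split; [exact: cw | exact: wp | exact: smu | exact: lc |].
  move=> q wq; have [mu0 metric [H0 H1 H2] gauss] := sol q wq.
  split; first exact: mu0.
  split; last by split; [exact: H0 | split; [exact: H1 | split; [exact: H2 | exact: gauss]]].
  apply/matrixP => i j; rewrite (metric_coefE hx i j cw wq) mxE.
  by apply: etrans (metric i j) _; rewrite mulr_natl.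
- apply: (isothermal_harmonic_map hx hnu) => p ng.
  have [w [mu [c [cw wp smu lc sol]]]] := H p ng.
  exists w, mu, c; split; [exact: cw | exact: wp | exact: smu |].
  move=> q wq; have [mu0 [metric [H0 [H1 [H2 gauss]]]]] := sol q wq.
  split; [exact: mu0 | | by split | exact: gauss].
  move=> i j; rewrite -(metric_coefE hx i j cw wq) metric mxE.
  by rewrite mulr_natl.
Qed.
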